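(* Let $H\in(0,\tfrac34]$, let $S=(S_t)_{t\ge 0}$ be a subfractional Brownian motion with parameter $H$, and for $n\ge 1$ let $$Z_n=\sum_{k=0}^{n-1} n^{2H}\left[\left(S_{(k+1)/n}-S_{k/n}\right)^2-\mathrm{Var}\left(S_{(k+1)/n}-S_{k/n}\right)\right].$$ Let $N\sim\mathcal N(0,1)$ be a standard Gaussian random variable. Then there exists a constant $c_H>0$ depending only on $H$ such that $$d_{Kol}\left(\frac{Z_n}{\sqrt{\mathrm{Var}(Z_n)}},N\right)\le c_H\times\begin{cases}\dfrac{1}{\sqrt n}, & H\in\left(0,\tfrac58\right),\\[2mm] \dfrac{(\log n)^{3/2}}{\sqrt n}, & H=\tfrac58,\\[2mm] n^{4H-3}, & H\in\left(\tfrac58,\tfrac34\right),\\[2mm] \dfrac{1}{\log n}, & H=\tfrac34,\end{cases}$$ for every integer $n\ge 1$ when $H\notin\{\tfrac58,\tfrac34\}$, and for every integer $n\ge 2$ when $H\in\{\tfrac58,\tfrac34\}$.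
   Context: A subfractional Brownian motion with parameter $H\in(0,1)$ is a centered Gaussian process $S=(S_t)_{t\ge 0}$, defined on some probability space $(\Omega,\mathcal F,P)$, with covariance $$\mathbb E[S_sS_t]=s^{2H}+t^{2H}-\tfrac12\left[(s+t)^{2H}+|t-s|^{2H}\right],\qquad s,t\ge 0.$$ For real random variables $X,Y$, the Kolmogorov distance is $d_{Kol}(X,Y)=\sup_{z\in\mathbb R}|P(X\le z)-P(Y\le z)|$. *)

(* Defs.v *)
From HB Require Import structures.
From mathcomp Require Import all_boot all_order all_algebra.
From mathcomp Require Import all_classical all_reals all_analysis.

Set Implicit Arguments.
Unset Strict Implicit.
Unset Printing Implicit Defensive.

Import Order.TTheory GRing.Theory Num.Theory.
Import numFieldNormedType.Exports.

Local Open Scope classical_set_scope.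
Local Open Scope ring_scope.

Definition has_law {d} {T : measurableType d} {R : realType}
    (P : probability T R) (X : T -> R) (mu : set R -> \bar R) : Prop :=
  forall A : set R, measurable A -> P (X @^-1` A) = mu A.

(* [normal_prob m 0] is by convention the uniform law on `[0, 1], not the
   point mass at m, hence the case split. *)
Definition gaussian_law {R : realType} (m s : R) (A : set R) : \bar R :=
  if s == 0 then \d_m A else normal_prob m s A.

(* Possibly degenerate (constant) Gaussian random variables are included. *)
Definition gaussian_rv {d} {T : measurableType d} {R : realType}
    (P : probability T R) (X : T -> R) : Prop :=
  exists m s : R, 0 <= s /\ has_law P X (gaussian_law m s).

(* Processes (S_t)_{t >= 0} are represented by families indexed by R, of which
   only the members with t >= 0 are ever constrained or used. *)
Definition gaussian_process {d} {T : measurableType d} {R : realType}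
    (P : probability T R) (S : R -> {RV P >-> R}) : Prop :=
  forall (m : nat) (t a : 'I_m -> R), (forall i, 0 <= t i) ->
    gaussian_rv P (fun w => \sum_(i < m) a i * S (t i) w).

Definition subfractional_covariance {R : realType} (H s t : R) : R :=
  s `^ (2 * H) + t `^ (2 * H)
  - 2^-1 * ((s + t) `^ (2 * H) + `|t - s| `^ (2 * H)).

Definition subfractional_brownian_motion {d} {T : measurableType d}
    {R : realType} (P : probability T R) (H : R) (S : R -> {RV P >-> R}) :
    Prop :=
  [/\ gaussian_process S,
      forall t : R, 0 <= t -> 'E_P[S t]%E = 0%E &
      forall s t : R, 0 <= s -> 0 <= t ->
        'E_P[(fun w => S s w * S t w)%R]%E = (subfractional_covariance H s t)%:E].

(* The two random variables may live on different probability spaces. *)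
Definition kolmogorov_distance {d} {T : measurableType d}
    {d'} {T' : measurableType d'} {R : realType}
    (P : probability T R) (X : T -> R) (Q : probability T' R) (Y : T' -> R) :
    \bar R :=
  ereal_sup [set (`| P [set w | (X w <= z)%R] - Q [set w | (Y w <= z)%R] |)%E
            | z in [set: R]].

Definition increment {d} {T : measurableType d} {R : realType}
    (P : probability T R) (S : R -> {RV P >-> R}) (n k : nat) : T -> R :=
  fun w => S (k.+1%:R / n%:R) w - S (k%:R / n%:R) w.

Definition centered_quadratic_variation {d} {T : measurableType d} {R : realType}
    (P : probability T R) (H : R) (S : R -> {RV P >-> R}) (n : nat) : T -> R :=
  fun w => \sum_(0 <= k < n)
    n%:R `^ (2 * H) *
      (increment S n k w ^+ 2 - fine (variance P (increment S n k))).

Definition normalized {d} {T : measurableType d} {R : realType}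
    (P : probability T R) (X : T -> R) : T -> R :=
  fun w => X w / Num.sqrt (fine (variance P X)).

(* The last branch is only meant for H = 3/4. *)
Definition rate {R : realType} (H : R) (n : nat) : R :=
  if H < 5 / 8 then 1 / Num.sqrt n%:R
  else if H == 5 / 8 then ln n%:R `^ (3 / 2) / Num.sqrt n%:R
  else if H < 3 / 4 then n%:R `^ (4 * H - 3)
  else 1 / ln n%:R.

Definition first_index {R : realType} (H : R) : nat :=
  if (H == 5 / 8) || (H == 3 / 4) then 2%N else 1%N.

(* Main.v *)
Require Import Defs.
From HB Require Import structures.
From mathcomp Require Import all_boot all_order all_algebra.
From mathcomp Require Import all_classical all_reals all_analysis.
From mathcomp Require Import measurable_realfun zify ring lra.

Set Implicit Arguments.
Unset Strict Implicit.
Unset Printing Implicit Defensive.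

Import Order.TTheory GRing.Theory Num.Theory.
Import numFieldNormedType.Exports.

Local Open Scope classical_set_scope.
Local Open Scope ring_scope.

(** The rescaled increments xi_k = n^H (S_((k+1)/n) - S_(k/n)) form a centered
    Gaussian vector with covariance C_jk = rho(|k - j|) - rho(j + k + 1), and
    Z_n = Q - tau with Q = sum xi_k^2 and tau = tr C.  With
    W = sum C_ij xi_i xi_j and D = sum C_ij^2 = E W, Gaussian integration by
    parts reads E[(Q - tau) g(Q)] = 2 E[W g'(Q)].  Inserting the solution of
    Stein's equation bounds the Kolmogorov distance by 2 sqrt(Var W) / D, where
    Var W = 2 tr(C^4).

    The integration by parts formula is available for polynomials, by
    polarization of the moments of one-dimensional Gaussian variables.  Since Q
    has exponential moments, it passes through power series to
    g(Q) = p(exp(-delta Q)) with p a polynomial, and by Bernstein approximation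
    of the derivative to every g of class C^1 with bounded derivative.

    AM-GM over the spanning paths of the 4-cycle gives
    tr(C^4) = O(n (sum_(m < n) (m+1)^(4/3 (2H - 2)))^3), which together with
    D >= n / 4, improved to D >= c n log n when H = 3/4, yields the four rates. *)

(** The obstacle is that Stein's solution is not a polynomial, while the moments of one-dimensional
    Gaussian laws only give algebraic identities. A power series in Q can be integrated term by term
    only against an exponential moment, and E exp(2 delta Q) is known to be finite only for some
    small delta. So the weight exp(-k delta Q) is built one factor at a time, each new factor being
    expanded against a weight already bounded by 1. These weights suffice because t |-> exp(-delta
    t) maps [0, +oo[ onto ]0, 1], and polynomials without constant term are those whose primitive in
    t is again a polynomial in exp(-delta t).

    The exponent 4/3 comes from putting on each edge of the 4-cycle the cube root of a majorant of
    |C_ij|: every edge lies in three of the four spanning paths. The threshold 4/3 (2 - 2H) = 1 is H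
    = 5/8; there a cubed harmonic sum under a square root gives (log n)^(3/2). At H = 3/4 the bound
    on tr(C^4) is of order n^2, so D >= n / 4 would give no decay at all; the gain in D comes from
    rho(m)^2 being of order 1 / m. *)

(** * Integration against normal laws and laws of random variables *)

Section normal_integrals.
Context {R : realType}.
Local Notation mu := (@lebesgue_measure R).

(** The Radon-Nikodym derivative of the law agrees almost everywhere with [normal_pdf], as both have
    the same integral over every measurable set. *)
Lemma ge0_integral_normal_prob (m s : R) (f : R -> \bar R) :
  measurable_fun [set: R] f -> (forall x, (0 <= f x)%E) ->
  (\int[normal_prob m s]_x f x = \int[mu]_x (f x * (normal_pdf m s x)%:E))%E.
Proof.
move=> mf f0.
have dom := @normal_prob_dominates R m s.
rewrite -(Radon_Nikodym_SigmaFinite.change_of_variables dom)//.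
have mpdf : measurable_fun setT (fun x => (normal_pdf m s x)%:E).
  by apply/measurable_EFinP; exact: measurable_normal_pdf.
apply: ae_eq_integral => //.
- apply: emeasurable_funM => //.
  exact: (measurable_int mu (Radon_Nikodym_SigmaFinite.f_integrable dom)).
- exact: emeasurable_funM.
- apply: ae_eqe_mul2l; apply: integral_ae_eq => //.
  + exact: Radon_Nikodym_SigmaFinite.f_integrable.
  + by move=> E _ mE; rewrite -(Radon_Nikodym_SigmaFinite.f_integral dom mE).
Qed.

Lemma integrable_normal_prob (m s : R) (f : R -> R) :
  measurable_fun [set: R] f ->
  mu.-integrable setT (fun x => (f x * normal_pdf m s x)%:E) ->
  (normal_prob m s).-integrable setT (EFin \o f).
Proof.
move=> mf /integrableP[_ fi]; apply/integrableP; split.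
  exact/measurable_EFinP.
rewrite ge0_integral_normal_prob//.
  apply: le_lt_trans fi; rewrite le_eqVlt; apply/orP; left; apply/eqP.
  by apply: eq_integral => x _; rewrite /= normrM EFinM [`|normal_pdf _ _ _|]ger0_norm ?normal_pdf_ge0.
by apply: measurableT_comp => //; exact/measurable_EFinP.
Qed.

Lemma integral_normal_prob (m s : R) (f : R -> R) :
  measurable_fun [set: R] f ->
  mu.-integrable setT (fun x => (f x * normal_pdf m s x)%:E) ->
  (\int[normal_prob m s]_x (f x)%:E =
    \int[mu]_x (f x * normal_pdf m s x)%:E)%E.
Proof.
move=> mf fi; rewrite integralE [RHS]integralE.
rewrite !ge0_integral_normal_prob//; last 2 first.
- exact/measurable_funeneg/measurable_EFinP.
- exact/measurable_funepos/measurable_EFinP.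
have p0 x : (0 <= (normal_pdf m s x)%:E)%E by rewrite lee_fin normal_pdf_ge0.
congr (_ - _)%E; apply: eq_integral => x _.
  by rewrite !funeposE EFinM maxe_pMl// mul0e.
by rewrite !funenegE EFinM -mulNe maxe_pMl// mul0e.
Qed.

End normal_integrals.

Section law_transport.
Context {R : realType} {d} {T : measurableType d} (P : probability T R).
Variables (X : {RV P >-> R}) (mu : probability (measurableTypeR R) R).
Hypothesis law : has_law P X mu.

(* [R] and [measurableTypeR R] carry the same sigma-algebra under different displays. *)
Let measurable_X : measurable_fun [set: T] (X : T -> measurableTypeR R).
Proof. exact: (measurable_funP X). Qed.

Let X' : {mfun T >-> measurableTypeR R} :=
  HB.pack (X : T -> measurableTypeR R) (isMeasurableFun.Build _ _ _ _ _ measurable_X).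

Lemma ge0_integral_has_law (f : measurableTypeR R -> \bar R) :
  measurable_fun [set: measurableTypeR R] f -> (forall x, (0 <= f x)%E) ->
  (\int[P]_w f (X w) = \int[mu]_x f x)%E.
Proof.
move=> mf f0.
rewrite (eq_measure_integral (distribution P X')); last first.
  by move=> A mA _; exact: esym (law mA).
by rewrite ge0_integral_distribution.
Qed.

Lemma integrable_has_law (f : measurableTypeR R -> R) :
  measurable_fun [set: measurableTypeR R] f ->
  mu.-integrable setT (EFin \o f) ->
  P.-integrable setT (EFin \o (f \o X)).
Proof.
move=> mf /integrableP[_ fi]; apply/integrableP; split.
  by apply/measurable_EFinP; exact: (measurableT_comp mf measurable_X).
apply: le_lt_trans fi; rewrite le_eqVlt; apply/orP; left; apply/eqP.
rewrite -ge0_integral_has_law//.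
by apply: measurableT_comp => //; exact/measurable_EFinP.
Qed.

Lemma integral_has_law (f : measurableTypeR R -> R) :
  measurable_fun [set: measurableTypeR R] f ->
  mu.-integrable setT (EFin \o f) ->
  (\int[P]_w (f (X w))%:E = \int[mu]_x (f x)%:E)%E.
Proof.
move=> mf fi.
rewrite (eq_measure_integral (distribution P X')); last first.
  by move=> A mA _; exact: esym (law mA).
rewrite integral_distribution//; first exact/measurable_EFinP.
exact: integrable_has_law.
Qed.

End law_transport.

Section dominated_convergence_real.
Context {d} {T : measurableType d} {R : realType}.
Variable mu : {measure set T -> \bar R}.

Lemma dominated_convergence_real (u_ : nat -> T -> R) (u g : T -> R) :
  (forall n, measurable_fun [set: T] (u_ n)) ->
  (forall w, u_ n w @[n --> \oo] --> u w) ->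
  mu.-integrable [set: T] (EFin \o g) ->
  (forall n w, `|u_ n w| <= g w) ->
  mu.-integrable [set: T] (EFin \o u) /\
  (\int[mu]_w u_ n w @[n --> \oo] --> \int[mu]_w u w).
Proof.
move=> mu_ u_u gi ug.
have mfu : measurable_fun [set: T] u.
  by apply: (measurable_fun_cvg (h := u_)) => // w _; exact: u_u.
have [ui _ cu] := @dominated_convergence _ _ _ mu setT measurableT
  (fun n => EFin \o u_ n) (EFin \o u) (EFin \o g)
  (fun n => (measurable_EFinP _ _).2 (mu_ n)) ((measurable_EFinP _ _).2 mfu)
  ltac:(by apply: aeW => w _; apply: cvg_EFin => //; [exact: nearW|exact: u_u])
  gi ltac:(by apply: aeW => w n _; rewrite lee_fin ug).
split => //; apply: fine_cvg.
by rewrite /Rintegral fineK//; exact: integrable_fin_num.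
Qed.

End dominated_convergence_real.

(** * Bernstein polynomials *)

Section bernstein.
Context {R : realType}.
Implicit Types (phi psi : nat -> R) (y : R).

(** [(bernstein N phi).[y]] is the mean of [phi] at a binomial variable with parameters N and y; the
    recursion conditions on one trial. The nodes are the counts k, not k / N: rescaling is left to
    the caller. *)
Fixpoint bernstein (N : nat) (phi : nat -> R) : {poly R} :=
  if N is N'.+1 then
    'X * bernstein N' (fun k => phi k.+1) + (1 - 'X) * bernstein N' phi
  else (phi 0%N)%:P.

Lemma hornerS_bernstein N phi y : (bernstein N.+1 phi).[y] =
  y * (bernstein N (fun k => phi k.+1)).[y] + (1 - y) * (bernstein N phi).[y].
Proof. by rewrite /= !(hornerE, hornerD, hornerM). Qed.

Lemma bernstein_at0 N phi : (bernstein N phi).[0] = phi 0%N.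
Proof.
elim: N phi => [|N IHN] phi; first by rewrite /= hornerC.
by rewrite hornerS_bernstein mul0r add0r subr0 mul1r IHN.
Qed.

Lemma ler_bernstein N phi psi y : 0 <= y <= 1 ->
  (forall k, (k <= N)%N -> phi k <= psi k) ->
  (bernstein N phi).[y] <= (bernstein N psi).[y].
Proof.
move=> /andP[y0 y1]; elim: N phi psi => [|N IHN] phi psi le_phi.
  by rewrite /= !hornerC le_phi.
rewrite !hornerS_bernstein lerD// ler_wpM2l ?subr_ge0//.
  by apply: IHN => k kN; rewrite le_phi.
by apply: IHN => k kN; rewrite le_phi// leqW.
Qed.

(* Second moment of a binomial variable, shifted by [a]. *)
Lemma bernstein_affine_sqr N (a b c : R) y :
  (bernstein N (fun k => b * (k%:R - a) ^+ 2 + c)).[y] =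
  b * ((N%:R * y - a) ^+ 2 + N%:R * y * (1 - y)) + c.
Proof.
elim: N a => [|N IHN] a; first by rewrite /= hornerC; ring.
rewrite hornerS_bernstein IHN.
have -> : (fun k => b * (k.+1%:R - a) ^+ 2 + c) =
          (fun k : nat => b * (k%:R - (a - 1)) ^+ 2 + c).
  by apply/funext => k; rewrite -natr1; ring.
by rewrite IHN -natr1; ring.
Qed.

Lemma bernstein_bounded N phi (B y : R) : 0 <= y <= 1 ->
  (forall k, `|phi k| <= B) -> `|(bernstein N phi).[y]| <= B.
Proof.
move=> y01 phiB.
have cstE (c : R) : (bernstein N (fun=> c)).[y] = c.
  have -> : (fun=> c) = (fun k : nat => 0 * (k%:R - 0) ^+ 2 + c).
    by apply/funext => k; rewrite mul0r add0r.
  by rewrite bernstein_affine_sqr mul0r add0r.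
rewrite ler_norml -{1}(cstE (- B)) -{2}(cstE B).
by rewrite !ler_bernstein// => k _; have := phiB k; rewrite ler_norml => /andP[].
Qed.

Arguments bernstein : simpl never.

Lemma near_infty_natr_gt_succ (x : R) : \forall N \near \oo, x < N.+1%:R.
Proof.
near=> N.
rewrite (@lt_trans _ _ N%:R)// ?ltr_nat//.
by near: N; exact: nbhs_infty_gtr.
Unshelve. all: by end_near.
Qed.

(** Chebyshev's argument, pointwise: boundedness of [u] and continuity at the single point y are
    enough, so [u] may jump elsewhere. This matters at 0, where the function approximated later need
    not be continuous. *)
Lemma bernstein_cvg (u : R -> R) (B y : R) : 0 <= y <= 1 ->
  (forall x, `|u x| <= B) -> {for y, continuous u} ->
  (bernstein N.+1 (fun k => u (k%:R / N.+1%:R))).[y] @[N --> \oo] --> u y.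
Proof.
move=> y01 uB uc.
have B0 : 0 <= B by rewrite (le_trans _ (uB 0)).
apply/cvgrPdist_le => /= e e0.
have e20 : 0 < e / 2 by rewrite divr_gt0.
have [r /= r0 ur] : exists2 r : R, 0 < r &
    forall x, `|y - x| < r -> `|u y - u x| <= e / 2.
  by have /cvgrPdist_le/(_ _ e20)/nbhs_ballP[r /= r0 ur] := uc; exists r.
near=> N.
have N0 : (0 : R) < N.+1%:R by rewrite ltr0n.
pose M : R := N.+1%:R.
(* The parabola of coefficient [b] centered at M y reaches 2 B, the largest possible oscillation of
   [u], once k / M is at distance r from y. Its mean is [b] times the binomial variance, which is
   O(1 / M). *)
pose b : R := 2 * B / (M * r) ^+ 2.
have b0 : 0 <= b by apply: divr_ge0; [exact: mulr_ge0 | exact: sqr_ge0].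
have key k : `|u (k%:R / M) - u y| <= b * (k%:R - M * y) ^+ 2 + e / 2.
  have [yr|ry] := ltP `|y - k%:R / M| r.
    rewrite distrC (le_trans (ur _ yr))// lerDr.
    by apply: mulr_ge0 => //; exact: sqr_ge0.
  apply: (@le_trans _ _ (2 * B)).
    by rewrite (le_trans (ler_normB _ _))// mulrDl mul1r lerD.
  rewrite -[leLHS]addr0 lerD//; last exact: ltW.
  rewrite /b mulrAC ler_pdivlMr ?exprn_gt0 ?mulr_gt0//.
  rewrite ler_wpM2l ?mulr_ge0// -[leRHS]real_normK ?num_real//.
  rewrite ler_sqr ?nnegrE//; last by rewrite ltW// mulr_gt0.
  rewrite -[k%:R](divfK (lt0r_neq0 N0)) -/M [k%:R / M * M]mulrC -mulrBr normrM.
  by rewrite gtr0_norm// ler_pM2l// distrC.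
have y1y : 0 <= y * (1 - y) <= 1.
  by move/andP: y01 => [y0 y1]; apply/andP; split; nra.
have bE : b * (M * y * (1 - y)) <= e / 2.
  rewrite /b -mulrA -[M * y * _]mulrA.
  have -> : 2 * B * (((M * r) ^+ 2)^-1 * (M * (y * (1 - y)))) =
     2 * B * (y * (1 - y)) / r ^+ 2 / M.
    by field; rewrite !lt0r_neq0.
  rewrite ler_pdivrMr//.
  have : 2 * B * (y * (1 - y)) / r ^+ 2 <= 2 * B / r ^+ 2.
    rewrite ler_pM2r ?invr_gt0 ?exprn_gt0//.
    by rewrite ler_piMr ?mulr_ge0//; case/andP: y1y.
  move/le_trans; apply.
  rewrite -ler_pdivrMl// ltW//.
  by rewrite /M; near: N; exact: near_infty_natr_gt_succ.
have aff (c : R) (g : R) : (bernstein N.+1 (fun k => g * (k%:R - M * y) ^+ 2 + c)).[y]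
  = g * (M * y * (1 - y)) + c.
  by rewrite bernstein_affine_sqr subrr expr0n add0r.
rewrite distrC ler_distl; apply/andP; split.
- apply: (@le_trans _ _ (bernstein N.+1 (fun k => - b * (k%:R - M * y) ^+ 2 + (u y - e / 2))).[y]).
    by rewrite aff; lra.
  apply: ler_bernstein => // k _.
  by have := key k; rewrite ler_distl => /andP[+ _]; rewrite -/M; lra.
- apply: (@le_trans _ _ (bernstein N.+1 (fun k => b * (k%:R - M * y) ^+ 2 + (u y + e / 2))).[y]).
    apply: ler_bernstein => // k _.
    by have := key k; rewrite ler_distl => /andP[_ +]; rewrite -/M; lra.
  by rewrite aff; lra.
Unshelve. all: by end_near.
Qed.

End bernstein.

(** * Integrals of derivatives over the line and over half-lines *)

Section integral_of_derivative.
Context {R : realType}.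
Local Notation mu := (@lebesgue_measure R).

Lemma integral_is_derive (F f : R -> R) (a b : R) : a <= b ->
  (forall x : R, is_derive x (1 : R) F (f x)) -> continuous f ->
  (\int[mu]_(x in `[a, b]) (f x)%:E = (F b - F a)%:E)%E.
Proof.
rewrite le_eqVlt => /predU1P[<- _ _|ab dF cf].
  by rewrite set_itv1 integral_set1 subrr.
have cF : continuous F.
  by move=> x; apply/differentiable_continuous/derivable1_diffP; have [] := dF x.
rewrite EFinB (continuous_FTC2 (F := F))//.
- exact: continuous_subspaceT.
- split.
  + by move=> x _; have [] := dF x.
  + exact/cvg_at_right_filter/cF.
  + exact/cvg_at_left_filter/cF.
- by move=> x _; rewrite derive1E; have [_ ->] := dF x.
Qed.

(** The decay is stated as a product so that nothing is divided by x - m; [u] will be n or -n, the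
    end points of growing intervals. *)
Lemma decay_cvg0 (F : R -> R) (m C : R) (u : nat -> R) :
  (forall x, `|x - m| * `|F x| <= C) -> (forall n, `|u n| = n%:R) ->
  F (u n) @[n --> \oo] --> 0.
Proof.
move=> FC uE; apply/cvgrPdist_le => /= e e0.
have C0 : 0 <= C by rewrite (le_trans _ (FC 0))// mulr_ge0.
near=> n; rewrite sub0r normrN.
have un : C / e + 1 <= `|u n - m|.
  rewrite (@le_trans _ _ (n%:R - `|m|))//; last first.
    by rewrite -uE lerB_dist.
  rewrite lerBrDr; near: n; exact: nbhs_infty_ger.
have un0 : 0 < `|u n - m| by rewrite (lt_le_trans _ un)// ltr_wpDl// divr_ge0// ltW.
rewrite -(ler_pM2l un0) (le_trans (FC _))// -ler_pdivrMr//.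
by rewrite (le_trans _ un)// lerDl.
Unshelve. all: by end_near.
Qed.

(** The fundamental theorem on [-n, n], with |f| as majorant for the limit; both boundary terms
    vanish by the decay of F. *)
Lemma integral_is_derive_eq0 (F f : R -> R) (m C : R) :
  (forall x : R, is_derive x (1 : R) F (f x)) -> continuous f ->
  mu.-integrable setT (EFin \o f) ->
  (forall x, `|x - m| * `|F x| <= C) ->
  (\int[mu]_x (f x)%:E = 0)%E.
Proof.
move=> dF cf fi FC.
pose D (n : nat) : set R := `[(- n%:R), n%:R]%classic.
have mf : measurable_fun [set: R] f by exact: continuous_measurable_fun.
have mD n : measurable (D n) by exact: measurable_itv.
have mfD n : measurable_fun [set: R] (f \_ (D n)).
  by apply/(measurable_restrictT _ _).1 => //; exact: measurable_funTS.
have cD x : (f \_ (D n)) x @[n --> \oo] --> f x.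
  apply: cvg_near_cst; near=> n.
  rewrite patchT// inE /D /= in_itv /= -ler_norml.
  by near: n; exact: nbhs_infty_ger.
have Df n x : `|(f \_ (D n)) x| <= (Num.norm \o f) x.
  by rewrite patchE; case: ifP => // _; rewrite normr0 /=.
have := (@dominated_convergence_real _ _ _ mu _ _ _ mfD cD (integrable_norm fi) Df).2.
have Dint n : \int[mu]_x (f \_ (D n)) x = F n%:R - F (- n%:R).
  rewrite -Rintegral_mkcond /Rintegral (integral_is_derive _ dF cf)//.
  by rewrite (@le_trans _ _ 0)// oppr_le0.
under eq_fun do rewrite Dint.
move=> cvgf.
have cvg0 : F n%:R - F (- n%:R) @[n --> \oo] --> (0 - 0 : R).
  apply: cvgB; apply: (decay_cvg0 FC) => n; first by rewrite ger0_norm.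
  by rewrite normrN ger0_norm.
have := cvg_unique _ cvgf cvg0; rewrite subr0 /Rintegral => /(_ (@Rhausdorff R)) f0.
have /fineK <- := integrable_fin_num measurableT fi.
by rewrite /= f0.
Unshelve. all: by end_near.
Qed.

Lemma Rintegral_is_derive_Nyc (F f : R -> R) (m C x : R) :
  (forall x : R, is_derive x (1 : R) F (f x)) -> continuous f ->
  mu.-integrable setT (EFin \o f) ->
  (forall x, `|x - m| * `|F x| <= C) ->
  \int[mu]_(y in `]-oo, x]) f y = F x.
Proof.
move=> dF cf fi FC.
pose D (n : nat) : set R := `[(- n%:R), x]%classic.
have mf : measurable_fun [set: R] f by exact: continuous_measurable_fun.
have mD n : measurable (D n) by exact: measurable_itv.
have mfD n : measurable_fun [set: R] (f \_ (D n)).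
  by apply/(measurable_restrictT _ _).1 => //; exact: measurable_funTS.
have cD y : (f \_ (D n)) y @[n --> \oo] --> (f \_ `]-oo, x]) y.
  apply: cvg_near_cst; near=> n.
  rewrite !patchE; congr (if _ then _ else _).
  rewrite /D !mem_setE !in_itv /=; suff -> : - n%:R <= y by [].
  by rewrite lerNl; near: n; exact: nbhs_infty_ger.
have Df n y : `|(f \_ (D n)) y| <= (Num.norm \o f) y.
  by rewrite patchE; case: ifP => // _; rewrite normr0 /=.
have := (@dominated_convergence_real _ _ _ mu _ _ _ mfD cD (integrable_norm fi) Df).2.
rewrite -Rintegral_mkcond => cvgf.
have cvg0 : F x - F (- n%:R) @[n --> \oo] --> (F x - 0 : R).
  apply: cvgB; first exact: cvg_cst.
  by apply: (decay_cvg0 FC) => n; rewrite normrN ger0_norm.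
rewrite -[RHS]subr0; apply: cvg_unique cvgf _ => //.
apply: cvg_trans cvg0; apply: near_eq_cvg; near=> n.
rewrite -Rintegral_mkcond /Rintegral (integral_is_derive _ dF cf)//.
by rewrite lerNl; near: n; exact: nbhs_infty_ger.
Unshelve. all: by end_near.
Qed.

End integral_of_derivative.

(** * Moments of one-dimensional Gaussian variables *)

Section gaussian_moments.
Context {R : realType}.
Local Notation mu := (@lebesgue_measure R).

Lemma exprn_le_expR (x : R) k : 0 <= x -> x ^+ k <= k`!%:R * expR x.
Proof.
move=> x0; case: k => [|k].
  by rewrite expr0 fact0 mul1r -expR0 ler_expR.
rewrite mulrC -ler_pdivrMr ?ltr0n ?fact_gt0//.
by rewrite (le_trans _ (expR_ge1Dxn k x0))// lerDr.
Qed.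

Lemma normX_le_expR_sqr (a : R) k : 0 < a ->
  exists2 K : R, 0 <= K & forall x : R, `|x| ^+ k <= K * expR (a * x ^+ 2).
Proof.
move=> a0; exists (1 + k`!%:R / a ^+ k).
  by rewrite addr_ge0// divr_ge0// exprn_ge0// ltW.
move=> x.
have e1 : 1 <= expR (a * x ^+ 2).
  by rewrite -expR0 ler_expR mulr_ge0 ?sqr_ge0 ?ltW.
have xk : `|x| ^+ k <= 1 + (x ^+ 2) ^+ k.
  have [x1|x1] := leP `|x| 1.
    by rewrite (le_trans (exprn_ile1 _ _ x1))// lerDl exprn_ge0 ?sqr_ge0.
  rewrite -[x ^+ 2]real_normK ?num_real// -exprM mulnC exprM.
  by rewrite expr2 -[leLHS]add0r lerD// ler_peMl ?exprn_ge0// exprn_ege1// ltW.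
rewrite (le_trans xk)// mulrDl mul1r lerD//.
rewrite mulrAC ler_pdivlMr ?exprn_gt0// -exprMn [x ^+ 2 * a]mulrC.
by apply: exprn_le_expR; rewrite mulr_ge0 ?sqr_ge0 ?ltW.
Qed.

Variables (m s : R).
Hypothesis s0 : s != 0.
Let pdf := normal_pdf m s.

(** The exponent 1 / (4 s^2) is half the one in the density, so the product is a multiple of the
    normal density of variance 2 s^2. *)
Lemma integrable_expR_sqr_normal :
  mu.-integrable setT (EFin \o (fun x => expR ((s ^+ 2 *+ 4)^-1 * (x - m) ^+ 2) * pdf x)).
Proof.
pose s' := Num.sqrt 2 * s.
have s'0 : s' != 0 by rewrite mulf_neq0// sqrtr_eq0 -ltNge.
have s'2 : s' ^+ 2 = s ^+ 2 *+ 2 by rewrite exprMn sqr_sqrtr// mulr_natl.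
have -> : (fun x => expR ((s ^+ 2 *+ 4)^-1 * (x - m) ^+ 2) * pdf x) =
  (fun x => normal_peak s / normal_peak s' * normal_pdf m s' x).
  apply/funext => x; rewrite /pdf !normal_pdfE// /normal_fun.
  rewrite mulrA divfK ?gt_eqF ?normal_peak_gt0// mulrCA -expRD; congr (_ * expR _).
  rewrite s'2; field.
  by rewrite s0.
rewrite /comp; under eq_fun do rewrite EFinM.
apply: integrableZl => //; exact: integrable_normal_pdf.
Qed.

Lemma integrable_normX_normal k :
  mu.-integrable setT (EFin \o (fun x => (x - m) ^+ k * pdf x)).
Proof.
have a0 : 0 < (s ^+ 2 *+ 4)^-1.
  by rewrite invr_gt0 pmulrn_lgt0// exprn_even_gt0.
have [K K0 KP] := normX_le_expR_sqr k a0.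
apply: (@le_integrable _ _ _ mu _ _ _
  (fun x => K%:E * (expR ((s ^+ 2 *+ 4)^-1 * (x - m) ^+ 2) * pdf x)%:E)%E) => //.
- apply/measurable_EFinP; apply: measurable_funM.
    by apply: measurable_funX; exact: measurable_funB.
  exact: measurable_normal_pdf.
- move=> x _; rewrite /= lee_fin normrM normrX [`|pdf x|]ger0_norm ?normal_pdf_ge0//.
  rewrite [leRHS]ger0_norm; last by rewrite !mulr_ge0 ?normal_pdf_ge0 ?expR_ge0.
  by rewrite mulrA ler_wpM2r ?normal_pdf_ge0.
- apply: integrableZl => //; exact: integrable_expR_sqr_normal.
Qed.

Lemma is_derive_normal_pdf (x : R) :
  is_derive x (1 : R) pdf (- (x - m) / s ^+ 2 * pdf x).
Proof.
rewrite /pdf normal_pdfE//.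
have H : is_derive x (1 : R) (fun x : R => - (x - m) ^+ 2 / (s ^+ 2 *+ 2)) (- (x - m) / s ^+ 2).
  apply: is_derive_eq.
  rewrite /GRing.scale /=; field.
  by rewrite s0.
have H2 := @is_derive1_comp _ expR _ x _ _ (is_derive_expR _) H.
have H3 := @is_deriveZ _ _ _ _ (normal_peak s) _ _ _ H2.
apply: is_derive_eq.
by rewrite /GRing.scale /= /normal_fun; ring.
Qed.

(** Integration by parts: -s^2 (x - m)^k pdf(x) is a primitive of the difference of the two
    integrands. At k = 0 the factor k makes the truncated exponent [k.-1] harmless, and the identity
    says that the centered mean is 0. *)
Lemma normal_moment_rec k :
  \int[mu]_x ((x - m) ^+ k.+1 * pdf x) =
  k%:R * s ^+ 2 * \int[mu]_x ((x - m) ^+ k.-1 * pdf x).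
Proof.
have s20 : 0 < s ^+ 2 by rewrite exprn_even_gt0.
have a0 : 0 < (s ^+ 2 *+ 4)^-1 by rewrite invr_gt0 pmulrn_lgt0.
have [K K0 KP] := normX_le_expR_sqr k.+1 a0.
pose F x := - s ^+ 2 * ((x - m) ^+ k * pdf x).
pose f x := (x - m) ^+ k.+1 * pdf x - k%:R * s ^+ 2 * ((x - m) ^+ k.-1 * pdf x).
have dF (x : R) : is_derive x (1 : R) F (f x).
  have H1 : is_derive x (1 : R) (fun x : R => (x - m) ^+ k) (k%:R * (x - m) ^+ k.-1).
    have H0 : is_derive x (1 : R) (fun x : R => x - m) 1.
      by apply: is_derive_eq; rewrite ?subr0 ?oppr0 ?addr0.
    have -> : (fun x : R => (x - m) ^+ k) = (fun x : R => x - m) ^+ k.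
      by apply/funext => y; rewrite exprfctE.
    by apply: is_derive_eq; rewrite /GRing.scale /= mulr1.
  have H2 := @is_deriveM _ _ _ _ _ _ _ _ H1 (is_derive_normal_pdf x).
  have H3 := @is_deriveZ _ _ _ _ (- s ^+ 2) _ _ _ H2.
  apply: is_derive_eq.
  rewrite /f /GRing.scale /= [(x - m) ^+ k.+1]exprS.
  move: (_ ^+ k) (_ ^+ k.-1) (pdf x) (k%:R) => A B C D; field.
  by rewrite s0.
have cf : continuous f.
  have cX n : continuous (fun x : R => (x - m) ^+ n * pdf x).
    move=> x; apply: cvgM; last exact: continuous_normal_pdf.
    apply: (@continuous_comp _ _ _ (fun x : R => x - m) (fun x => x ^+ n)).
      by apply: cvgB; [exact: cvg_id|exact: cvg_cst].
    exact: exprn_continuous.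
  by move=> x; apply: cvgB; [exact: cX|apply: cvgM; [exact: cvg_cst|exact: cX]].
have fi1 := integrable_normX_normal k.+1.
have fi2 : mu.-integrable setT (EFin \o (fun x => k%:R * s ^+ 2 * ((x - m) ^+ k.-1 * pdf x))).
  by rewrite /comp; under eq_fun do rewrite EFinM; apply: integrableZl => //;
    exact: integrable_normX_normal.
have fi : mu.-integrable setT (EFin \o f).
  by rewrite /comp; under eq_fun do rewrite /f EFinB; apply: integrableB.
(* The growth of (x - m)^(k+1) is paid for with half of the Gaussian exponent; the other half keeps
   the product bounded. *)
have FC x : `|x - m| * `|F x| <= s ^+ 2 * K * normal_peak s.
  rewrite /F !normrM normrN (gtr0_norm s20) mulrCA -mulrA ler_wpM2l ?(ltW s20)//.
  rewrite mulrA normrX -exprS (ger0_norm (normal_pdf_ge0 _ _ _)).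
  apply: (le_trans (ler_wpM2r (normal_pdf_ge0 _ _ _) (KP _))).
  rewrite -mulrA ler_wpM2l// /pdf normal_pdfE// mulrCA ler_piMr ?normal_peak_ge0//.
  rewrite /normal_fun -expRD -[leRHS]expR0 ler_expR.
  rewrite [leLHS](_ : _ = - ((x - m) ^+ 2 * (s ^+ 2 *+ 4)^-1)).
    by rewrite oppr_le0 mulr_ge0 ?sqr_ge0// ltW.
  field; by rewrite s0.
have := integral_is_derive_eq0 dF cf fi FC.
move=> /(congr1 fine) /=; rewrite -/(Rintegral _ _ _) RintegralB//.
rewrite RintegralZl//; last exact: integrable_normX_normal.
by move/eqP; rewrite subr_eq0 => /eqP.
Qed.

End gaussian_moments.

Section centered_gaussian.
Context {R : realType} {d} {T : measurableType d} (P : probability T R).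

(** Written with E X^2 in place of the parameters of the law, the recursion also covers the point
    mass at 0, where both sides vanish. This recursion and the exponential moment are all that is
    later drawn from Gaussianity. *)
Lemma centered_gaussian_moments (X0 : T -> R) : measurable_fun [set: T] X0 ->
  gaussian_rv P X0 -> (\int[P]_w (X0 w)%:E = 0)%E ->
  (exists2 a, 0 < a & P.-integrable setT (EFin \o (fun w => expR (a * X0 w ^+ 2)))) /\
  (forall k, \int[P]_w (X0 w ^+ k.+1) =
     k%:R * \int[P]_w (X0 w ^+ 2) * \int[P]_w (X0 w ^+ k.-1)).
Proof.
move=> mX0.
pose X : {RV P >-> R} := HB.pack X0 (isMeasurableFun.Build _ _ _ _ _ mX0).
rewrite -[X0]/(X : T -> R) => -[m [s [s_ge0 law]]].
(* For s = 0 the law is the point mass at m, and centering forces m = 0. *)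
have [s0|s0] := eqVneq s 0.
  have lawD : has_law P X (@dirac _ (measurableTypeR R) m R : probability (measurableTypeR R) R).
    by move=> A mA; rewrite law// /gaussian_law s0 eqxx.
  have int f : measurable_fun [set: R] f -> (\int[P]_w (f (X w))%:E)%E = (f m)%:E.
    move=> mf; have mf' : measurable_fun [set: R] (EFin \o f) by exact/measurable_EFinP.
    rewrite (integral_has_law lawD)//.
      by rewrite integral_dirac// diracT mul1e.
    apply/integrableP; split => //.
    rewrite integral_dirac//; last exact: measurableT_comp.
    by rewrite diracT mul1e ltry.
  rewrite (int idfun (@measurable_id _ _ _)) => h.
  have m0 : m = 0 by apply: EFin_inj.
  split.
    exists 1 => //.
    apply: (integrable_has_law lawD (f := fun x => expR (1 * x ^+ 2))).
      by apply: measurableT_comp => //; apply: measurable_funM => //.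
    apply/integrableP; split.
      apply/measurable_EFinP.
      by apply: measurableT_comp => //; apply: measurable_funM => //.
    rewrite integral_dirac//.
      by rewrite diracT mul1e ltry.
    do 2 apply: measurableT_comp => //.
    by apply: measurableT_comp => //; apply: measurable_funM => //.
  have mX n : measurable_fun [set: R] (fun x : R => x ^+ n) by exact: measurable_funX.
  move=> k; rewrite /Rintegral !(int (fun x => x ^+ _))// m0 /= !expr0n /=.
  by rewrite mulr0 mul0r.
have lawN : has_law P X (normal_prob m s : probability (measurableTypeR R) R).
  by move=> A mA; rewrite law// /gaussian_law (negbTE s0).
have mX n : measurable_fun [set: R] (fun x : R => (x - m) ^+ n).
  by apply: measurable_funX; exact: measurable_funB.
have Nint n : (normal_prob m s).-integrable setT (EFin \o (fun x : R => (x - m) ^+ n)).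
  by apply: integrable_normal_prob => //; exact: integrable_normX_normal.
have Pint n : P.-integrable setT (EFin \o (fun w => (X w - m) ^+ n)).
  exact: (integrable_has_law lawN (mX n) (Nint n)).
have E n : \int[P]_w ((X w - m) ^+ n) =
    \int[lebesgue_measure]_x ((x - m) ^+ n * normal_pdf m s x).
  rewrite /Rintegral (integral_has_law lawN (mX n) (Nint n)).
  by rewrite integral_normal_prob//; exact: integrable_normX_normal.
have EX : \int[P]_w (X w) = m.
  transitivity (\int[P]_w ((X w - m) ^+ 1 + cst m w)).
    by apply: eq_Rintegral => w _; rewrite expr1 /= subrK.
  rewrite RintegralD//; last exact: finite_measure_integrable_cst.
  rewrite E normal_moment_rec// mul0r mul0r add0r Rintegral_cst//.
  by rewrite [X in fine X](_ : _ = 1%E) ?mulr1//; exact: probability_setT.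
move=> EX0; have m0 : m = 0 by rewrite -EX /Rintegral EX0.
split.
  exists (s ^+ 2 *+ 4)^-1; first by rewrite invr_gt0 pmulrn_lgt0// exprn_even_gt0.
  have me : measurable_fun [set: R] (fun x => expR ((s ^+ 2 *+ 4)^-1 * x ^+ 2)).
    by apply: measurableT_comp => //; apply: measurable_funM => //.
  apply: (integrable_has_law lawN me); apply: integrable_normal_prob => //.
  have := integrable_expR_sqr_normal m s0; rewrite /comp m0.
  by under eq_fun do rewrite subr0.
have EE n : \int[P]_w (X w ^+ n) =
    \int[lebesgue_measure]_x ((x - m) ^+ n * normal_pdf m s x).
  by rewrite -E; apply: eq_Rintegral => w _; rewrite m0 subr0.
have E0 : \int[lebesgue_measure]_x ((x - m) ^+ 0 * normal_pdf m s x) = 1.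
  rewrite -E; under eq_Rintegral do rewrite expr0.
  rewrite Rintegral_cst//.
  by rewrite [X in fine X](_ : _ = 1%E) ?mulr1//; exact: probability_setT.
have E2 : \int[P]_w (X w ^+ 2) = s ^+ 2.
  by rewrite EE normal_moment_rec//= E0 mul1r mulr1.
by move=> k; rewrite E2 !EE normal_moment_rec.
Qed.

End centered_gaussian.

(** * Stein's equation for the standard normal law *)

Section stein_equation.
Context {R : realType}.
Local Notation mu := (@lebesgue_measure R).
Let p : R -> R := normal_pdf 0 1.

Let p_gt0 x : 0 < p x.
Proof.
by rewrite /p normal_pdfE ?oner_neq0// mulr_gt0 ?normal_peak_gt0 ?oner_neq0// expR_gt0.
Qed.

Let dp (x : R) : is_derive x (1 : R) p (- x * p x).
Proof.
have := @is_derive_normal_pdf R 0 1 (oner_neq0 _) x.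
by rewrite subr0 expr1n divr1.
Qed.

Let cp : continuous p.
Proof. exact/continuous_normal_pdf/oner_neq0. Qed.

Let xp_integrable : mu.-integrable setT (EFin \o (fun x => x * p x)).
Proof.
have := @integrable_normX_normal R 0 1 (oner_neq0 _) 1.
by rewrite /comp; under eq_fun do rewrite subr0 expr1.
Qed.

Let p_integrable : mu.-integrable setT (EFin \o p).
Proof. exact: integrable_normal_pdf. Qed.

(** -y p(y) is the derivative of p. This exact tail integral is the source of the Mills ratio bound
    on the Stein solution. *)
Let mills_Ny x : \int[mu]_(y in `]-oo, x]) (- (y * p y)) = p x.
Proof.
have [K K0 KP] := @normX_le_expR_sqr R 2^-1 1 ltac:(by rewrite invr_gt0).
apply: (@Rintegral_is_derive_Nyc _ p (fun y => - (y * p y)) 0 (K * normal_peak 1)).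
- by move=> y; rewrite -mulNr; exact: dp.
- move=> y; apply: cvgN; apply: cvgM; [exact: cvg_id|exact: cp].
- by have := integrableN xp_integrable; rewrite /comp; under eq_fun do rewrite -EFinN.
- move=> y; rewrite subr0 (gtr0_norm (p_gt0 y)) -[`|y|]expr1.
  apply: (le_trans (ler_wpM2r (ltW (p_gt0 y)) (KP y))).
  rewrite /p normal_pdfE ?oner_neq0// -mulrA ler_wpM2l// mulrCA ler_piMr ?normal_peak_ge0//.
  rewrite /normal_fun -expRD -[leRHS]expR0 ler_expR subr0 expr1n mulr2n.
  by rewrite [leLHS](_ : _ = 0)//; field.
Qed.

Let mills_y x : \int[mu]_(y in `]x, +oo[) (y * p y) = p x.
Proof.
have [K K0 KP] := @normX_le_expR_sqr R 2^-1 1 ltac:(by rewrite invr_gt0).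
have i1 := xp_integrable.
have total : \int[mu]_y (y * p y) = 0.
  have := @normal_moment_rec R 0 1 (oner_neq0 _) 0.
  rewrite mul0r mul0r; under eq_Rintegral do rewrite subr0 expr1; exact.
have := @Rintegral_itvB R (fun y => y * p y) -oo%O +oo%O x.
rewrite set_itvNyy => /(_ i1 isT isT) <-.
rewrite total sub0r -[RHS]mills_Ny.
under [RHS]eq_Rintegral do rewrite -mulN1r.
rewrite RintegralZl// ?mulN1r//.
by apply: integrableS i1.
Qed.

(** The solution is f = J / p with J(x) the integral of (h - c) p up to x, so f' = (h - c) + x f.
    The bound 2 is 1 + 1: |h - c| <= 1, and |x J(x)| <= p(x) by comparison with a tail integral of
    |y| p(y). Continuity of h makes f of class C^1. *)
Lemma stein_equation (h : R -> R) : continuous h -> (forall x, 0 <= h x <= 1) ->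
  exists f f' : R -> R, [/\ forall x : R, is_derive x (1 : R) f (f' x),
    continuous f', forall x, `|f' x| <= 2 &
    forall x, f' x - x * f x = h x - \int[mu]_y (h y * p y)].
Proof.
move=> ch h01.
have hpi : mu.-integrable setT (EFin \o (fun y => h y * p y)).
  apply: (le_integrable _ _ _ p_integrable) => //.
    apply/measurable_EFinP/measurable_funM; first exact: continuous_measurable_fun.
    exact: continuous_measurable_fun.
  move=> x _; rewrite /= lee_fin normrM ler_piMl//.
  by have /andP[h0 h1] := h01 x; rewrite ger0_norm.
set c := \int[mu]_y (h y * p y).
have Ep : \int[mu]_y p y = 1 by rewrite /Rintegral integral_normal_pdf.
have c01 : 0 <= c <= 1.
  rewrite /c; apply/andP; split.
    by apply: Rintegral_ge0 => x _; case/andP: (h01 x) => ? _; rewrite mulr_ge0// ltW.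
  rewrite -Ep; apply: le_Rintegral => // x _.
  by rewrite ler_piMl ?(ltW (p_gt0 _))//; case/andP: (h01 x).
pose g x := h x - c.
have g1 x : `|g x| <= 1.
  by move: (h01 x) c01 => /andP[? ?] /andP[? ?]; rewrite ler_norml /g; lra.
have cg : continuous g by move=> x; apply: cvgB; [exact: ch|exact: cvg_cst].
have cgp : continuous (fun y => g y * p y).
  by move=> x; apply: cvgM; [exact: cg|exact: cp].
have gpE y : g y * p y = h y * p y - c * p y by rewrite mulrBl.
have cpi : mu.-integrable setT (EFin \o (fun y => c * p y)).
  by rewrite /comp; under eq_fun do rewrite EFinM; exact: integrableZl.
have gpi : mu.-integrable setT (EFin \o (fun y => g y * p y)).
  by rewrite /comp; under eq_fun do rewrite gpE EFinB; exact: integrableB.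
have gp0 : \int[mu]_y (g y * p y) = 0.
  under eq_Rintegral do rewrite gpE.
  by rewrite RintegralB// RintegralZl// Ep mulr1 subrr.
pose J x := \int[mu]_(y in `]-oo, x]) (g y * p y).
have dJ (x : R) : is_derive x (1 : R) J (g x * p x).
  have [||//|d1 d2] := @continuous_FTC1 R (fun y => g y * p y) -oo%O x (x + 1) _ _ _ (cgp x).
  - by rewrite ltrDl.
  - exact: integrableS gpi.
  - by rewrite ltNyr.
  - by apply: (DeriveDef d1); rewrite -derive1E d2.
(* The total integral of g p is 0, so J can be computed from either tail; the tail on the side of x
   is chosen, where |y| >= |x|. *)
have JE x : J x = - \int[mu]_(y in `]x, +oo[) (g y * p y).
  have := @Rintegral_itvB R (fun y => g y * p y) -oo%O +oo%O x.
  by rewrite set_itvNyy => /(_ gpi isT isT) <-; rewrite gp0 sub0r opprK.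
have xJ x : `|x * J x| <= p x.
  (* [sg] is the common sign of x and of the points y of A, and |x| <= |y| there, so |x g(y)| p(y)
     is at most |y| p(y), which is [sg * (y * p y)]. *)
  have bnd (A : set R) (sg : R) : measurable A -> `|sg| = 1 ->
      (forall y, A y -> 0 <= sg * x <= sg * y) ->
      `|x * \int[mu]_(y in A) (g y * p y)| <= \int[mu]_(y in A) (sg * (y * p y)).
    move=> mA sg1 sgA.
    rewrite -RintegralZl//; last exact: integrableS gpi.
    have xgpi : mu.-integrable A (EFin \o (fun y => x * (g y * p y))).
      rewrite /comp; under eq_fun do rewrite EFinM.
      by apply: integrableZl => //; exact: integrableS gpi.
    rewrite (le_trans (@le_normr_Rintegral _ _ _ mu _ _ mA xgpi))//.
    apply: le_Rintegral => //.
    - exact: integrable_norm.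
    - rewrite /comp; under eq_fun do rewrite EFinM.
      by apply: integrableZl => //; exact: integrableS xp_integrable.
    move=> y Ay; have /andP[sx xy] := sgA y Ay.
    rewrite !normrM mulrA [leRHS]mulrA (gtr0_norm (p_gt0 y)) ler_wpM2r ?(ltW (p_gt0 y))//.
    rewrite (le_trans _ xy)// -[sg * x]ger0_norm// normrM sg1 mul1r.
    by rewrite ler_piMr.
  have [x0|x0] := leP 0 x.
    rewrite JE mulrN normrN (le_trans (bnd _ 1 _ _ _))//.
    + by rewrite normr1.
    + by move=> y /=; rewrite in_itv /= andbT => xy; rewrite !mul1r x0 ltW.
    + by under eq_Rintegral do rewrite mul1r; rewrite mills_y.
  rewrite (le_trans (bnd _ (-1) _ _ _))//.
  + by rewrite normrN normr1.
  + by move=> y /=; rewrite in_itv /= => xy; rewrite !mulN1r oppr_ge0 ltW//= lerN2.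
  + by under eq_Rintegral do rewrite mulN1r; rewrite mills_Ny.
have p0 x : p x != 0 by rewrite gt_eqF.
pose f x := J x / p x.
pose f' x := g x + x * f x.
have df (x : R) : is_derive x (1 : R) f (f' x).
  have H1 := @is_deriveV _ _ _ _ _ (p0 x) (dp x).
  have H2 := @is_deriveM _ _ _ _ _ _ _ _ (dJ x) H1.
  apply: is_derive_eq.
  rewrite /f' /f /GRing.scale /=; field.
  by rewrite p0.
exists f, f'; split => //.
- move=> x; apply: cvgD; first exact: cg.
  apply: cvgM; first exact: cvg_id.
  by apply/differentiable_continuous/derivable1_diffP; have [] := df x.
- move=> x; rewrite (le_trans (ler_normD _ _))// (_ : 2 = 1 + 1)// lerD//.
  rewrite /f mulrA normrM normfV ler_pdivrMr ?normr_gt0// mul1r.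
  by rewrite [leRHS]gtr0_norm.
- by move=> x; rewrite /f' addrK.
Qed.

End stein_equation.

(** * Random variables with moments of all orders *)

Section finite_moments.
Context {R : realType} {d} {T : measurableType d} (P : probability T R).
Implicit Types f g : T -> R.

(** A class closed under sums, scaling and products, so that the integrability side conditions of
    the algebra below reduce to closure. *)
Definition all_moments f := measurable_fun [set: T] f /\
  forall p, P.-integrable setT (EFin \o (fun w => `|f w| ^+ p)).

Lemma le_integrable_real f g : measurable_fun [set: T] f ->
  (forall w, `|f w| <= g w) -> P.-integrable setT (EFin \o g) ->
  P.-integrable setT (EFin \o f).
Proof.
move=> mf fg; apply: le_integrable => //; first exact/measurable_EFinP.
by move=> w _; rewrite /= lee_fin (le_trans (fg w))// ler_norm.
Qed.

Lemma integrableD_real f g : P.-integrable setT (EFin \o f) ->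
  P.-integrable setT (EFin \o g) -> P.-integrable setT (EFin \o (fun w => f w + g w)).
Proof.
by move=> fi gi; rewrite /comp; under eq_fun do rewrite EFinD; exact: integrableD.
Qed.

Lemma integrableZ_real (c : R) f : P.-integrable setT (EFin \o f) ->
  P.-integrable setT (EFin \o (fun w => c * f w)).
Proof.
by move=> fi; rewrite /comp; under eq_fun do rewrite EFinM; exact: integrableZl.
Qed.

Lemma all_moments_integrable f : all_moments f -> P.-integrable setT (EFin \o f).
Proof.
by move=> [mf /(_ 1)]; apply: le_integrable_real => // w; rewrite expr1.
Qed.

Lemma all_moments_cst (c : R) : all_moments (fun=> c).
Proof. by split => // p; exact: finite_measure_integrable_cst. Qed.

Lemma all_momentsM f g : all_moments f -> all_moments g ->
  all_moments (fun w => f w * g w).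
Proof.
move=> [mf fi] [mg gi]; split; first exact: measurable_funM.
move=> p; apply: le_integrable_real (integrableD_real (fi (p * 2)%N) (gi (p * 2)%N)).
  apply: measurable_funX; apply: measurableT_comp => //; exact: measurable_funM.
move=> w; rewrite ger0_norm ?exprn_ge0// normrM exprMn !exprM.
have : 0 <= `|f w| ^+ p by rewrite exprn_ge0.
have : 0 <= `|g w| ^+ p by rewrite exprn_ge0.
by move: (`|f w| ^+ p) (`|g w| ^+ p) => a b *; nra.
Qed.

Lemma all_momentsD f g : all_moments f -> all_moments g ->
  all_moments (fun w => f w + g w).
Proof.
move=> [mf fi] [mg gi]; split; first exact: measurable_funD.
move=> p; apply: (le_integrable_real _ _ (integrableZ_real (2 ^+ p) (integrableD_real (fi p) (gi p)))).
  apply: measurable_funX; apply: measurableT_comp => //; exact: measurable_funD.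
move=> w; rewrite ger0_norm ?exprn_ge0// mulrDr -!exprMn.
have [fg|gf] := leP `|f w| `|g w|.
  rewrite -[leLHS]add0r lerD ?exprn_ge0 ?mulr_ge0// lerXn2r ?nnegrE ?mulr_ge0//.
  by rewrite (le_trans (ler_normD _ _))// mulr2n mulrDl mul1r lerD.
rewrite -[leLHS]addr0 lerD ?exprn_ge0 ?mulr_ge0// lerXn2r ?nnegrE ?mulr_ge0//.
by rewrite (le_trans (ler_normD _ _))// mulr2n mulrDl mul1r lerD// ltW.
Qed.

Lemma all_momentsZ (c : R) f : all_moments f -> all_moments (fun w => c * f w).
Proof. by move=> mf; apply: all_momentsM => //; exact: all_moments_cst. Qed.

Lemma all_momentsX f n : all_moments f -> all_moments (fun w => f w ^+ n).
Proof.
move=> mf; elim: n => [|n IHn]; first exact: all_moments_cst.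
by under eq_fun do rewrite exprS; exact: all_momentsM.
Qed.

Lemma all_moments_sum I (r : seq I) (F : I -> T -> R) :
  (forall i, all_moments (F i)) -> all_moments (fun w => \sum_(i <- r) F i w).
Proof.
move=> mF; elim: r => [|i r IHr].
  by under eq_fun do rewrite big_nil; exact: all_moments_cst.
by under eq_fun do rewrite big_cons; exact: all_momentsD.
Qed.

Lemma expectD f g : all_moments f -> all_moments g ->
  \int[P]_w (f w + g w) = \int[P]_w f w + \int[P]_w g w.
Proof. by move=> mf mg; apply: RintegralD => //; exact: all_moments_integrable. Qed.

Lemma expectB f g : all_moments f -> all_moments g ->
  \int[P]_w (f w - g w) = \int[P]_w f w - \int[P]_w g w.
Proof. by move=> mf mg; apply: RintegralB => //; exact: all_moments_integrable. Qed.

Lemma expectZ (c : R) f : all_moments f ->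
  \int[P]_w (c * f w) = c * \int[P]_w f w.
Proof. by move=> mf; apply: RintegralZl => //; exact: all_moments_integrable. Qed.

Lemma expect_cst (c : R) : \int[P]_w c = c.
Proof.
rewrite Rintegral_cst//.
by rewrite [X in fine X](_ : _ = 1%E) ?mulr1//; exact: probability_setT.
Qed.

Lemma expect_sum I (r : seq I) (F : I -> T -> R) : (forall i, all_moments (F i)) ->
  \int[P]_w (\sum_(i <- r) F i w) = \sum_(i <- r) \int[P]_w F i w.
Proof.
move=> mF; elim: r => [|i r IHr].
  by under eq_Rintegral do rewrite big_nil; rewrite big_nil expect_cst.
under eq_Rintegral do rewrite big_cons.
by rewrite big_cons expectD// ?IHr//; exact: all_moments_sum.
Qed.

(* [t |-> E[A (Y + t X)^m]] is a polynomial; comparing its coefficients of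
   degree 1 is how mixed moments are extracted from moments of single
   Gaussian variables. *)
Definition moment_poly m (A X Y : T -> R) : {poly R} :=
  \poly_(k < m.+1) (\int[P]_w (A w * (Y w ^+ (m - k) * X w ^+ k)) *+ 'C(m, k)).

Lemma horner_moment_poly m A X Y t :
  all_moments A -> all_moments X -> all_moments Y ->
  (moment_poly m A X Y).[t] = \int[P]_w (A w * (Y w + t * X w) ^+ m).
Proof.
move=> mA mX mY; rewrite horner_poly.
transitivity (\int[P]_w (\sum_(k < m.+1) (t ^+ k *+ 'C(m, k)) * (A w * (Y w ^+ (m - k) * X w ^+ k)))).
  rewrite expect_sum; last first.
    by move=> k; apply: all_momentsZ; apply: all_momentsM => //;
       apply: all_momentsM; exact: all_momentsX.
  apply: eq_bigr => k _; rewrite expectZ.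
    by rewrite mulrnAl mulrnAl mulrC.
  by apply: all_momentsM => //; apply: all_momentsM; exact: all_momentsX.
apply: eq_Rintegral => w _; rewrite exprDn mulr_sumr; apply: eq_bigr => k _.
rewrite exprMn -mulr_natr -[in RHS]mulr_natr; ring.
Qed.

Lemma coef0_moment_poly m A X Y :
  (moment_poly m A X Y)`_0 = \int[P]_w (A w * Y w ^+ m).
Proof.
rewrite coef_poly /= bin0 mulr1n; apply: eq_Rintegral => w _.
by rewrite subn0 expr0 mulr1.
Qed.

Lemma coef1_moment_poly m A X Y :
  (moment_poly m A X Y)`_1 = m%:R * \int[P]_w (A w * (Y w ^+ m.-1 * X w)).
Proof.
rewrite coef_poly; case: m => [|m] /=; first by rewrite mul0r.
rewrite bin1 -[LHS]mulr_natl; congr (_ * _); apply: eq_Rintegral => w _.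
by rewrite subSS subn0 expr1.
Qed.

(** The difference vanishes at the naturals below its size, which are distinct in characteristic 0
    and too many for its degree. *)
Lemma eq_poly_horner (p q : {poly R}) : (forall t, p.[t] = q.[t]) -> p = q.
Proof.
move=> pq; apply/eqP; rewrite -subr_eq0; apply/eqP.
apply: (@roots_geq_poly_eq0 _ _ [seq k%:R | k <- iota 0 (size (p - q))]).
- by apply/allP => x _; rewrite rootE hornerD hornerN pq subrr.
- rewrite map_inj_uniq ?iota_uniq// => i j /eqP; rewrite eqr_nat => /eqP //.
- by rewrite size_map size_iota.
Qed.

End finite_moments.

(** * Gaussian integration by parts for polynomials *)

Section gaussian_space.
Context {R : realType} {d} {T : measurableType d} (P : probability T R).
Variable V : (T -> R) -> Prop.
Hypothesis V_lin : forall X Y (t : R), V X -> V Y -> V (fun w => X w + t * Y w).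
Hypothesis V_meas : forall X, V X -> measurable_fun [set: T] X.
Hypothesis V_gauss : forall X, V X -> gaussian_rv P X.
Hypothesis V_center : forall X, V X -> (\int[P]_w (X w)%:E = 0)%E.

Local Notation "''E' f" := (\int[P]_w f w) (at level 10, f at level 9).

Lemma gaussian_all_moments X : V X -> all_moments P X.
Proof.
move=> VX; split; first exact: V_meas.
have [[a a0 ai] _] := centered_gaussian_moments (V_meas VX) (V_gauss VX) (V_center VX).
move=> p; have [K K0 KP] := normX_le_expR_sqr p a0.
apply: (le_integrable_real _ _ (integrableZ_real K ai)).
  by apply: measurable_funX; apply: measurableT_comp => //; exact: V_meas.
by move=> w; rewrite ger0_norm ?exprn_ge0.
Qed.

Let moments k X : V X -> \int[P]_w (X w ^+ k.+1) =
     k%:R * \int[P]_w (X w ^+ 2) * \int[P]_w (X w ^+ k.-1).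
Proof.
move=> VX.
by have [_] := centered_gaussian_moments (V_meas VX) (V_gauss VX) (V_center VX).
Qed.

(** Polarization: the moment recursion for E (Y + t b)^(m+2) is an identity between polynomials in
    t. Its coefficient of degree 1 expresses E[b Y^(m+1)] through E[b Y^(m-1)], which calls for
    strong induction. *)
Lemma gaussian_ibp_power b Y m : V b -> V Y ->
  \int[P]_w (b w * Y w ^+ m) =
  m%:R * \int[P]_w (b w * Y w) * \int[P]_w (Y w ^+ m.-1).
Proof.
move=> Vb VY; have Mb := gaussian_all_moments Vb; have MY := gaussian_all_moments VY.
have M1 := all_moments_cst P (1 : R).
elim/ltn_ind: m => -[_|m IHm].
  rewrite !mul0r; under eq_Rintegral do rewrite expr0 mulr1.
  by rewrite /Rintegral V_center.
have pE : moment_poly P m.+2 (fun=> 1) b Y =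
    m.+1%:R *: (moment_poly P 2 (fun=> 1) b Y * moment_poly P m (fun=> 1) b Y).
  apply: eq_poly_horner => t; rewrite hornerZ hornerM !horner_moment_poly//.
  under eq_Rintegral do rewrite mul1r.
  under [X in _ = _ * (X * _)]eq_Rintegral do rewrite mul1r.
  under [X in _ = _ * (_ * X)]eq_Rintegral do rewrite mul1r.
  by rewrite (moments m.+1 (V_lin t VY Vb)) mulrA.
have := congr1 (fun p : {poly R} => p`_1) pE.
rewrite coefZ coefM big_ord_recr big_ord1 /= !coef1_moment_poly !coef0_moment_poly /=.
have EY1 n : \int[P]_w (1 * (Y w ^+ n * b w)) = \int[P]_w (b w * Y w ^+ n).
  by apply: eq_Rintegral => w _; rewrite mul1r mulrC.
have E1 n : \int[P]_w (1 * Y w ^+ n) = \int[P]_w (Y w ^+ n).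
  by apply: eq_Rintegral => w _; rewrite mul1r.
have Eb1 : \int[P]_w (b w * Y w ^+ 1) = \int[P]_w (b w * Y w).
  by apply: eq_Rintegral => w _; rewrite expr1.
rewrite !EY1 !E1 Eb1 => H.
(* The induction hypothesis for the power m - 1; the moment recursion for Y turns (m - 1) E[Y^2]
   E[Y^(m-2)] back into E[Y^m]. *)
have IH : m%:R * \int[P]_w (Y w ^+ 2) * \int[P]_w (b w * Y w ^+ m.-1) =
    m%:R * \int[P]_w (b w * Y w) * \int[P]_w (Y w ^+ m).
  case: m IHm {pE H} => [|m] IHm; first by rewrite !mul0r.
  rewrite IHm//= (moments m VY); ring.
apply: (@mulfI _ m.+2%:R); first by rewrite pnatr_eq0.
rewrite H.
transitivity (m.+1%:R * (m%:R * \int[P]_w (Y w ^+ 2) * \int[P]_w (b w * Y w ^+ m.-1) +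
   2 * \int[P]_w (b w * Y w) * \int[P]_w (Y w ^+ m))).
  ring.
by rewrite IH -!natr1; ring.
Qed.

Fixpoint lprod (L : list (T -> R)) : T -> R :=
  if L is X :: L' then fun w => X w * lprod L' w else fun=> 1.

(** Leibniz' rule for the derivation that sends X to the constant E[b X]. Lists give the induction
    one factor at a time. *)
Fixpoint dlprod (b : T -> R) (L : list (T -> R)) : T -> R :=
  if L is X :: L' then
    fun w => \int[P]_w (b w * X w) * lprod L' w + X w * dlprod b L' w
  else fun=> 0.

Fixpoint lin_space (L : list (T -> R)) : Prop :=
  if L is X :: L' then V X /\ lin_space L' else True.

Lemma all_moments_lprod L : lin_space L -> all_moments P (lprod L).
Proof.
elim: L => [_|X L IHL /= [VX /IHL ML]]; first exact: all_moments_cst.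
by apply: all_momentsM => //; exact: gaussian_all_moments.
Qed.

Lemma all_moments_dlprod b L : lin_space L -> all_moments P (dlprod b L).
Proof.
elim: L => [_|X L IHL /= [VX VL]]; first exact: all_moments_cst.
apply: all_momentsD; first by apply: all_momentsZ; exact: all_moments_lprod.
by apply: all_momentsM; [exact: gaussian_all_moments|exact: IHL].
Qed.

(** The free power of Y drives the induction on L: in the identity for L, applied to Y + t X with
    exponent m + 1, the coefficient of t is the identity for X :: L with exponent m. *)
Lemma gaussian_ibp_lprod_power b L Y m : V b -> lin_space L -> V Y ->
  \int[P]_w (b w * lprod L w * Y w ^+ m) =
  \int[P]_w (dlprod b L w * Y w ^+ m) +
  m%:R * \int[P]_w (b w * Y w) * \int[P]_w (lprod L w * Y w ^+ m.-1).
Proof.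
move=> Vb; have Mb := gaussian_all_moments Vb.
elim: L Y m => [|X L IHL] Y m VL VY.
  rewrite /=; under eq_Rintegral do rewrite mulr1.
  under [X in _ = X + _]eq_Rintegral do rewrite mul0r.
  under [X in _ = _ + _ * X]eq_Rintegral do rewrite mul1r.
  by rewrite expect_cst add0r gaussian_ibp_power.
have [VX VL'] := VL.
have MX := gaussian_all_moments VX; have MY := gaussian_all_moments VY.
have ML := all_moments_lprod VL'; have MD := all_moments_dlprod b VL'.
have MbL : all_moments P (fun w => b w * lprod L w) by exact: all_momentsM.
have pE : moment_poly P m.+1 (fun w => b w * lprod L w) X Y =
    moment_poly P m.+1 (dlprod b L) X Y +
    m.+1%:R *: (((\int[P]_w (b w * Y w))%:P + \int[P]_w (b w * X w) *: 'X) *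
    moment_poly P m (lprod L) X Y).
  apply: eq_poly_horner => t.
  rewrite hornerD hornerZ hornerM hornerD hornerC hornerZ hornerX !horner_moment_poly//.
  rewrite (IHL _ _ VL' (V_lin t VY VX)) -mulrA; congr (_ + _ * (_ * _)).
  rewrite [_ * t]mulrC -expectZ; last exact: all_momentsM.
  rewrite -expectD; last 2 first.
  - exact: all_momentsM.
  - by apply: all_momentsZ; exact: all_momentsM.
  by apply: eq_Rintegral => w _; ring.
have := congr1 (fun p : {poly R} => p`_1) pE.
rewrite coefD coefZ coefM big_ord_recr big_ord1 /= !coef1_moment_poly !coef0_moment_poly /=.
rewrite !coefD !coefC !coefZ !coefX /= mulr0 addr0 add0r mulr1 => H.
apply: (@mulfI _ m.+1%:R); first by rewrite pnatr_eq0.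
have E1 (A : T -> R) : \int[P]_w (A w * (Y w ^+ m * X w)) = \int[P]_w (X w * A w * Y w ^+ m).
  by apply: eq_Rintegral => w _; ring.
have E2 (A : T -> R) : \int[P]_w (A w * (Y w ^+ m.-1 * X w)) = \int[P]_w (X w * A w * Y w ^+ m.-1).
  by apply: eq_Rintegral => w _; ring.
transitivity (m.+1%:R * \int[P]_w (b w * lprod L w * (Y w ^+ m * X w))).
  by congr (_ * _); apply: eq_Rintegral => w _; ring.
rewrite H !E1 !E2 -mulrDr; congr (_ * _).
transitivity (\int[P]_w (X w * dlprod b L w * Y w ^+ m) +
  \int[P]_w (b w * X w) * \int[P]_w (lprod L w * Y w ^+ m) +
  m%:R * \int[P]_w (b w * Y w) * \int[P]_w (X w * lprod L w * Y w ^+ m.-1)).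
  ring.
congr (_ + _); rewrite -expectZ; last by apply: all_momentsM => //; exact: all_momentsX.
rewrite -expectD; last 2 first.
- by apply: all_momentsM; [exact: all_momentsM|exact: all_momentsX].
- by apply: all_momentsZ; apply: all_momentsM => //; exact: all_momentsX.
by apply: eq_Rintegral => w _; ring.
Qed.

Lemma gaussian_ibp_lprod b L : V b -> lin_space L ->
  \int[P]_w (b w * lprod L w) = \int[P]_w dlprod b L w.
Proof.
move=> Vb VL; have := @gaussian_ibp_lprod_power b L b 0 Vb VL Vb.
rewrite !mul0r addr0.
by under eq_Rintegral do rewrite expr0 mulr1; under [RHS]eq_Rintegral do rewrite expr0 mulr1.
Qed.

(* [polynomial_derivative b phi psi]: [phi] is a polynomial in elements of [V]
   and [psi] is its derivative in the direction given by [X |-> E[b X]]. *)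
Inductive polynomial_derivative (b : T -> R) : (T -> R) -> (T -> R) -> Prop :=
| pd_one : polynomial_derivative b (fun=> 1) (fun=> 0)
| pd_mul X phi psi : V X -> polynomial_derivative b phi psi ->
    polynomial_derivative b (fun w => X w * phi w)
      (fun w => \int[P]_w (b w * X w) * phi w + X w * psi w)
| pd_add (c : R) phi psi phi' psi' : polynomial_derivative b phi psi ->
    polynomial_derivative b phi' psi' ->
    polynomial_derivative b (fun w => phi w + c * phi' w)
      (fun w => psi w + c * psi' w).

Lemma all_moments_pd b phi psi : polynomial_derivative b phi psi ->
  all_moments P phi /\ all_moments P psi.
Proof.
elim=> {phi psi} [|X phi psi VX _ [M1 M2]|c phi psi phi' psi' _ [M1 M2] _ [M3 M4]].
- by split; exact: all_moments_cst.
- have MX := gaussian_all_moments VX; split; first exact: all_momentsM.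
  by apply: all_momentsD; [exact: all_momentsZ|exact: all_momentsM].
- by split; apply: all_momentsD => //; exact: all_momentsZ.
Qed.

Lemma gaussian_ibp b phi psi : V b -> polynomial_derivative b phi psi ->
  \int[P]_w (b w * phi w) = \int[P]_w psi w.
Proof.
move=> Vb pd; have Mb := gaussian_all_moments Vb.
(* Generalized over a trailing product: in the case [pd_mul] the factor X moves from [phi] to the
   list, where Leibniz' rule is built into [dlprod]. *)
suff H L : lin_space L -> \int[P]_w (b w * (phi w * lprod L w)) =
    \int[P]_w (psi w * lprod L w + phi w * dlprod b L w).
  have := H [::] I; rewrite /=.
  under eq_Rintegral do rewrite mulr1.
  by under [X in _ = X]eq_Rintegral do rewrite mulr1 mulr0 addr0.
elim: pd L => {phi psi} [|X phi psi VX pd IH|c phi psi phi' psi' pd IH pd' IH'] L VL.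
- under eq_Rintegral do rewrite mul1r.
  under [RHS]eq_Rintegral do rewrite mul0r add0r mul1r.
  exact: gaussian_ibp_lprod.
- have := IH (X :: L) (conj VX VL).
  rewrite /= => H; transitivity (\int[P]_w (b w * (phi w * (X w * lprod L w)))).
    by apply: eq_Rintegral => w _; ring.
  by rewrite H; apply: eq_Rintegral => w _; ring.
have [M1 M2] := all_moments_pd pd; have [M3 M4] := all_moments_pd pd'.
have ML := all_moments_lprod VL; have MD := all_moments_dlprod b VL.
transitivity (\int[P]_w (b w * (phi w * lprod L w)) + c * \int[P]_w (b w * (phi' w * lprod L w))).
  rewrite -expectZ; last by do 2 apply: all_momentsM => //.
  rewrite -expectD; last 2 first.
  - by do 2 apply: all_momentsM => //.
  - by apply: all_momentsZ; do 2 apply: all_momentsM => //.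
  by apply: eq_Rintegral => w _; ring.
rewrite IH// IH'// -expectZ; last by apply: all_momentsD; exact: all_momentsM.
rewrite -expectD; last 2 first.
- by apply: all_momentsD; exact: all_momentsM.
- by apply: all_momentsZ; apply: all_momentsD; exact: all_momentsM.
by apply: eq_Rintegral => w _; ring.
Qed.

End gaussian_space.

Section exponential_series.
Context {R : realType}.

(** The partial sums of exp(-x) are not bounded by 1, only by the sums of the absolute terms, hence
    by exp(x). This is why exponential moments of Q enter. *)
Lemma normr_series_exp_coeff (x : R) L : 0 <= x ->
  `|\sum_(l < L) exp_coeff (- x) l| <= expR x.
Proof.
move=> x0; rewrite (le_trans (ler_norm_sum _ _ _))//.
have -> : \sum_(l < L) `|exp_coeff (- x) l| = series (exp_coeff x) L.
  rewrite /series /= big_mkord; apply: eq_bigr => l _.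
  by rewrite !exp_coeffE normrM normrX normrN (ger0_norm x0) ger0_norm// invr_ge0.
apply: nondecreasing_cvgn_le; last exact: is_cvg_series_exp_coeff.
by apply: nondecreasing_series => l _ _; exact: exp_coeff_ge0.
Qed.

Lemma cvg_sum_exp_coeff (x : R) : \sum_(l < L) exp_coeff x l @[L --> \oo] --> expR x.
Proof.
rewrite (_ : (fun L => _) = series (exp_coeff x)); last first.
  by apply/funext => L; rewrite /series /= big_mkord.
exact: is_cvg_series_exp_coeff.
Qed.

End exponential_series.

(** * The quadratic form Q: integration by parts and variances *)

Section quadratic_form.
Context {R : realType} {d} {T : measurableType d} (P : probability T R).
Variable V : (T -> R) -> Prop.
Hypothesis V_lin : forall X Y (t : R), V X -> V Y -> V (fun w => X w + t * Y w).
Hypothesis V_meas : forall X, V X -> measurable_fun [set: T] X.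
Hypothesis V_gauss : forall X, V X -> gaussian_rv P X.
Hypothesis V_center : forall X, V X -> (\int[P]_w (X w)%:E = 0)%E.
Variables (n : nat) (xi : 'I_n -> T -> R).
Hypothesis V_xi : forall i, V (xi i).

Local Notation pd := (polynomial_derivative P V).
Let C i j : R := \int[P]_w (xi i w * xi j w).
Let Q w := \sum_i xi i w ^+ 2.
Let W w := \sum_i \sum_j C i j * (xi i w * xi j w).
Let tau := \sum_i C i i.

Lemma pd_zero b : pd b (fun=> 0) (fun=> 0).
Proof.
have := pd_add (-1) (pd_one P V b) (pd_one P V b).
by rewrite mulN1r subrr mulr0 addr0.
Qed.

Lemma pd_linear b X : V X -> pd b X (fun=> \int[P]_w (b w * X w)).
Proof.
move=> VX; have := pd_mul VX (pd_one P V b).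
by under eq_fun do rewrite mulr1; under [X in pd _ _ X -> _]eq_fun do rewrite mulr1 mulr0 addr0.
Qed.

Lemma pd_prod b phi psi phi' psi' : pd b phi psi -> pd b phi' psi' ->
  pd b (fun w => phi w * phi' w) (fun w => psi w * phi' w + phi w * psi' w).
Proof.
elim=> {phi psi} [|X phi psi VX _ IH|c phi psi phi2 psi2 _ IH1 _ IH2] pd'.
- under eq_fun do rewrite mul1r; under [X in pd _ _ X]eq_fun do rewrite mul0r add0r mul1r.
  exact: pd'.
- have := pd_mul VX (IH pd').
  congr polynomial_derivative; apply/funext => w; ring.
- have := pd_add c (IH1 pd') (IH2 pd').
  congr polynomial_derivative; apply/funext => w; ring.
Qed.

Lemma pd_sum b I (r : seq I) (F G : I -> T -> R) : (forall i, pd b (F i) (G i)) ->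
  pd b (fun w => \sum_(i <- r) F i w) (fun w => \sum_(i <- r) G i w).
Proof.
move=> FG; elim: r => [|i r IHr].
  by under eq_fun do rewrite big_nil; under [X in pd _ _ X]eq_fun do rewrite big_nil;
    exact: pd_zero.
have := pd_add 1 (FG i) IHr.
by congr polynomial_derivative; apply/funext => w; rewrite mul1r big_cons.
Qed.

Lemma pd_scale b (c : R) phi psi : pd b phi psi ->
  pd b (fun w => c * phi w) (fun w => c * psi w).
Proof.
move=> p; have := pd_add c (pd_zero b) p.
by congr polynomial_derivative; apply/funext => w; rewrite add0r.
Qed.

Lemma pd_power b phi psi m : pd b phi psi ->
  pd b (fun w => phi w ^+ m) (fun w => m%:R * phi w ^+ m.-1 * psi w).
Proof.
move=> p; elim: m => [|m IHm].
  under [X in pd _ _ X]eq_fun do rewrite !mul0r; exact: pd_one.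
have := pd_prod p IHm.
congr polynomial_derivative; apply/funext => w; first by rewrite exprS.
rewrite /=; case: m {IHm} => [|m] /=; first by rewrite !mul0r expr0; ring.
by rewrite -[in RHS]natr1 exprS; ring.
Qed.

Lemma pd_Q b : pd b Q (fun w => 2 * \sum_i \int[P]_w (b w * xi i w) * xi i w).
Proof.
have := pd_sum (index_enum 'I_n) (fun i => pd_power 2 (pd_linear b (V_xi i))).
congr polynomial_derivative; apply/funext => w.
by rewrite mulr_sumr; apply: eq_bigr => i _; rewrite /= expr1; ring.
Qed.

Let Mxi i : all_moments P (xi i) := gaussian_all_moments V_meas V_gauss V_center (V_xi i).

Lemma all_moments_Q : all_moments P Q.
Proof. by apply: all_moments_sum => i; exact: all_momentsX. Qed.

Lemma all_moments_W : all_moments P W.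
Proof.
by do 2 (apply: all_moments_sum => ?); apply: all_momentsZ; exact: all_momentsM.
Qed.

Let MQ := all_moments_Q.
Let MW := all_moments_W.
Let Mc c : all_moments P (fun=> c) := all_moments_cst P c.

Let MQt : all_moments P (fun w => Q w - tau).
Proof. exact: all_momentsD. Qed.

Let CC i j : C i j = C j i.
Proof. by apply: eq_Rintegral => w _; rewrite mulrC. Qed.

(** Q^(m+1) is the sum of the xi_j (xi_j Q^m). The derivative of the inner xi_j gives C_jj Q^m,
    which sums to tau Q^m; that of Q^m gives 2 m Q^(m-1) (C xi)_j, which sums against xi_j to 2 m W
    Q^(m-1). *)
Lemma quadratic_ibp_power m :
  \int[P]_w ((Q w - tau) * Q w ^+ m) = m%:R * (2 * \int[P]_w (W w * Q w ^+ m.-1)).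
Proof.
have MQm k : all_moments P (fun w => Q w ^+ k) by exact: all_momentsX.
have stepj j : \int[P]_w (xi j w * (xi j w * Q w ^+ m)) =
    \int[P]_w (C j j * Q w ^+ m +
       xi j w * (m%:R * Q w ^+ m.-1 * (2 * \sum_i C j i * xi i w))).
  apply: (gaussian_ibp V_lin V_meas V_gauss V_center (V_xi j)).
  by apply: pd_mul => //; apply: pd_power; exact: pd_Q.
transitivity (\sum_j \int[P]_w (xi j w * (xi j w * Q w ^+ m)) - \sum_j \int[P]_w (C j j * Q w ^+ m)).
  rewrite -!expect_sum; last 2 first.
  - by move=> j; exact: all_momentsZ.
  - by move=> j; do 2 apply: all_momentsM => //.
  rewrite -expectB; last 2 first.
  - by apply: all_moments_sum => j; do 2 apply: all_momentsM => //.
  - by apply: all_moments_sum => j; exact: all_momentsZ.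
  apply: eq_Rintegral => w _; rewrite mulrBl -mulr_suml; congr (_ - _).
  by rewrite mulr_suml; apply: eq_bigr => j _; rewrite mulrA expr2.
have Mlin j : all_moments P (fun w => \sum_i C j i * xi i w).
  by apply: all_moments_sum => i; exact: all_momentsZ.
have Mj j : all_moments P (fun w => xi j w * (m%:R * Q w ^+ m.-1 * (2 * \sum_i C j i * xi i w))).
  apply: all_momentsM => //; apply: all_momentsM; exact: all_momentsZ.
transitivity (\sum_j \int[P]_w (xi j w * (m%:R * Q w ^+ m.-1 * (2 * \sum_i C j i * xi i w)))).
  rewrite -sumrB; apply: eq_bigr => j _; rewrite stepj expectD//; last exact: all_momentsZ.
  by rewrite addrC addKr.
rewrite -expect_sum// mulrA -expectZ; last exact: all_momentsM.
apply: eq_Rintegral => w _; rewrite /W mulr_suml mulr_sumr; apply: eq_bigr => j _.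
rewrite !mulr_sumr mulr_suml mulr_sumr; apply: eq_bigr => i _; ring.
Qed.

Lemma expect_W : \int[P]_w W w = \sum_i \sum_j C i j ^+ 2.
Proof.
rewrite expect_sum; last first.
  by move=> i; apply: all_moments_sum => j; apply: all_momentsZ; exact: all_momentsM.
apply: eq_bigr => i _; rewrite expect_sum; last first.
  by move=> j; apply: all_momentsZ; exact: all_momentsM.
by apply: eq_bigr => j _; rewrite expectZ//; exact: all_momentsM.
Qed.

Lemma expect_Q : \int[P]_w Q w = tau.
Proof.
rewrite expect_sum; last by move=> i; exact: all_momentsX.
by apply: eq_bigr => i _; apply: eq_Rintegral => w _; rewrite expr2.
Qed.

Lemma variance_Q : \int[P]_w ((Q w - tau) ^+ 2) = 2 * \sum_i \sum_j C i j ^+ 2.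
Proof.
have := quadratic_ibp_power 1; rewrite mul1r /=.
under [X in _ = _ * X]eq_Rintegral do rewrite expr0 mulr1.
rewrite expect_W => <-.
have E0 : \int[P]_w ((Q w - tau) * tau) = 0.
  under eq_Rintegral do rewrite mulrC.
  by rewrite expectZ// expectB// expect_Q expect_cst subrr mulr0.
rewrite -[LHS]addr0 -E0 -expectD; last 2 first.
- exact: all_momentsX.
- exact: all_momentsM.
by apply: eq_Rintegral => w _; ring.
Qed.

(** With v = C xi, W is the sum of the xi_j v_j. Integrating by parts against xi_j yields D^2 from
    the derivative of v_j, and from that of W twice the j-th entry of C v. Finally E[v_j v_i] is an
    entry of C^3, so the result is 2 tr(C^4). *)
Lemma variance_W : \int[P]_w ((W w - \sum_i \sum_j C i j ^+ 2) ^+ 2) =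
  2 * \sum_j \sum_k C j k * \sum_a \sum_b C j a * C k b * C a b.
Proof.
set D := \sum_i \sum_j C i j ^+ 2.
pose v j w := \sum_k C j k * xi k w.
have Mv j : all_moments P (v j) by apply: all_moments_sum => k; exact: all_momentsZ.
have WE w : W w = \sum_j xi j w * v j w.
  by apply: eq_bigr => j _; rewrite mulr_sumr; apply: eq_bigr => k _; ring.
have pdv b j : pd b (v j) (fun=> \sum_k C j k * \int[P]_w (b w * xi k w)).
  by apply: (pd_sum (index_enum 'I_n)) => k; apply: pd_scale; exact: pd_linear.
have pdW b : pd b W (fun w => \sum_j (\int[P]_w (b w * xi j w) * v j w +
     xi j w * \sum_k C j k * \int[P]_w (b w * xi k w))).
  have := pd_sum (index_enum 'I_n) (fun j => pd_mul (V_xi j) (pdv b j)).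
  by congr polynomial_derivative; apply/funext => w; rewrite WE.
have stepj j : \int[P]_w (xi j w * (v j w * W w)) = \int[P]_w ((\sum_k C j k * C j k) * W w +
     v j w * \sum_i (C j i * v i w + xi i w * \sum_k C i k * C j k)).
  by apply: (gaussian_ibp V_lin V_meas V_gauss V_center (V_xi j)); exact: pd_prod.
have Mj j : all_moments P (fun w => v j w * \sum_i (C j i * v i w + xi i w * \sum_k C i k * C j k)).
  apply: all_momentsM => //; apply: all_moments_sum => i.
  by apply: all_momentsD; [exact: all_momentsZ|exact: all_momentsM].
have Wsq : \int[P]_w (W w ^+ 2) = D ^+ 2 +
    \sum_j \int[P]_w (v j w * \sum_i (C j i * v i w + xi i w * \sum_k C i k * C j k)).
  transitivity (\sum_j \int[P]_w (xi j w * (v j w * W w))).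
    rewrite -expect_sum; last by move=> j; do 2 apply: all_momentsM => //.
    apply: eq_Rintegral => w _; rewrite expr2 {1}WE mulr_suml.
    by apply: eq_bigr => j _; rewrite mulrA.
  have -> : D ^+ 2 = \sum_j \int[P]_w ((\sum_k C j k * C j k) * W w).
    rewrite expr2 {1}/D mulr_suml; apply: eq_bigr => j _.
    by rewrite expectZ// expect_W.
  rewrite -big_split /=; apply: eq_bigr => j _.
  by rewrite stepj expectD//; exact: all_momentsZ.
have vv j i : \int[P]_w (v j w * v i w) = \sum_a \sum_b C j a * C i b * C a b.
  transitivity (\int[P]_w (\sum_a \sum_b C j a * C i b * (xi a w * xi b w))).
    apply: eq_Rintegral => w _; rewrite /v mulr_suml; apply: eq_bigr => a _.
    by rewrite mulr_sumr; apply: eq_bigr => b _; ring.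
  rewrite expect_sum; last by move=> a; apply: all_moments_sum => b; apply: all_momentsZ; exact: all_momentsM.
  apply: eq_bigr => a _; rewrite expect_sum; last by move=> b; apply: all_momentsZ; exact: all_momentsM.
  by apply: eq_bigr => b _; rewrite expectZ//; exact: all_momentsM.
(* The derivative of W hits either of its two factors, and symmetry of C makes the two contributions
   equal. *)
have vC w j : \sum_i (C j i * v i w + xi i w * \sum_k C i k * C j k) = \sum_i 2 * C j i * v i w.
  rewrite big_split /=.
  have -> : \sum_i xi i w * \sum_k C i k * C j k = \sum_i C j i * v i w.
    under eq_bigr do rewrite mulr_sumr.
    rewrite exchange_big /=; apply: eq_bigr => k _; rewrite mulr_sumr.
    by apply: eq_bigr => i _; rewrite [C i k]CC; ring.
  by rewrite -big_split /=; apply: eq_bigr => i _; ring.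
transitivity (\int[P]_w (W w ^+ 2) - D ^+ 2).
  transitivity (\int[P]_w ((W w ^+ 2 + (- (2 * D)) * W w) + D ^+ 2)).
    by apply: eq_Rintegral => w _; ring.
  rewrite expectD//; last by apply: all_momentsD; [exact: all_momentsX|exact: all_momentsZ].
  rewrite expectD//; [|exact: all_momentsX|exact: all_momentsZ].
  by rewrite expectZ// expect_W expect_cst -/D; ring.
rewrite Wsq addrC addKr mulr_sumr; apply: eq_bigr => j _.
transitivity (\int[P]_w (\sum_i 2 * C j i * (v j w * v i w))).
  apply: eq_Rintegral => w _; rewrite vC mulr_sumr; apply: eq_bigr => i _; ring.
rewrite expect_sum; last by move=> i; apply: all_momentsZ; exact: all_momentsM.
rewrite mulr_sumr; apply: eq_bigr => i _; rewrite expectZ; last exact: all_momentsM.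
by rewrite vv mulrA.
Qed.

End quadratic_form.

(** * From powers of Q to functions of class C^1 *)

Section moment_identity_extension.
Context {R : realType} {d} {T : measurableType d} (P : probability T R).
Local Notation mu := (@lebesgue_measure R).
Variables (Q W : T -> R) (tau delta : R).
Hypothesis Q_ge0 : forall w, 0 <= Q w.
Hypothesis MQ : all_moments P Q.
Hypothesis MW : all_moments P W.
Hypothesis delta_gt0 : 0 < delta.
Hypothesis expQ : P.-integrable setT (EFin \o (fun w => expR (2 * delta * Q w))).
Hypothesis moment_identity : forall m,
  \int[P]_w ((Q w - tau) * Q w ^+ m) = m%:R * (2 * \int[P]_w (W w * Q w ^+ m.-1)).

Let e k w := expR (- (k%:R * delta) * Q w).

Let mQ : measurable_fun [set: T] Q. Proof. by case: MQ. Qed.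

Let e_bound k w : 0 <= e k w <= 1.
Proof.
rewrite expR_ge0 /= -[leRHS]expR0 ler_expR mulNr oppr_le0.
by rewrite !mulr_ge0 ?(ltW delta_gt0).
Qed.

Let Me k : all_moments P (e k).
Proof.
have me : measurable_fun [set: T] (e k).
  by apply: measurableT_comp => //; exact: measurable_funM.
split => // p; apply: le_integrable_real (finite_measure_integrable_cst P 1 measurableT) => //.
  by apply: measurable_funX; exact: measurableT_comp.
move=> w; rewrite ger0_norm ?exprn_ge0// exprn_ile1//.
by case/andP: (e_bound k w) => e0 e1; rewrite ger0_norm.
Qed.

Let eS k w : e k.+1 w = e k w * expR (- delta * Q w).
Proof. by rewrite /e -expRD -natr1; congr expR; ring. Qed.

Let MQt : all_moments P (fun w => Q w - tau).
Proof. by apply: all_momentsD => //; exact: all_moments_cst. Qed.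

(** Only the new factor exp(-delta Q) is expanded, while [e k] stays closed and is bounded by 1. The
    majorant |Y| exp(delta Q) <= Y^2 + exp(2 delta Q) explains the 2 delta in the exponential
    moment. *)
Let cvg_exp_tilt Y k : all_moments P Y ->
  \sum_(l < L) ((- delta) ^+ l / l`!%:R * \int[P]_w (Y w * Q w ^+ l * e k w))
    @[L --> \oo] --> \int[P]_w (Y w * e k.+1 w).
Proof.
move=> MY; have [mY _] := MY.
pose u (L : nat) w := Y w * e k w * \sum_(l < L) exp_coeff (- (delta * Q w)) l.
have uE L : \sum_(l < L) ((- delta) ^+ l / l`!%:R * \int[P]_w (Y w * Q w ^+ l * e k w)) =
    \int[P]_w u L w.
  rewrite /u; under [RHS]eq_Rintegral do rewrite mulr_sumr.
  rewrite expect_sum; last first.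
    move=> l; apply: all_momentsM; first exact: all_momentsM.
    under eq_fun do rewrite exp_coeffE -mulNr exprMn.
    by apply: all_momentsZ; apply: all_momentsZ; exact: all_momentsX.
  apply: eq_bigr => l _; rewrite -expectZ; last first.
    by apply: all_momentsM => //; apply: all_momentsM => //; exact: all_momentsX.
  by apply: eq_Rintegral => w _; rewrite exp_coeffE -mulNr exprMn; ring.
under eq_fun do rewrite uE.
have mu_ L : measurable_fun [set: T] (u L).
  apply: measurable_funM; first by apply: measurable_funM => //; case: (Me k).
  apply: measurable_sum => l; under eq_fun do rewrite exp_coeffE.
  apply: measurable_funM => //; apply: measurable_funX; apply: measurable_funN.
  exact: measurable_funM.
have u_cvg w : u L w @[L --> \oo] --> Y w * e k.+1 w.
  rewrite eS mulrA mulNr; apply: cvgM; first exact: cvg_cst.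
  exact: cvg_sum_exp_coeff.
have gi : P.-integrable setT (EFin \o (fun w => Y w ^+ 2 + expR (2 * delta * Q w))).
  by apply: integrableD_real => //; apply: all_moments_integrable; exact: all_momentsX.
have ug L w : `|u L w| <= Y w ^+ 2 + expR (2 * delta * Q w).
  rewrite /u !normrM.
  have dQ : 0 <= delta * Q w by rewrite mulr_ge0 ?(ltW delta_gt0).
  apply: (@le_trans _ _ (`|Y w| * expR (delta * Q w))).
    rewrite ler_pM ?mulr_ge0// ?normr_series_exp_coeff//.
    case/andP: (e_bound k w) => e0 e1.
    by rewrite ler_piMr// ger0_norm.
  rewrite -mulrA (mulr_natl _ 2) mulr2n expRD -[Y w ^+ 2]real_normK ?num_real//.
  have : 0 <= expR (delta * Q w) by exact: expR_ge0.
  have : 0 <= `|Y w| by [].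
  by move: `|Y w| (expR _) => a b; nra.
exact: (dominated_convergence_real mu_ u_cvg gi ug).2.
Qed.

(** This is the identity for g(q) = q^m exp(-k delta q). Expanding exp(-k delta Q) at once would
    need exponential moments that grow with k, hence the induction. All m are carried because the
    expansion raises the power of Q. *)
Let tilted_identity k m :
  \int[P]_w ((Q w - tau) * Q w ^+ m * e k w) =
  m%:R * (2 * \int[P]_w (W w * Q w ^+ m.-1 * e k w)) -
  k%:R * delta * (2 * \int[P]_w (W w * Q w ^+ m * e k w)).
Proof.
elim: k m => [|k IHk] m.
  have e0 Y : \int[P]_w (Y w * e 0 w) = \int[P]_w Y w.
    by apply: eq_Rintegral => w _; rewrite /e mul0r oppr0 mul0r expR0 mulr1.
  by rewrite !e0 moment_identity mul0r mul0r subr0.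
pose c l := (- delta) ^+ l / l`!%:R.
pose G j := \int[P]_w ((Q w - tau) * Q w ^+ j * e k w).
pose H j := 2 * \int[P]_w (W w * Q w ^+ j * e k w).
have cG : \sum_(l < L) (c l * G (m + l)%N) @[L --> \oo] -->
    \int[P]_w ((Q w - tau) * Q w ^+ m * e k.+1 w).
  pose Y w := (Q w - tau) * Q w ^+ m.
  have EL L : \sum_(l < L) (c l * G (m + l)%N) =
      \sum_(l < L) ((- delta) ^+ l / l`!%:R * \int[P]_w (Y w * Q w ^+ l * e k w)).
    apply: eq_bigr => l _; congr (_ * _); apply: eq_Rintegral => w _.
    by rewrite /Y exprD; ring.
  under eq_fun do rewrite EL.
  exact: (@cvg_exp_tilt Y k (all_momentsM MQt (all_momentsX m MQ))).
have cH j : \sum_(l < L) (c l * H (j + l)%N) @[L --> \oo] -->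
    2 * \int[P]_w (W w * Q w ^+ j * e k.+1 w).
  pose Y w := W w * Q w ^+ j.
  have EL L : \sum_(l < L) (c l * H (j + l)%N) =
      2 * \sum_(l < L) ((- delta) ^+ l / l`!%:R * \int[P]_w (Y w * Q w ^+ l * e k w)).
    rewrite mulr_sumr; apply: eq_bigr => l _; rewrite /H mulrCA; congr (_ * (_ * _)).
    by apply: eq_Rintegral => w _; rewrite /Y exprD; ring.
  under eq_fun do rewrite EL.
  apply: cvgM; first exact: cvg_cst.
  exact: (@cvg_exp_tilt Y k (all_momentsM MW (all_momentsX j MQ))).
(* The hypothesis at power m + l brings the factor m + l. The part m stays; the part l cancels into
   (l - 1)! and becomes, after a shift of index, -delta times a sum with one term fewer: the
   derivative of the new exponential. *)
have GE L : \sum_(l < L.+1) (c l * G (m + l)%N) =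
    m%:R * (\sum_(l < L.+1) (c l * H (m.-1 + l)%N)) -
    delta * (\sum_(l < L) (c l * H (m + l)%N)) -
    k%:R * delta * \sum_(l < L.+1) (c l * H (m + l)%N).
  have split1 : \sum_(l < L.+1) (c l * l%:R * H (m + l).-1%N) =
      - (delta * \sum_(l < L) (c l * H (m + l)%N)).
    rewrite big_ord_recl mulr0 mul0r add0r -mulNr mulr_sumr; apply: eq_bigr => l _.
    rewrite /= /bump /= add1n addnS /= /c exprS factS natrM.
    have l0 : (l.+1%:R : R) != 0 by rewrite pnatr_eq0.
    have f0 : (l`!%:R : R) != 0 by rewrite pnatr_eq0 -lt0n fact_gt0.
    move: (l.+1%:R : R) l0 (l`!%:R : R) f0 => a a0 b b0; field.
    by rewrite a0 b0.
  rewrite -split1 !mulr_sumr -big_split /= -sumrB; apply: eq_bigr => l _.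
  rewrite /G IHk -/(H _) -/(H _) natrD.
  (* The truncated predecessors differ only for m = 0, where the coefficient is 0. *)
  have -> : m%:R * (c l * H (m.-1 + l)%N) = m%:R * (c l * H (m + l).-1%N).
    by case: (m) => [|m']; rewrite ?mul0r.
  ring.
have cGS := cG; rewrite -(cvg_shiftS (fun L => \sum_(l < L) (c l * G (m + l)%N))) /= in cGS.
have cHS j := cH j; have cHS' j : \sum_(l < L.+1) (c l * H (j + l)%N) @[L --> \oo] -->
    2 * \int[P]_w (W w * Q w ^+ j * e k.+1 w).
  by rewrite (cvg_shiftS (fun L => \sum_(l < L) (c l * H (j + l)%N))).
have lim2 : m%:R * (\sum_(l < L.+1) (c l * H (m.-1 + l)%N)) -
    delta * (\sum_(l < L) (c l * H (m + l)%N)) -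
    k%:R * delta * \sum_(l < L.+1) (c l * H (m + l)%N) @[L --> \oo] -->
    m%:R * (2 * \int[P]_w (W w * Q w ^+ m.-1 * e k.+1 w)) -
    delta * (2 * \int[P]_w (W w * Q w ^+ m * e k.+1 w)) -
    k%:R * delta * (2 * \int[P]_w (W w * Q w ^+ m * e k.+1 w)).
  by apply: cvgB; [apply: cvgB|]; apply: cvgM => //; exact: cvg_cst.
move: cGS; under eq_fun do rewrite GE; move=> cGS.
have := cvg_unique _ cGS lim2 => /(_ (@Rhausdorff R)) ->.
by rewrite -natr1; ring.
Qed.

(** A makes t |-> A(exp(-delta t)) a primitive of B(exp(-delta t)). This divides the coefficient of
    degree i by i, hence the condition on degree 0, where [a 0] is 0. *)
Let exp_poly_identity (B : {poly R}) : B`_0 = 0 -> exists A : {poly R},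
  A^`() * ((- delta) *: 'X) = B /\
  \int[P]_w ((Q w - tau) * A.[expR (- delta * Q w)]) =
  2 * \int[P]_w (W w * B.[expR (- delta * Q w)]).
Proof.
move=> B0; have d0 : delta != 0 by rewrite gt_eqF.
pose a i := - B`_i / (i%:R * delta).
exists (\poly_(i < size B) a i); split.
  apply/polyP => -[|i].
    by rewrite -scalerAr coefZ coefMX /= mulr0 B0.
  rewrite -scalerAr coefZ coefMX /= coef_deriv coef_poly.
  case: ltnP => iB; last by rewrite mul0rn mulr0 nth_default.
  have i0 : (i.+1%:R : R) != 0 by rewrite pnatr_eq0.
  rewrite -mulr_natl /a; move: (i.+1%:R : R) i0 => x x0; field.
  by rewrite x0 d0.
have eE i w : e i w = expR (- delta * Q w) ^+ i.
  by rewrite /e -expRM_natl; congr expR; ring.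
transitivity (\int[P]_w (\sum_(i < size B) a i * ((Q w - tau) * Q w ^+ 0 * e i w))).
  apply: eq_Rintegral => w _; rewrite horner_poly mulr_sumr; apply: eq_bigr => i _.
  by rewrite eE expr0; ring.
have MQe i : all_moments P (fun w => (Q w - tau) * Q w ^+ 0 * e i w).
  by apply: all_momentsM => //; apply: all_momentsM => //; exact: all_momentsX.
have MWe i : all_moments P (fun w => W w * Q w ^+ 0 * e i w).
  by apply: all_momentsM => //; apply: all_momentsM => //; exact: all_momentsX.
rewrite expect_sum; last by move=> i; exact: all_momentsZ.
transitivity (2 * \int[P]_w (\sum_(i < size B) B`_i * (W w * Q w ^+ 0 * e i w))); last first.
  congr (_ * _); apply: eq_Rintegral => w _; rewrite horner_coef mulr_sumr.
  by apply: eq_bigr => i _; rewrite eE expr0; ring.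
rewrite expect_sum; last by move=> i; exact: all_momentsZ.
rewrite mulr_sumr; apply: eq_bigr => i _.
rewrite !expectZ// tilted_identity mul0r sub0r /a.
have [i0|i0] := eqVneq (i%:R : R) 0.
  have /eqP i00 : (i : nat) == 0%N by rewrite -(pnatr_eq0 R) i0.
  by rewrite i00 B0 oppr0 !mul0r mulr0.
move: (\int[P]_w _) (i%:R : R) i0 => z x x0; field.
by rewrite x0 d0.
Qed.

(** f' is approximated rather than f: bounded pointwise convergence of the derivatives gives
    convergence of the increments of the primitives, with the linear majorant M Q. *)
Lemma moment_identity_C1 (f f' : R -> R) (M : R) :
  (forall x : R, is_derive x (1 : R) f (f' x)) -> continuous f' ->
  (forall x, `|f' x| <= M) ->
  \int[P]_w ((Q w - tau) * f (Q w)) = 2 * \int[P]_w (W w * f' (Q w)).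
Proof.
move=> df cf' f'M.
have M0 : 0 <= M by rewrite (le_trans _ (f'M 0)).
have cf : continuous f.
  by move=> x; apply/differentiable_continuous/derivable1_diffP; have [] := df x.
(* f' in the variable y = exp(-delta t). The value 0 at y = 0, the image of t = +oo, removes the
   constant term of the Bernstein polynomials; f' need not have a limit there, but exp(-delta Q) is
   never 0. *)
pose u (y : R) := if 0 < y then f' (- (ln y / delta)) else 0.
have uM y : `|u y| <= M by rewrite /u; case: ifP => // _; rewrite normr0.
have u_exp t : u (expR (- delta * t)) = f' t.
  by rewrite /u expR_gt0 expRK; congr f'; field; rewrite gt_eqF.
have u_cont y : 0 < y -> {for y, continuous u}.
  move=> y0.
  have c1 : {for y, continuous (fun y => f' (- (ln y / delta)))}.
    apply: (@continuous_comp _ _ _ (fun y => - (ln y / delta)) f'); last exact: cf'.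
    by apply: cvgN; apply: cvgM; [exact: continuous_ln|exact: cvg_cst].
  have uy : u y = f' (- (ln y / delta)) by rewrite /u y0.
  suff : u z @[z --> y] --> f' (- (ln y / delta)) by rewrite -uy.
  apply: cvg_trans c1; apply: near_eq_cvg.
  exists y => // z /=; rewrite ltr_distlC subrr => /andP[z0 _].
  by rewrite /u z0.
pose B N := bernstein N.+1 (fun k => u (k%:R / N.+1%:R)).
have B0 N : (B N)`_0 = 0.
  by rewrite -horner_coef0 /B bernstein_at0 mul0r /u ltxx.
pose A N := sval (cid (exp_poly_identity (B0 N))).
have AD N : (A N)^`() * ((- delta) *: 'X) = B N.
  by rewrite /A; case: cid => A0 /= [].
have AE N : \int[P]_w ((Q w - tau) * (A N).[expR (- delta * Q w)]) =
    2 * \int[P]_w (W w * (B N).[expR (- delta * Q w)]).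
  by rewrite /A; case: cid => A0 /= [].
have y01 t : 0 <= t -> 0 <= expR (- delta * t) <= 1.
  move=> t0; rewrite expR_ge0 /= -[leRHS]expR0 ler_expR mulNr oppr_le0.
  by rewrite mulr_ge0// ltW.
have BM N t : 0 <= t -> `|(B N).[expR (- delta * t)]| <= M.
  by move=> t0; apply: bernstein_bounded => //; exact: y01.
have B_cvg t : 0 <= t -> (B N).[expR (- delta * t)] @[N --> \oo] --> f' t.
  move=> t0; rewrite -u_exp; apply: (bernstein_cvg (B := M)) => //; first exact: y01.
  by apply: u_cont; exact: expR_gt0.
pose G N t := (A N).[expR (- delta * t)].
have dG N (t : R) : is_derive t (1 : R) (G N) ((B N).[expR (- delta * t)]).
  have H1 : is_derive t (1 : R) (fun t : R => expR (- delta * t)) (- delta * expR (- delta * t)).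
    have H0 : is_derive t (1 : R) (fun t : R => - delta * t) (- delta).
      by apply: is_derive_eq; rewrite /GRing.scale /= mulr1.
    rewrite [- delta * expR _]mulrC.
    exact: (is_derive1_comp (is_derive_expR (- delta * t)) H0).
  have H2 := @is_derive1_comp _ (horner (A N)) (fun t => expR (- delta * t)) t _ _
    (is_derive_poly _ _) H1.
  by rewrite -AD hornerM hornerZ hornerX; exact: H2.
have cB N : continuous (fun t => (B N).[expR (- delta * t)]).
  move=> t; apply: (@continuous_comp _ _ _ (fun t => expR (- delta * t)) (horner (B N))).
    apply: (@continuous_comp _ _ _ (fun t => - delta * t) expR); last exact: continuous_expR.
    by apply: cvgM; [exact: cvg_cst|exact: cvg_id].
  exact: continuous_horner.
have int_B N x : 0 <= x -> \int[mu]_(t in `[0, x]) (B N).[expR (- delta * t)] = G N x - G N 0.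
  by move=> x0; rewrite /Rintegral (integral_is_derive x0 (dG N) (cB N)).
have int_f' x : 0 <= x -> \int[mu]_(t in `[0, x]) f' t = f x - f 0.
  by move=> x0; rewrite /Rintegral (integral_is_derive x0 df cf').
have cstM (x : R) : mu.-integrable `[0, x] (EFin \o cst M).
  apply: continuous_compact_integrable; first exact: segment_compact.
  by apply: continuous_subspaceT => t; exact: cvg_cst.
have GM N x : 0 <= x -> `|G N x - G N 0| <= M * x.
  move=> x0; rewrite -int_B//.
  have Bi : mu.-integrable `[0, x] (EFin \o (fun t => (B N).[expR (- delta * t)])).
    apply: continuous_compact_integrable; first exact: segment_compact.
    exact: continuous_subspaceT.
  rewrite (le_trans (le_normr_Rintegral _ Bi))//.
  apply: (@le_trans _ _ (\int[mu]_(t in `[0, x]) M)).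
    apply: le_Rintegral => //; first exact: integrable_norm.
    by move=> t /=; rewrite in_itv /= => /andP[t0 _]; exact: BM.
  rewrite Rintegral_cst//= lebesgue_measure_itv /= lte_fin.
  by case: ltP => // _; rewrite ?mulr0 ?mulr_ge0// -EFinB /= subr0.
have G_cvg x : 0 <= x -> G N x - G N 0 @[N --> \oo] --> f x - f 0.
  move=> x0; pose g (F : R -> R) : R -> R := F \_ `[0, x].
  have GE N : G N x - G N 0 = \int[mu]_t g (fun t => (B N).[expR (- delta * t)]) t.
    by rewrite -int_B// Rintegral_mkcond.
  rewrite -int_f'// Rintegral_mkcond; under eq_fun do rewrite GE.
  have mF F : continuous F -> measurable_fun [set: R] (g F).
    move=> cF; apply/(measurable_restrictT _ _).1 => //.
    by apply: measurable_funTS; exact: continuous_measurable_fun.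
  have cvg_g t : g (fun t => (B N).[expR (- delta * t)]) t @[N --> \oo] --> g f' t.
    rewrite /g patchE; case: ifPn => tx; last first.
      by under eq_fun do rewrite patchE (negbTE tx); exact: cvg_cst.
    under eq_fun do rewrite patchE tx.
    by apply: B_cvg; move: tx; rewrite inE /= in_itv /= => /andP[].
  have gi : mu.-integrable setT (EFin \o (g (cst M))).
    rewrite -restrict_EFin; apply/integrable_restrict => //=.
    by rewrite setTI.
  have gb N t : `|g (fun t => (B N).[expR (- delta * t)]) t| <= g (cst M) t.
    rewrite /g !patchE; case: ifPn => tx; last by rewrite normr0.
    by apply: BM; move: tx; rewrite inE /= in_itv /= => /andP[].
  exact: (@dominated_convergence_real _ _ _ mu _ _ _ (fun N => mF _ (cB N)) cvg_g gi gb).2.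
have mf : measurable_fun [set: R] f by exact: continuous_measurable_fun.
have mf' : measurable_fun [set: R] f' by exact: continuous_measurable_fun.
have [mW _] := MW.
have lim1 : \int[P]_w (W w * (B N).[expR (- delta * Q w)]) @[N --> \oo] -->
    \int[P]_w (W w * f' (Q w)).
  have mu_ N : measurable_fun [set: T] (fun w => W w * (B N).[expR (- delta * Q w)]).
    apply: measurable_funM => //.
    apply: (measurableT_comp (f := fun t => (B N).[expR (- delta * t)])) => //.
    exact: continuous_measurable_fun.
  have cu w : W w * (B N).[expR (- delta * Q w)] @[N --> \oo] --> W w * f' (Q w).
    by apply: cvgM; [exact: cvg_cst|exact: B_cvg].
  have gi : P.-integrable setT (EFin \o (fun w => M * `|W w|)).
    apply: integrableZ_real; have := MW.2 1%N.
    by rewrite /comp; under eq_fun do rewrite expr1.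
  have ug N w : `|W w * (B N).[expR (- delta * Q w)]| <= M * `|W w|.
    by rewrite normrM mulrC ler_wpM2r// BM.
  exact: (dominated_convergence_real mu_ cu gi ug).2.
have MQQ : all_moments P (fun w => (Q w - tau) * Q w) by exact: all_momentsM.
have gi2 : P.-integrable setT (EFin \o (fun w => M * `|(Q w - tau) * Q w|)).
  apply: integrableZ_real; have := MQQ.2 1%N.
  by rewrite /comp; under eq_fun do rewrite expr1.
(* Q - tau has mean 0, so constants may be subtracted: it is the increments G_N(x) - G_N(0) that are
   known to converge, to f(x) - f(0). *)
have EQt0 c : \int[P]_w ((Q w - tau) * c) = 0.
  under eq_Rintegral do rewrite mulrC.
  rewrite expectZ//; have := moment_identity 0; rewrite mul0r.
  by under eq_Rintegral do rewrite expr0 mulr1; move=> ->; rewrite mulr0.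
have mG N : measurable_fun [set: T] (fun w => G N (Q w)).
  apply: (measurableT_comp (f := G N)) => //; apply: continuous_measurable_fun => t.
  by apply/differentiable_continuous/derivable1_diffP; have [] := dG N t.
have mu2 N : measurable_fun [set: T] (fun w => (Q w - tau) * (G N (Q w) - G N 0)).
  apply: measurable_funM; first by case: MQt.
  exact: measurable_funB.
have ug2 N w : `|(Q w - tau) * (G N (Q w) - G N 0)| <= M * `|(Q w - tau) * Q w|.
  rewrite !normrM mulrCA ler_wpM2l// (le_trans (GM _ _ (Q_ge0 w)))//.
  by rewrite ger0_norm.
have cu2 w : (Q w - tau) * (G N (Q w) - G N 0) @[N --> \oo] --> (Q w - tau) * (f (Q w) - f 0).
  by apply: cvgM; [exact: cvg_cst|exact: G_cvg].
have [fi lim2] := dominated_convergence_real mu2 cu2 gi2 ug2.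
have GE N : \int[P]_w ((Q w - tau) * (G N (Q w) - G N 0)) =
    2 * \int[P]_w (W w * (B N).[expR (- delta * Q w)]).
  rewrite -AE -[RHS]addr0 -[X in _ = _ + X](EQt0 (- G N 0)).
  have i1 : P.-integrable setT (EFin \o (fun w => (Q w - tau) * (G N (Q w) - G N 0))).
    exact: le_integrable_real (mu2 N) (ug2 N) gi2.
  have i2 c : P.-integrable setT (EFin \o (fun w => (Q w - tau) * c)).
    by apply: all_moments_integrable; apply: all_momentsM => //; exact: all_moments_cst.
  have i3 : P.-integrable setT (EFin \o (fun w => (Q w - tau) * G N (Q w))).
    have := integrableD_real i1 (i2 (G N 0)).
    by rewrite /comp; under eq_fun do rewrite -mulrDr subrK.
  by rewrite -RintegralD//; apply: eq_Rintegral => w _; rewrite -mulrDr.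
have lim2' : \int[P]_w ((Q w - tau) * (G N (Q w) - G N 0)) @[N --> \oo] -->
    2 * \int[P]_w (W w * f' (Q w)).
  by under eq_fun do rewrite GE; apply: cvgM; [exact: cvg_cst|exact: lim1].
have := cvg_unique _ lim2 lim2' => /(_ (@Rhausdorff R)) <-.
have fi' : P.-integrable setT (EFin \o (fun w => (Q w - tau) * f (Q w))).
  have Mc : all_moments P (fun w => (Q w - tau) * f 0).
    by apply: all_momentsM => //; exact: all_moments_cst.
  have := integrableD_real fi (all_moments_integrable Mc).
  by rewrite /comp; under eq_fun do rewrite -mulrDr subrK.
rewrite -[LHS]addr0 -[X in _ + X = _](EQt0 (- f 0)).
rewrite -RintegralD//; last first.
  by apply: all_moments_integrable; apply: all_momentsM => //; exact: all_moments_cst.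
by apply: eq_Rintegral => w _; rewrite -mulrDr.
Unshelve. all: by end_near.
Qed.

End moment_identity_extension.

(** * Kolmogorov distance from continuous test functions *)

Section kolmogorov_from_stein.
Context {R : realType} {d} {T : measurableType d} (P : probability T R).
Local Notation mu := (@lebesgue_measure R).
Let p : R -> R := normal_pdf 0 1.
Let Phi (z : R) := \int[mu]_(x in `]-oo, z]) p x.

Let p_ge0 x : 0 <= p x := normal_pdf_ge0 0 1 x.

Let p_integrable A : measurable A -> mu.-integrable A (EFin \o p).
Proof.
move=> mA; apply: (integrableS measurableT mA (@subsetT _ A)).
exact: integrable_normal_pdf.
Qed.

Let Phi_lipschitz z (e : R) : 0 <= e -> Phi (z + e) <= Phi z + normal_peak 1 * e.
Proof.
move=> e0; rewrite -lerBlDl /Phi.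
rewrite (@Rintegral_itvB _ p -oo%O (BRight (z + e)) z)//; last 2 first.
- exact: p_integrable.
- by rewrite bnd_simp lerDl.
apply: (@le_trans _ _ (\int[mu]_(x in `]z, (z + e)]) normal_peak 1)).
  apply: le_Rintegral => //; first exact: p_integrable.
    apply/integrableP; split; first exact: measurable_cst.
    rewrite integral_cst//= lebesgue_measure_itv /=; case: ifP => _; last by rewrite mule0 ltry.
    by rewrite -EFinB -EFinM ltry.
  by move=> x _; apply: normal_pdf_ub; exact: oner_neq0.
rewrite Rintegral_cst//= lebesgue_measure_itv /= lte_fin.
case: ifP => _ /=; first by rewrite addrAC subrr add0r.
by rewrite mulr0 mulr_ge0// normal_peak_ge0.
Qed.

(** For e > 0, a continuous substitute for the indicator of ]-oo, z]: 1 up to z, 0 from z + e on,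
    affine in between. With it Stein's equation has a C^1 solution. *)
Definition ramp (z e x : R) := Num.min 1 (Num.max 0 ((z + e - x) / e)).

Lemma ramp01 z e x : 0 <= ramp z e x <= 1.
Proof. by rewrite /ramp ge_min lexx andbT le_min ler01 le_max lexx. Qed.

Lemma continuous_ramp z e : continuous (ramp z e).
Proof.
move=> x; apply: (@continuous_comp _ _ _ (fun x => (z + e - x) / e)
    (fun y => Num.min 1 (Num.max 0 y))).
  apply: cvgM; last exact: cvg_cst.
  by apply: cvgB; [exact: cvg_cst|exact: cvg_id].
apply: continuous_min; first exact: cvg_cst.
by apply: continuous_max; [exact: cvg_cst|exact: cvg_id].
Qed.

Lemma ramp_ge1 z e x : 0 < e -> x <= z -> ramp z e x = 1.
Proof.
move=> e0 xz; apply/eqP; rewrite /ramp; rewrite eq_le ge_min lexx /= le_min lexx /=.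
by rewrite le_max ler_pdivlMr// mul1r lerBrDr addrC lerD2r xz orbT.
Qed.

Lemma ramp_le0 z e x : 0 < e -> z + e <= x -> ramp z e x = 0.
Proof.
move=> e0 xz; rewrite /ramp max_l; first by rewrite min_r.
by rewrite ler_pdivrMr// mul0r subr_le0.
Qed.

Let ramp_p_integrable z e : mu.-integrable setT (EFin \o (fun x => ramp z e x * p x)).
Proof.
apply: (le_integrable _ _ _ (p_integrable measurableT)) => //.
  apply/measurable_EFinP/measurable_funM; last exact: measurable_normal_pdf.
  by apply: continuous_measurable_fun; exact: continuous_ramp.
move=> x _; rewrite /= lee_fin normrM ler_piMl//.
by have /andP[h0 h1] := ramp01 z e x; rewrite ger0_norm.
Qed.

Let restrict_p_integrable z : mu.-integrable setT (EFin \o (p \_ `]-oo, z])).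
Proof.
by rewrite -restrict_EFin; apply/integrable_restrict => //=; rewrite setTI; exact: p_integrable.
Qed.

Let ramp_Phi z e : 0 < e -> Phi z <= \int[mu]_x (ramp z e x * p x) <= Phi (z + e).
Proof.
move=> e0; have PhiE y : Phi y = \int[mu]_x (p \_ `]-oo, y]) x by rewrite /Phi Rintegral_mkcond.
rewrite !PhiE; apply/andP; split.
  apply: le_Rintegral => // x _; rewrite patchE; case: ifPn => [|_].
    by rewrite inE /= in_itv /= => xz; rewrite ramp_ge1// mul1r.
  by rewrite mulr_ge0//; case/andP: (ramp01 z e x).
apply: le_Rintegral => // x _; rewrite patchE; case: ifPn => [_|].
  by rewrite ler_piMl//; case/andP: (ramp01 z e x).
rewrite notin_setE /= in_itv /= => /negP; rewrite -ltNge => /ltW xz.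
by rewrite ramp_le0// mul0r.
Qed.

(** The bound b passes to indicators without loss: ramps on either side of z cost only the normal
    mass of an interval of length e, at most e times the peak of the density, and e is arbitrary. *)
Lemma kolmogorov_distance_ramp (F : T -> R) (b : R) (d' : measure_display)
    (T' : measurableType d') (Pr : probability T' R) (N : {RV Pr >-> R}) :
  measurable_fun [set: T] F -> has_law Pr N (normal_prob 0 1) ->
  (forall h : R -> R, continuous h -> (forall x, 0 <= h x <= 1) ->
    `|\int[P]_w h (F w) - \int[mu]_x (h x * p x)| <= b) ->
  (kolmogorov_distance P F Pr N <= b%:E)%E.
Proof.
move=> mF law Hh; apply: ge_ereal_sup => _ [z _ <-].
have mA y : measurable [set w | F w <= y].
  rewrite (_ : [set w | F w <= y] = F @^-1` `]-oo, y]); first by rewrite -[X in measurable X]setTI; exact: mF.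
  by apply/seteqP; split => w /=; rewrite in_itv.
have -> : Pr [set w | N w <= z] = (Phi z)%:E.
  rewrite (_ : [set w | N w <= z] = N @^-1` `]-oo, z]); last first.
    by apply/seteqP; split => w /=; rewrite in_itv.
  rewrite law// /normal_prob /Phi /Rintegral fineK//.
  by apply: integrable_fin_num => //; exact: p_integrable.
have PE y : P [set w | F w <= y] = (\int[P]_w (\1_[set w | F w <= y] w : R))%:E.
  rewrite /Rintegral fineK; last first.
    by apply: integrable_fin_num => //; apply: integrable_indic => //; exact: fin_num_fun_lty.
  by rewrite integral_indic// setIT.
rewrite PE -EFinB /= lee_fin.
have hF_int y e : P.-integrable setT (EFin \o (fun w => ramp y e (F w))).
  apply: (le_integrable_real (g := cst 1)) => //; last exact: finite_measure_integrable_cst.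
    apply: (measurableT_comp (f := ramp y e)) => //.
    by apply: continuous_measurable_fun; exact: continuous_ramp.
  by move=> w; have /andP[h0 h1] := ramp01 y e (F w); rewrite ger0_norm.
have ind_int y : P.-integrable setT (EFin \o (fun w => \1_[set w | F w <= y] w : R)).
  by apply: integrable_indic => //; exact: fin_num_fun_lty.
apply/ler_addgt0Pl => e' e'0.
have K0 : 0 < normal_peak (1 : R) by apply: normal_peak_gt0; exact: oner_neq0.
pose e := e' / normal_peak 1.
have e0 : 0 < e by rewrite divr_gt0.
have Ke : normal_peak 1 * e = e' by rewrite mulrC divfK// gt_eqF.
rewrite ler_distl; apply/andP; split.
(* The ramp descending between z - e and z lies below the indicator and gives the lower bound; the
   one between z and z + e gives the upper bound. *)
- have := Hh _ (@continuous_ramp (z - e) e) (ramp01 (z - e) e).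
  have /andP[h1 h2] := ramp_Phi (z - e) e0.
  have := Phi_lipschitz (z - e) (ltW e0); rewrite subrK Ke => h3.
  rewrite ler_distl => /andP[h4 _].
  have h5 : \int[P]_w ramp (z - e) e (F w) <= \int[P]_w (\1_[set w | F w <= z] w : R).
    apply: le_Rintegral => // w _; rewrite indicE.
    case: (boolP (w \in _)) => [_|].
      by case/andP: (ramp01 (z - e) e (F w)).
    rewrite notin_setE /= => /negP; rewrite -ltNge => /ltW Fz.
    by rewrite ramp_le0// subrK.
  lra.
- have := Hh _ (@continuous_ramp z e) (ramp01 z e).
  have /andP[h1 h2] := ramp_Phi z e0.
  have := Phi_lipschitz z (ltW e0); rewrite Ke => h3.
  rewrite ler_distl => /andP[_ h4].
  have h5 : \int[P]_w (\1_[set w | F w <= z] w : R) <= \int[P]_w ramp z e (F w).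
    apply: le_Rintegral => // w _; rewrite indicE.
    case: (boolP (w \in _)) => [|_]; last by case/andP: (ramp01 z e (F w)).
    by rewrite inE /= => Fz; rewrite ramp_ge1.
  lra.
Qed.

End kolmogorov_from_stein.

(** * The Kolmogorov bound for sums of squares of Gaussian variables *)

Section quadratic_kolmogorov.
Context {R : realType} {d} {T : measurableType d} (P : probability T R).
Local Notation mu := (@lebesgue_measure R).
Variables (n : nat) (xi : 'I_n -> T -> R).
Hypothesis xi_meas : forall i, measurable_fun [set: T] (xi i).
Hypothesis xi_gauss : forall a : 'I_n -> R, gaussian_rv P (fun w => \sum_i a i * xi i w).
Hypothesis xi_center : forall i, (\int[P]_w (xi i w)%:E = 0)%E.

Let V X := exists a : 'I_n -> R, X = fun w => \sum_i a i * xi i w.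

Let V_lin X Y (t : R) : V X -> V Y -> V (fun w => X w + t * Y w).
Proof.
move=> [a ->] [b ->]; exists (fun i => a i + t * b i); apply/funext => w.
by rewrite mulr_sumr -big_split /=; apply: eq_bigr => i _; ring.
Qed.

Let V_meas X : V X -> measurable_fun [set: T] X.
Proof. by move=> [a ->]; apply: measurable_sum => i; exact: measurable_funM. Qed.

Let V_gauss X : V X -> gaussian_rv P X.
Proof. by move=> [a ->]. Qed.

Let V_xi i : V (xi i).
Proof.
exists (fun j => (i == j)%:R); apply/funext => w.
rewrite (bigD1 i)//= eqxx mul1r big1 ?addr0// => j ji.
by rewrite eq_sym (negbTE ji) mul0r.
Qed.

Let xi_moments i := centered_gaussian_moments (xi_meas i) (V_gauss (V_xi i)) (xi_center i).

(** The family of the [xi i] takes the place of [V] here: centering of [V] is not yet available, and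
    its proof needs these moments to exchange expectation and sum. *)
Let Mxi i : all_moments P (xi i).
Proof.
apply: (@gaussian_all_moments _ _ _ P (fun X => exists i, X = xi i)); last by exists i.
- by move=> _ [j ->].
- by move=> _ [j ->]; exact/V_gauss/V_xi.
- by move=> _ [j ->].
Qed.

Let V_center X : V X -> (\int[P]_w (X w)%:E = 0)%E.
Proof.
move=> [a ->].
have MX : all_moments P (fun w => \sum_i a i * xi i w).
  by apply: all_moments_sum => i; exact: all_momentsZ.
have /fineK <- := integrable_fin_num measurableT (all_moments_integrable MX).
congr EFin; rewrite -/(Rintegral P setT _) expect_sum; last by move=> i; exact: all_momentsZ.
by rewrite big1// => i _; rewrite expectZ// /Rintegral xi_center mulr0.
Qed.

Let C i j : R := \int[P]_w (xi i w * xi j w).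
Let Q w := \sum_i xi i w ^+ 2.
Let W w := \sum_i \sum_j C i j * (xi i w * xi j w).
Let tau := \sum_i C i i.
Let D := \sum_i \sum_j C i j ^+ 2.
Let T4 := \sum_j \sum_k C j k * \sum_a \sum_b C j a * C k b * C a b.

(** Without independence, Q is compared with its largest term: Q <= n xi_i^2 for a maximizing i, so
    the exponential of a small multiple of Q is at most one of the integrable exp(a_i xi_i^2). The
    denominator n + 1 avoids division by 0 for n = 0. *)
Let exp_Q : exists2 delta, 0 < delta & P.-integrable setT (EFin \o (fun w => expR (2 * delta * Q w))).
Proof.
pose a i := s2val (cid2 (xi_moments i).1).
have a_gt0 i : 0 < a i by rewrite /a; case: cid2.
have a_int i : P.-integrable setT (EFin \o (fun w => expR (a i * xi i w ^+ 2))).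
  by rewrite /a; case: cid2.
pose m := \big[Num.min/1]_i a i.
have m_gt0 : 0 < m by rewrite /m; elim/big_ind: _ => // x y x0 y0; rewrite lt_min x0.
have m_le i : m <= a i by rewrite /m (bigD1 i)//= ge_min lexx.
exists (m / n.+1%:R / 2); first by rewrite !divr_gt0.
have sum_int : P.-integrable setT (EFin \o (fun w => 1 + \sum_i expR (a i * xi i w ^+ 2))).
  apply: integrableD_real; first exact: finite_measure_integrable_cst.
  rewrite (_ : _ \o _ = (fun w => \sum_(i <- index_enum 'I_n) (expR (a i * xi i w ^+ 2))%:E)%E); last first.
    by apply/funext => w; rewrite /= sumEFin.
  by apply: integrable_sum => // i _; exact: a_int.
apply: le_integrable_real sum_int.
  apply: measurableT_comp => //; apply: measurable_funM => //.
  by apply: measurable_sum => i; exact: measurable_funX.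
move=> w; rewrite ger0_norm ?expR_ge0// [2 * _]mulrC divfK ?pnatr_eq0//.
have [n0|[i iP]] : n = 0%N \/ exists i : 'I_n, forall j, xi j w ^+ 2 <= xi i w ^+ 2.
  case: (n) xi => [|n'] xi'; first by left.
  right; have [i _ iP] := @arg_maxP _ _ _ (ord0 : 'I_n'.+1) predT (fun i => xi' i w ^+ 2) isT.
  by exists i => j; exact: iP.
  rewrite (_ : Q w = 0); last first.
    by rewrite /Q big1// => i _; exfalso; case: i => i'; rewrite n0.
  rewrite mulr0 expR0 lerDl; apply: sumr_ge0 => i _; exact: expR_ge0.
apply: (@le_trans _ _ (expR (a i * xi i w ^+ 2))).
  rewrite ler_expR mulrAC ler_pdivrMr//.
  apply: (@le_trans _ _ (n%:R * xi i w ^+ 2 * m)).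
    rewrite mulrC ler_wpM2r ?(ltW m_gt0)// /Q.
    rewrite -[n in n%:R]card_ord -sum1_card natr_sum mulr_suml ler_sum// => j _.
    by rewrite mul1r.
  rewrite mulrAC [leRHS]mulrAC ler_wpM2r ?sqr_ge0// mulrC ler_pM//.
  - exact: ltW.
  - by rewrite ler_nat.
rewrite (bigD1 i)//= addrCA lerDl addr_ge0// sumr_ge0// => j _; exact: expR_ge0.
Qed.

Lemma quadratic_variance : \int[P]_w ((Q w - tau) ^+ 2) = 2 * D.
Proof. exact: (variance_Q V_lin V_meas V_gauss V_center V_xi). Qed.

Lemma quadratic_all_moments : all_moments P Q.
Proof. exact: (all_moments_Q V_meas V_gauss V_center V_xi). Qed.

(** Stein's equation turns the error for h into E[f'(F) (1 - W / D)]. The factor 2 bounds |f'|, and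
    E |1 - W / D| is at most the standard deviation of W / D, because E W = D. *)
Lemma kolmogorov_distance_quadratic (d' : measure_display)
    (T' : measurableType d') (Pr : probability T' R) (N : {RV Pr >-> R}) :
  0 < D -> has_law Pr N (normal_prob 0 1) ->
  (kolmogorov_distance P (fun w => ((Q w - tau) / Num.sqrt (2 * D))%R) Pr N
    <= (2 * Num.sqrt (2 * T4) / D)%:E)%E.
Proof.
move=> D0 law.
have MQ := quadratic_all_moments.
have MW : all_moments P W := all_moments_W V_meas V_gauss V_center V_xi.
pose s := Num.sqrt (2 * D).
have s0 : 0 < s by rewrite sqrtr_gt0 mulr_gt0.
have s2 : s ^+ 2 = 2 * D by rewrite sqr_sqrtr// ltW// mulr_gt0.
pose F w := (Q w - tau) / s.
have mF : measurable_fun [set: T] F.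
  by apply: measurable_funM => //; apply: measurable_funB => //; case: MQ.
apply: kolmogorov_distance_ramp => // h ch h01.
have [f [f' [df cf' f'2 fE]]] := stein_equation ch h01.
set c := \int[mu]_x _ in fE *.
have [delta delta0 expQ] := exp_Q.
have Q_ge0 w : 0 <= Q w by apply: sumr_ge0 => i _; exact: sqr_ge0.
pose g q := f ((q - tau) / s); pose g' q := f' ((q - tau) / s) / s.
have clin : continuous (fun q => (q - tau) / s).
  move=> q; apply: cvgM; last exact: cvg_cst.
  by apply: cvgB; [exact: cvg_id|exact: cvg_cst].
have dg (q : R) : is_derive q (1 : R) g (g' q).
  have H0 : is_derive q (1 : R) (fun q : R => (q - tau) / s) (s^-1).
    by apply: is_derive_eq; rewrite /GRing.scale /=; ring.
  exact: (@is_derive1_comp _ f (fun q : R => (q - tau) / s) q _ _ (df _) H0).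
have cg' : continuous g'.
  move=> q; apply: cvgM; last exact: cvg_cst.
  exact: (@continuous_comp _ _ _ (fun q => (q - tau) / s) f' _ (clin q) (cf' _)).
have g'M q : `|g' q| <= 2 / s.
  by rewrite normrM (gtr0_norm (_ : 0 < s^-1)) ?invr_gt0// ler_pM2r ?invr_gt0.
have := moment_identity_C1 Q_ge0 MQ MW delta0 expQ
  (quadratic_ibp_power V_lin V_meas V_gauss V_center V_xi) dg cg' g'M.
rewrite -/tau => identity.
have mhF : measurable_fun [set: T] (fun w => h (F w)).
  by apply: (measurableT_comp (f := h)) => //; exact: continuous_measurable_fun.
have mf'F : measurable_fun [set: T] (fun w => f' (F w)).
  by apply: (measurableT_comp (f := f')) => //; exact: continuous_measurable_fun.
have bounded_moments (Y : T -> R) B : measurable_fun [set: T] Y -> (forall w, `|Y w| <= B) ->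
    all_moments P Y.
  move=> mY YB; split => // k.
  apply: le_integrable_real (finite_measure_integrable_cst P (B ^+ k) measurableT) => //.
    by apply: measurable_funX; exact: measurableT_comp.
  by move=> w; rewrite ger0_norm ?exprn_ge0// lerXn2r ?nnegrE// (le_trans _ (YB w)).
have MhF : all_moments P (fun w => h (F w)).
  by apply: (bounded_moments _ 1) => // w; case/andP: (h01 (F w)) => ? ?; rewrite ger0_norm.
have Mf'F : all_moments P (fun w => f' (F w)) by exact: (bounded_moments _ 2).
have Mcst (k : R) := all_moments_cst P k.
have FfE w : F w * f (F w) = f' (F w) + (-1) * h (F w) + c.
  by have := fE (F w); lra.
have MFf : all_moments P (fun w => F w * f (F w)).
  under eq_fun do rewrite FfE.
  by apply: all_momentsD => //; apply: all_momentsD => //; exact: all_momentsZ.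
(* The inner derivative of g contributes 1 / s and F another 1 / s; with the 2 of the identity this
   makes 2 / s^2 = 1 / D. *)
have EFf : \int[P]_w (F w * f (F w)) = \int[P]_w (D^-1 * W w * f' (F w)).
  transitivity (s^-1 * \int[P]_w ((Q w - tau) * g (Q w))).
    rewrite -expectZ; last first.
      rewrite (_ : (fun w => _) = (fun w => s * (F w * f (F w)))); first exact: all_momentsZ.
      apply/funext => w; rewrite /g -/(F w) [F w in LHS]/F mulrA [s * _]mulrC.
      by rewrite [in RHS]/F divfK// gt_eqF.
    by apply: eq_Rintegral => w _; rewrite /g -/(F w) mulrA [s^-1 * _]mulrC.
  rewrite identity mulrA -expectZ; last first.
    by apply: all_momentsM => //; rewrite /g'; under eq_fun do rewrite mulrC; exact: all_momentsZ.
  apply: eq_Rintegral => w _; rewrite /g' -/(F w).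
  have -> : D^-1 = 2 / s ^+ 2 by rewrite s2; field; rewrite gt_eqF.
  by field; rewrite gt_eqF.
have diffE : \int[P]_w h (F w) - c = \int[P]_w (f' (F w) * (1 - D^-1 * W w)).
  transitivity (\int[P]_w (f' (F w)) - \int[P]_w (F w * f (F w))).
    under [X in _ = _ - X]eq_Rintegral do rewrite FfE.
    rewrite expectD//; last by apply: all_momentsD => //; exact: all_momentsZ.
    rewrite expectD//; last exact: all_momentsZ.
    by rewrite expectZ// expect_cst; ring.
  rewrite EFf -expectB//; last by apply: all_momentsM => //; exact: all_momentsZ.
  by apply: eq_Rintegral => w _; ring.
pose Y w := 1 - D^-1 * W w.
have MY : all_moments P Y.
  rewrite /Y; under eq_fun do rewrite -mulNr.
  by apply: all_momentsD => //; exact: all_momentsZ.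
have MaY : all_moments P (fun w => `|Y w|).
  split; first by apply: measurableT_comp => //; case: MY.
  by move=> k; under eq_fun do rewrite normr_id; case: MY.
have EY2 : \int[P]_w (Y w ^+ 2) = 2 * T4 / D ^+ 2.
  have varW : \int[P]_w ((W w - D) ^+ 2) = 2 * T4.
    exact: (variance_W V_lin V_meas V_gauss V_center V_xi).
  rewrite mulrC -varW -expectZ; last first.
    by apply: all_momentsX; apply: all_momentsD.
  by apply: eq_Rintegral => w _; rewrite /Y; field; rewrite gt_eqF.
rewrite -/c diffE.
apply: (@le_trans _ _ (2 * \int[P]_w `|Y w|)).
  rewrite -expectZ//.
  have i1 : P.-integrable setT (EFin \o (fun w => f' (F w) * Y w)).
    by apply: all_moments_integrable; exact: all_momentsM.
  rewrite (le_trans (le_normr_Rintegral measurableT i1))//.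
  apply: le_Rintegral => //; first exact: integrable_norm.
    by apply: all_moments_integrable; exact: all_momentsZ.
  by move=> w _; rewrite normrM ler_wpM2r.
rewrite -mulrA ler_wpM2l//.
have aY_ge0 : 0 <= \int[P]_w `|Y w| by apply: Rintegral_ge0.
have var_ge0 : (\int[P]_w `|Y w|) ^+ 2 <= \int[P]_w (Y w ^+ 2).
  set m := \int[P]_w `|Y w|.
  have : 0 <= \int[P]_w (`|Y w| - m) ^+ 2 by apply: Rintegral_ge0 => w _; exact: sqr_ge0.
  have -> : \int[P]_w (`|Y w| - m) ^+ 2 = \int[P]_w (Y w ^+ 2 + (- (2 * m)) * `|Y w| + m ^+ 2).
    by apply: eq_Rintegral => w _; rewrite -[Y w ^+ 2]real_normK ?num_real//; ring.
  rewrite expectD//; last by apply: all_momentsD; [exact: all_momentsX|exact: all_momentsZ].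
  rewrite expectD//; [|exact: all_momentsX|exact: all_momentsZ].
  by rewrite expectZ// expect_cst -/m; lra.
have D0' : 0 <= D by exact: ltW.
rewrite -[leLHS]ger0_norm// -sqrtr_sqr.
rewrite (_ : Num.sqrt (2 * T4) / D = Num.sqrt (2 * T4 / D ^+ 2)); last first.
  rewrite [in RHS]mulrC [in RHS]sqrtrM ?invr_ge0 ?sqr_ge0// [in RHS]sqrtrV ?sqr_ge0// sqrtr_sqr ger0_norm//.
  by rewrite mulrC.
by rewrite ler_wsqrtr// -EY2.
Qed.

End quadratic_kolmogorov.

(** * Second differences of x^a *)

Section second_differences.
Context {R : realType}.
Variable a : R.
Hypothesis a_gt0 : 0 < a.
Hypothesis a_le : a <= 3 / 2.

(** Half the second difference of |x|^a at m: the autocovariance of the unit increments of a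
    fractional Brownian motion with a = 2H. The absolute value only acts at m = 0. *)
Definition rho (m : nat) : R :=
  (m.+1%:R `^ a + `|m%:R - 1| `^ a - 2 * m%:R `^ a) / 2.

Lemma powR_MVT (b x y : R) : 0 < x -> x < y ->
  exists2 c, x < c < y & y `^ b - x `^ b = b * c `^ (b - 1) * (y - x).
Proof.
move=> x0 xy.
have d (z : R) : x <= z -> is_derive z (1 : R) (fun z => z `^ b) (b * z `^ (b - 1)).
  by move=> xz; apply: is_derive1_powR; exact: lt_le_trans xz.
have [||c] := @MVT _ (fun z => z `^ b) (fun z => b * z `^ (b - 1)) x y xy.
- by move=> z; rewrite in_itv /= => /andP[/ltW xz _]; exact: d.
- apply: derivable_within_continuous => z; rewrite in_itv /= => /andP[xz _].
  by have [] := d z xz.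
- by rewrite in_itv /= => cxy E; exists c.
Qed.

(** The mean value theorem, twice. The index m + 2 keeps the points m + 1, m + 2, m + 3 of the
    second difference in x > 0, where x^a is smooth. *)
Lemma rho_second_derivative (m : nat) : exists2 d : R,
  m.+1%:R < d < m.+3%:R & rho m.+2 = a * (a - 1) / 2 * d `^ (a - 2).
Proof.
have m1 : (0 : R) < m.+1%:R by rewrite ltr0n.
have m12 : (m.+1%:R : R) < m.+2%:R by rewrite ltr_nat.
pose phi (x : R) := (x + 1) `^ a - x `^ a.
have dphi (x : R) : 0 < x ->
    is_derive x (1 : R) phi (a * (x + 1) `^ (a - 1) - a * x `^ (a - 1)).
  move=> x0; have x10 : 0 < x + 1 by rewrite addr_gt0.
  have H1 : is_derive x (1 : R) (fun x : R => x + 1) 1.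
    by apply: is_derive_eq; rewrite addr0.
  have H2 := @is_derive1_comp _ (fun z => z `^ a) (fun x : R => x + 1) x _ _
    (is_derive1_powR a x10) H1.
  have H3 := is_deriveB H2 (is_derive1_powR a x0).
  by rewrite mulr1 in H3.
have [||c] := @MVT _ phi (fun x => a * (x + 1) `^ (a - 1) - a * x `^ (a - 1)) _ _ m12.
- move=> z; rewrite in_itv /= => /andP[mz _]; apply: dphi; exact: lt_trans mz.
- apply: derivable_within_continuous => z; rewrite in_itv /= => /andP[mz _].
  by have [] := dphi z (lt_le_trans m1 mz).
rewrite in_itv /= => /andP[mc cm] E.
have c0 : 0 < c by exact: lt_trans mc.
have [d /andP[cd dc] E2] := @powR_MVT (a - 1) c (c + 1) c0 ltac:(by rewrite ltrDl).
exists d.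
  rewrite (lt_trans mc)//= (lt_trans dc)// -[m.+3%:R]natr1 ltrD2r//.
have E3 : m.+2%:R - m.+1%:R = 1 :> R by rewrite -[m.+2%:R]natr1 addrAC subrr add0r.
have E4 : phi m.+2%:R - phi m.+1%:R = a * ((a - 1) * d `^ (a - 2)).
  rewrite E -mulrBr E2 E3 mulr1; congr (_ * _).
  by rewrite -addrA -opprD [c + 1]addrC addrK mulr1 -(_ : 1 + 1 = 2).
have E5 : `|m.+2%:R - 1| = m.+1%:R :> R.
  by rewrite -[m.+2%:R]natr1 addrK ger0_norm.
rewrite /rho E5; apply: (@mulIf _ 2) => //; rewrite divfK//.
transitivity (phi m.+2%:R - phi m.+1%:R); last by rewrite E4; field.
by rewrite /phi !natr1; ring.
Qed.

Lemma rho0 : rho 0 = 1.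
Proof.
rewrite /rho sub0r normrN normr1 powR1 powR0 ?gt_eqF//.
by field.
Qed.

Let two_powR_bounds : 1 <= (2 : R) `^ a <= 3.
Proof.
apply/andP; split.
  by rewrite -[leLHS](powRr0 (2 : R)); apply: ler_powR; [rewrite ler1n|exact: ltW].
apply: (@le_trans _ _ (2 `^ (3 / 2))).
  by apply: ler_powR => //; rewrite ler1n.
rewrite powRrM powR_mulrn// powR12_sqrt ?exprn_ge0//.
rewrite -(ler_pXn2r (_ : 0 < 2)%N) ?nnegrE ?sqrtr_ge0// sqr_sqrtr ?exprn_ge0//.
by rewrite -!natrX ler_nat.
Qed.

Let rho1 : rho 1 = (2 `^ a - 2) / 2.
Proof.
by rewrite /rho subrr normr0 powR0 ?gt_eqF// powR1; congr (_ / _); ring.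
Qed.

(** On ]0, 3/2] the product a (a - 1) lies between -1/4 and 3/4, its values at 1/2 and 3/2; [h1] and
    [h2] certify the two bounds. *)
Let coef_bound : `|a * (a - 1) / 2| <= 3 / 8.
Proof.
have h1 : 0 <= (3 / 2 - a) * (a + 1 / 2) by apply: mulr_ge0; move: a_gt0 a_le; lra.
have h2 := sqr_ge0 (a - 1 / 2); rewrite expr2 in h2.
by rewrite ler_norml; apply/andP; split; move: a_gt0 a_le; nra.
Qed.

Lemma rho_le_shift m : `|rho m.+2| <= 3 / 8 * m.+1%:R `^ (a - 2).
Proof.
have [d /andP[md _] ->] := rho_second_derivative m.
rewrite normrM [`|_ `^ _|]ger0_norm ?powR_ge0// ler_pM ?powR_ge0 ?coef_bound//.
have d0 : 0 < d by apply: lt_trans md; rewrite ltr0n.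
rewrite -(opprB 2 a) !powRN lef_pV2 ?posrE ?powR_gt0 ?ltr0n//.
apply: ge0_ler_powR; rewrite ?nnegrE ?(ltW d0) ?(ltW md)//; move: a_le; lra.
Qed.

(** This keeps the diagonal covariance 1 - rho(2 j + 1) at least 1/2. The decisive case is rho(1) =
    (2^a - 2) / 2, with 1 <= 2^a <= 3. *)
Lemma rho_le_half m : `|rho m.+1| <= 1 / 2.
Proof.
case: m => [|m].
  by rewrite rho1 ler_norml; case/andP: two_powR_bounds => *; apply/andP; split; lra.
rewrite (le_trans (rho_le_shift m))//.
have : m.+1%:R `^ (a - 2) <= 1 :> R.
  rewrite -[leRHS](powRr0 (m.+1%:R : R)); apply: ler_powR; first by rewrite ler1n.
  by move: a_le; lra.
lra.
Qed.

(** The 9 is 3^2: m + 3 <= 3 (m + 1), and the exponent a - 2 is above -2. *)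
Lemma rho_decay m : `|rho m| <= 9 * m.+1%:R `^ (a - 2).
Proof.
case: m => [|[|m]].
- by rewrite rho0 powR1 normr1 mulr1; lra.
- rewrite (le_trans (rho_le_half 0))//.
  have : 2 `^ (- 2%:R) <= 2 `^ (a - 2) :> R.
    by apply: ler_powR; [rewrite ler1n|move: a_gt0 a_le; lra].
  rewrite powR_invn// (_ : 2 ^- 2 = 4^-1 :> R); last by rewrite -natrX.
  by move=> h; lra.
rewrite (le_trans (rho_le_shift m))//.
have p0 : 0 < (m.+3%:R : R) `^ (a - 2) by rewrite powR_gt0// ltr0n.
have : (m.+1%:R : R) `^ (a - 2) <= 9 * m.+3%:R `^ (a - 2).
  apply: (@le_trans _ _ ((3^-1 * m.+3%:R) `^ (a - 2))).
    rewrite -(opprB 2 a) !powRN lef_pV2 ?posrE ?powR_gt0 ?ltr0n//.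
    apply: ge0_ler_powR; rewrite ?nnegrE//; first by move: a_le; lra.
    by rewrite ler_pdivrMl// -natrM ler_nat !mulSn mul0n; lia.
  rewrite powRM// ler_wpM2r ?powR_ge0// -powR_inv1// -powRrM.
  apply: (@le_trans _ _ (3 `^ 2%:R)); last by rewrite powR_mulrn// -natrX ler_nat.
  by apply: ler_powR; [rewrite ler1n|move: a_gt0 a_le; lra].
lra.
Qed.

End second_differences.

Section rho_critical.
Context {R : realType}.
Local Notation rho32 := (@rho R (3 / 2)).

(** For a = 3/2 the coefficient a (a - 1) / 2 = 3/8 is positive, so the second derivative also
    bounds rho from below; the indices 0 and 1, outside that representation, are computed. *)
Lemma rho32_ge m : 3 / 8 * m.+1%:R `^ (- 2^-1) <= rho32 m.
Proof.
case: m => [|[|m]].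
- by rewrite rho0 ?divr_gt0// powR1; lra.
- rewrite /rho subrr normr0 powR0 ?gt_eqF ?divr_gt0// powR1 powRN.
  rewrite (_ : 3 / 2 = 1 + 2^-1 :> R); last by field.
  rewrite powRD ?powRr1//; last by rewrite pnatr_eq0 implybT.
  rewrite powR12_sqrt//; set s := Num.sqrt 2.
  have s0 : 0 < s by rewrite sqrtr_gt0.
  have s2 : s * s = 2 by rewrite -expr2 sqr_sqrtr.
  have sV : s^-1 = s / 2 by apply: (@mulfI _ s); rewrite ?gt_eqF// divff ?gt_eqF// mulrA s2 divff.
  by rewrite sV; nra.
have [d /andP[md dm] ->] := @rho_second_derivative R (3 / 2) m.
have d0 : 0 < d by apply: lt_trans md; rewrite ltr0n.
rewrite (_ : 3 / 2 * (3 / 2 - 1) / 2 = 3 / 8); last by field.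
rewrite (_ : 3 / 2 - 2 = - 2^-1); last by field.
rewrite ler_pM2l ?divr_gt0// !powRN lef_pV2 ?posrE ?powR_gt0 ?ltr0n//.
by apply: ge0_ler_powR; rewrite ?nnegrE ?(ltW d0) ?(ltW dm).
Qed.

Lemma rho32_le m : rho32 m.+2 <= 3 / 8 * m.+1%:R `^ (- 2^-1).
Proof.
have := @rho_le_shift R (3 / 2) ltac:(by rewrite divr_gt0) (lexx _) m.
rewrite (_ : 3 / 2 - 2 = - 2^-1); last by field.
exact: le_trans (ler_norm _).
Qed.

End rho_critical.

(** * Power sums and harmonic sums *)

Section power_sums.
Context {R : realType}.

(** Comparison with the integral of x^(-beta), by the mean value theorem on each unit step; one
    formula serves beta < 1 and beta > 1. *)
Lemma sum_powR_le (beta : R) n : 0 < beta -> beta != 1 ->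
  \sum_(0 <= m < n.+1) (m.+1%:R : R) `^ (- beta) <=
  1 + (n.+1%:R `^ (1 - beta) - 1) / (1 - beta).
Proof.
move=> b0 b1; elim: n => [|n IHn].
  by rewrite big_nat1 !powR1 subrr mul0r addr0.
rewrite big_nat_recr//= (le_trans (lerD IHn (lexx _)))//.
rewrite -addrA lerD2l -lerBrDl -mulrBl opprB addrA subrK.
have n1 : (0 : R) < n.+1%:R by rewrite ltr0n.
have [|c /andP[nc cn] ->] := @powR_MVT R (1 - beta) n.+1%:R n.+2%:R n1.
  by rewrite ltr_nat.
have -> : n.+2%:R - n.+1%:R = 1 :> R by rewrite -[n.+2%:R]natr1 addrAC subrr add0r.
rewrite mulr1 [_ * _ / _]mulrAC divff ?subr_eq0 1?eq_sym// mul1r.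
rewrite addrAC subrr add0r !powRN lef_pV2 ?posrE ?powR_gt0 ?ltr0n//; last exact: lt_trans nc.
apply: ge0_ler_powR; rewrite ?nnegrE ?(ltW b0) ?(ltW cn)//.
by rewrite ltW// (lt_trans n1).
Qed.

Lemma harmonic_le n : \sum_(0 <= m < n.+1) (m.+1%:R : R)^-1 <= 1 + ln n.+1%:R.
Proof.
elim: n => [|n IHn]; first by rewrite big_nat1 invr1 ln1 addr0.
rewrite big_nat_recr//= (le_trans (lerD IHn (lexx _)))// -addrA lerD2l.
have n2 : (0 : R) < n.+2%:R by rewrite ltr0n.
have n1 : (0 : R) < n.+1%:R by rewrite ltr0n.
rewrite -lerBrDl -opprB lerNr -ln_div ?posrE//.
rewrite (_ : n.+1%:R / n.+2%:R = 1 + (- n.+2%:R^-1)); last first.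
  rewrite -[n.+2%:R]natr1 in n2 *; move: (n.+1%:R : R) n1 n2 => x x0 x1.
  by field; rewrite gt_eqF.
by apply: le_ln1Dx; rewrite ltrN2 invf_lt1// ltr1n.
Qed.

Lemma harmonic_ge n : ln n.+1%:R <= \sum_(0 <= m < n) (m.+1%:R : R)^-1.
Proof.
elim: n => [|n IHn]; first by rewrite big_geq// ln1.
rewrite big_nat_recr//= (le_trans _ (lerD IHn (lexx _)))//.
have n2 : (0 : R) < n.+2%:R by rewrite ltr0n.
have n1 : (0 : R) < n.+1%:R by rewrite ltr0n.
rewrite -lerBlDl -ln_div ?posrE//.
rewrite (_ : n.+2%:R / n.+1%:R = 1 + n.+1%:R^-1); last first.
  by rewrite -[n.+2%:R]natr1; field; rewrite gt_eqF.
apply: le_ln1Dx; apply: (@lt_trans _ _ 0); first by rewrite oppr_lt0.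
by rewrite invr_gt0.
Qed.

(** Each distance to x occurs at most once below x and once from x on, whence the factor 2. *)
Lemma sum_dist_le (phi : nat -> R) x n : (forall m, 0 <= phi m) -> (x < n)%N ->
  \sum_(0 <= y < n) phi (maxn x y - minn x y)%N <= 2 * \sum_(0 <= m < n) phi m.
Proof.
move=> phi0 xn; rewrite (@big_cat_nat _ _ _ x)//=; last exact: ltnW.
rewrite mulr2n mulrDl mul1r lerD//.
  rewrite big_nat_rev /= add0n.
  apply: (@le_trans _ _ (\sum_(0 <= y < x) phi y.+1)).
    rewrite le_eqVlt; apply/orP; left; apply/eqP; rewrite big_nat [RHS]big_nat.
    apply: eq_bigr => y /andP[_ yx]; congr phi; lia.
  have -> : \sum_(0 <= m < n) phi m = phi 0%N + \sum_(0 <= y < n.-1) phi y.+1.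
    by case: n xn => // n xn; rewrite big_nat_recl.
  rewrite (@big_cat_nat _ _ _ x 0 n.-1)//=; last by lia.
  have h : 0 <= \sum_(x <= i < n.-1) phi i.+1 by apply: sumr_ge0.
  have := phi0 0%N; lra.
rewrite -{1}(add0n x) big_addn.
apply: (@le_trans _ _ (\sum_(0 <= y < n - x) phi y)).
  rewrite le_eqVlt; apply/orP; left; apply/eqP; apply: eq_bigr => y _.
  by congr phi; lia.
rewrite [leRHS](@big_cat_nat _ _ _ (n - x)%N)//=; last by lia.
by rewrite lerDl; apply: sumr_ge0.
Qed.

End power_sums.

(** * Sums over 4-cycles *)

Section four_cycles.
Context {R : realType}.
Variables (n : nat) (t : 'I_n -> 'I_n -> R) (B : R).
Hypothesis t_sym : forall i j, t i j = t j i.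
Hypothesis t_row : forall i, \sum_j t i j ^+ 4 <= B.

Let v i j := t i j ^+ 4.
Let v_ge0 i j : 0 <= v i j. Proof. by rewrite /v exprn_even_ge0. Qed.
Let v_sym i j : v i j = v j i. Proof. by rewrite /v t_sym. Qed.

(** Summed from the free end of the path: the vertices l, k and j cost one row sum B each, and i
    costs n. *)
Let path_sum_le :
  \sum_i \sum_j \sum_k \sum_l v i j * v j k * v k l <= n%:R * B ^+ 3.
Proof.
have step (c : R) i : 0 <= c -> \sum_j c * v i j <= c * B.
  by move=> c0; rewrite -mulr_sumr; apply: ler_wpM2l => //; exact: t_row.
have B0 : (0 < n)%N -> 0 <= B.
  move=> n0; apply: le_trans (t_row (Ordinal n0)); apply: sumr_ge0 => j _; exact: v_ge0.
apply: (@le_trans _ _ (\sum_(i < n) B ^+ 3)); last first.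
  by rewrite sumr_const card_ord mulr_natl.
apply: ler_sum => i _; have B1 := B0 (leq_ltn_trans (leq0n _) (ltn_ord i)).
apply: (@le_trans _ _ (\sum_j \sum_k v i j * v j k * B)).
  by do 2 (apply: ler_sum => ? _); apply: step; rewrite mulr_ge0.
apply: (@le_trans _ _ (\sum_j v i j * B * B)).
  apply: ler_sum => j _; rewrite -mulr_suml ler_wpM2r//; exact: step.
rewrite -!mulr_suml (_ : B ^+ 3 = B * B * B); last by ring.
by do 2 (apply: ler_wpM2r => //); exact: t_row.
Qed.

Lemma four_cycle_sum_le :
  \sum_i \sum_j \sum_k \sum_l (t i j * t i k * t j l * t k l) ^+ 3 <= n%:R * B ^+ 3.
Proof.
(* AM-GM over the four spanning paths of the 4-cycle i-j-l-k-i. *)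
have amgm (w x y z : R) : (w * x * y * z) ^+ 3 <=
   4^-1 * (x ^+ 4 * y ^+ 4 * z ^+ 4 + w ^+ 4 * y ^+ 4 * z ^+ 4 +
    w ^+ 4 * x ^+ 4 * z ^+ 4 + w ^+ 4 * x ^+ 4 * y ^+ 4).
  have H (b c d e : R) : b * c * d * e <= 4^-1 * (b ^+ 4 + c ^+ 4 + d ^+ 4 + e ^+ 4).
    have H2 (r s : R) : r * s <= 2^-1 * (r ^+ 2 + s ^+ 2).
      by have := sqr_ge0 (r - s); rewrite sqrrB; lra.
    have := H2 (b * c) (d * e); have := H2 (b ^+ 2) (c ^+ 2); have := H2 (d ^+ 2) (e ^+ 2).
    have e4 (r : R) : r ^+ 4 = (r ^+ 2) ^+ 2 by rewrite -exprM.
    rewrite [(b * c) ^+ 2]exprMn [(d * e) ^+ 2]exprMn !e4 => h1 h2 h3.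
    by rewrite -[b * c * d * e]mulrA; lra.
  have := H (x * y * z) (w * y * z) (w * x * z) (w * x * y).
  rewrite !exprMn; apply: le_trans; rewrite le_eqVlt; apply/orP; left; apply/eqP; ring.
apply: (@le_trans _ _ (\sum_i \sum_j \sum_k \sum_l
   4^-1 * (v i k * v j l * v k l + v i j * v j l * v k l +
     v i j * v i k * v k l + v i j * v i k * v j l))).
  by do 4 (apply: ler_sum => ? _); exact: amgm.
have -> : \sum_i \sum_j \sum_k \sum_l
   4^-1 * (v i k * v j l * v k l + v i j * v j l * v k l +
     v i j * v i k * v k l + v i j * v i k * v j l) =
   4^-1 * (\sum_i \sum_j \sum_k \sum_l v i k * v j l * v k l +
   \sum_i \sum_j \sum_k \sum_l v i j * v j l * v k l +
   \sum_i \sum_j \sum_k \sum_l v i j * v i k * v k l +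
   \sum_i \sum_j \sum_k \sum_l v i j * v i k * v j l).
  rewrite -!big_split mulr_sumr; apply: eq_bigr => i _ /=.
  rewrite -!big_split mulr_sumr; apply: eq_bigr => j _ /=.
  rewrite -!big_split mulr_sumr; apply: eq_bigr => k _ /=.
  by rewrite -!big_split mulr_sumr.
(* Each of the four path sums is relabelled into i-j-k-l by exchanging sums and using symmetry. *)
have E1 : \sum_i \sum_j \sum_k \sum_l v i k * v j l * v k l =
    \sum_i \sum_j \sum_k \sum_l v i j * v j k * v k l.
  apply: eq_bigr => i _; rewrite exchange_big; apply: eq_bigr => k _ /=.
  rewrite exchange_big; apply: eq_bigr => l _ /=; apply: eq_bigr => j _.
  by rewrite [v j l]v_sym; ring.
have E2 : \sum_i \sum_j \sum_k \sum_l v i j * v j l * v k l =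
    \sum_i \sum_j \sum_k \sum_l v i j * v j k * v k l.
  apply: eq_bigr => i _; apply: eq_bigr => j _; rewrite exchange_big /=.
  by apply: eq_bigr => l _; apply: eq_bigr => k _; rewrite [v k l]v_sym.
have E3 : \sum_i \sum_j \sum_k \sum_l v i j * v i k * v k l =
    \sum_i \sum_j \sum_k \sum_l v i j * v j k * v k l.
  rewrite exchange_big /=; apply: eq_bigr => i _; apply: eq_bigr => j _.
  by rewrite [v j i]v_sym.
have E4 : \sum_i \sum_j \sum_k \sum_l v i j * v i k * v j l =
    \sum_i \sum_j \sum_k \sum_l v i j * v j k * v k l.
  transitivity (\sum_i \sum_k \sum_j \sum_l v i j * v i k * v j l).
    by apply: eq_bigr => i _; rewrite exchange_big.
  rewrite exchange_big /=; apply: eq_bigr => k _; apply: eq_bigr => i _.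
  by apply: eq_bigr => j _; apply: eq_bigr => l _; rewrite [v i k]v_sym; ring.
by rewrite E1 E2 E3 E4; have := path_sum_le; lra.
Qed.

End four_cycles.

(** * Covariance estimates and the noncritical rates *)

Section covariance_bounds.
Context {R : realType}.
Variable a : R.
Hypothesis a_gt0 : 0 < a.
Hypothesis a_le : a <= 3 / 2.

(** [maxn j k - minn j k] is |j - k| in the naturals. The second term is the correction that
    distinguishes the subfractional from the fractional increments. *)
Definition subfractional_cov (j k : nat) : R :=
  rho a (maxn j k - minn j k) - rho a (j + k).+1.

Local Notation cov := subfractional_cov.

(** The correction has the larger argument j + k + 1, so the decreasing majorant at |j - k| serves
    for both terms: 18 = 9 + 9. *)
Lemma subfractional_cov_le j k :
  `|cov j k| <= 18 * (maxn j k - minn j k).+1%:R `^ (a - 2).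
Proof.
rewrite (le_trans (ler_normB _ _))//.
have h1 := @rho_decay R a a_gt0 a_le (maxn j k - minn j k).
have h2 := @rho_decay R a a_gt0 a_le (j + k).+1.
have h3 : (j + k).+2%:R `^ (a - 2) <= (maxn j k - minn j k).+1%:R `^ (a - 2) :> R.
  rewrite -(opprB 2 a) !powRN lef_pV2 ?posrE ?powR_gt0 ?ltr0n//.
  apply: ge0_ler_powR; rewrite ?nnegrE//; first by move: a_le; lra.
  by rewrite ler_nat; lia.
lra.
Qed.

Lemma subfractional_cov_diag j : 1 / 2 <= cov j j.
Proof.
rewrite /cov maxnn minnn subnn rho0//.
have := @rho_le_half R a a_gt0 a_le (j + j).
by rewrite ler_norml => /andP[_]; lra.
Qed.

Definition cov_square_sum n : R := \sum_(j < n) \sum_(k < n) cov j k ^+ 2.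

(** This is tr(C^4), with the indices in the order in which the variance of W produces them. *)
Definition cov_fourth_sum n : R :=
  \sum_(j < n) \sum_(k < n) cov j k *
    \sum_(i < n) \sum_(l < n) cov j i * cov k l * cov i l.

Lemma cov_square_sum_ge n : n%:R / 4 <= cov_square_sum n.
Proof.
apply: (@le_trans _ _ (\sum_(j < n) 4^-1)).
  by rewrite sumr_const card_ord mulr_natl.
apply: ler_sum => j _; rewrite (bigD1 j)//= -[leLHS]addr0 lerD//.
  by have := subfractional_cov_diag j; nra.
by apply: sumr_ge0 => k _; exact: sqr_ge0.
Qed.

(** The decay exponent of the majorant of |C_jk|^(4/3). It crosses 1 at a = 5/4, that is H = 5/8,
    which separates the regimes. *)
Let beta := 4 / 3 * (2 - a).
Let B n : R := 2 * \sum_(0 <= m < n) m.+1%:R `^ (- beta).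

(** Each edge of the 4-cycle carries [t], the cube root of the covariance majorant up to its
    constant: a product of four majorants is then a cube, as the 4-cycle estimate requires, and the
    fourth powers of [t] have exponent [- beta]. *)
Lemma cov_fourth_sum_le n : cov_fourth_sum n <= 18 ^+ 4 * (n%:R * B n ^+ 3).
Proof.
pose t (i j : 'I_n) : R := (maxn i j - minn i j).+1%:R `^ ((a - 2) / 3).
have t_ge0 i j : 0 <= t i j by exact: powR_ge0.
have t_sym i j : t i j = t j i by rewrite /t maxnC minnC.
have covt (i j : 'I_n) : `|cov i j| <= 18 * t i j ^+ 3.
  rewrite (le_trans (subfractional_cov_le i j))// ler_wpM2l//.
  rewrite -powR_mulrn ?powR_ge0// -powRrM divfK//.
have t_row i : \sum_j t i j ^+ 4 <= B n.
  have := @sum_dist_le R (fun m => m.+1%:R `^ (- beta)) i n (fun m => powR_ge0 _ _) (ltn_ord i).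
  apply: le_trans; rewrite big_mkord le_eqVlt; apply/orP; left; apply/eqP.
  apply: eq_bigr => j _; rewrite /t -powR_mulrn ?powR_ge0// -powRrM; congr (_ `^ _).
  by rewrite /beta; field.
apply: (@le_trans _ _ (18 ^+ 4 * \sum_i \sum_j \sum_k \sum_l (t i j * t i k * t j l * t k l) ^+ 3)).
  rewrite mulr_sumr; apply: ler_sum => i _; rewrite mulr_sumr; apply: ler_sum => j _.
  rewrite !mulr_sumr; apply: ler_sum => k _; rewrite !mulr_sumr; apply: ler_sum => l _.
  rewrite (le_trans (ler_norm _))// !normrM mulrA mulrA.
  apply: (@le_trans _ _ ((18 * t i j ^+ 3) * (18 * t i k ^+ 3) * (18 * t j l ^+ 3) * (18 * t k l ^+ 3))).
    by do 3 (apply: ler_pM; rewrite ?mulr_ge0//).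
  by rewrite le_eqVlt; apply/orP; left; apply/eqP; ring.
by rewrite ler_wpM2l ?exprn_ge0// (four_cycle_sum_le t_sym t_row).
Qed.

(** X^2 measures tr(C^4) and n L measures D, so X / (n L) is the rate. L is 1 except in the critical
    case, where it is log n. *)
Lemma combine_rate (K c L X : R) n : 0 < c -> 0 < L -> 0 <= X -> 0 <= K ->
  c * (n.+1%:R * L) <= cov_square_sum n.+1 ->
  cov_fourth_sum n.+1 <= K * X ^+ 2 ->
  2 * Num.sqrt (2 * cov_fourth_sum n.+1) / cov_square_sum n.+1 <=
  2 * Num.sqrt (2 * K) / c * (X / (n.+1%:R * L)).
Proof.
move=> c0 L0 X0 K0 hD hT.
have nL : 0 < n.+1%:R * L by rewrite mulr_gt0// ltr0n.
have cnL : 0 < c * (n.+1%:R * L) by rewrite mulr_gt0.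
have D0 : 0 < cov_square_sum n.+1 by exact: lt_le_trans hD.
have hs : Num.sqrt (2 * cov_fourth_sum n.+1) <= Num.sqrt (2 * K) * X.
  rewrite -[X in _ <= _ * X](ger0_norm X0) -sqrtr_sqr -sqrtrM ?mulr_ge0//.
  by apply: ler_wsqrtr; rewrite -mulrA ler_wpM2l.
rewrite (_ : _ / c * _ = 2 * (Num.sqrt (2 * K) * X) / (c * (n.+1%:R * L))); last first.
  by field; rewrite !gt_eqF.
rewrite ler_pM ?mulr_ge0 ?sqrtr_ge0 ?invr_ge0 ?(ltW D0)//; first by rewrite ler_wpM2l.
by rewrite lef_pV2 ?posrE.
Qed.

Let beta_gt0 : 0 < beta.
Proof. by rewrite /beta; move: a_le; lra. Qed.

Let B_ge0 n : 0 <= B n.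
Proof. by rewrite mulr_ge0// sumr_ge0// => m _; exact: powR_ge0. Qed.

(** Here beta > 1 and the row sums stay bounded, so tr(C^4) is O(n) and X = sqrt n. *)
Lemma kolmogorov_rate_lt : a < 5 / 4 -> exists2 c : R, 0 < c & forall n,
  2 * Num.sqrt (2 * cov_fourth_sum n.+1) / cov_square_sum n.+1 <=
  c * (1 / Num.sqrt n.+1%:R).
Proof.
move=> a54; have b1 : 1 < beta by rewrite /beta; lra.
pose b := 2 * (1 + (beta - 1)^-1).
have b_gt0 : 0 < b by rewrite mulr_gt0// addr_gt0// invr_gt0 subr_gt0.
pose K := 18 ^+ 4 * b ^+ 3.
have K_gt0 : 0 < K by rewrite mulr_gt0// exprn_gt0.
exists (2 * Num.sqrt (2 * K) / 4^-1).
  by rewrite divr_gt0// mulr_gt0// sqrtr_gt0 mulr_gt0.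
move=> n; have n0 : (0 : R) < n.+1%:R by rewrite ltr0n.
have Bb : B n.+1 <= b.
  rewrite /B /b ler_wpM2l// (le_trans (sum_powR_le n beta_gt0 _)) ?gt_eqF//.
  rewrite lerD2l -(opprB beta 1) invrN mulrN -mulNr opprB ler_pdivrMr ?subr_gt0//.
  by rewrite mulVf ?subr_eq0 ?gt_eqF// gerBl powR_ge0.
have -> : 1 / Num.sqrt n.+1%:R = Num.sqrt n.+1%:R / (n.+1%:R * 1) :> R.
  rewrite mulr1 -{3}(sqr_sqrtr (ltW n0)) expr2 invfM mulrA divff ?gt_eqF ?sqrtr_gt0//.
apply: combine_rate; rewrite ?sqrtr_ge0 ?(ltW K_gt0) ?invr_gt0//.
  by rewrite mulr1 mulrC; exact: cov_square_sum_ge.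
rewrite sqr_sqrtr ?(ltW n0)// (le_trans (cov_fourth_sum_le _))//.
rewrite (_ : K * _ = 18 ^+ 4 * (n.+1%:R * b ^+ 3)); last by rewrite /K; ring.
rewrite ler_wpM2l ?exprn_ge0// ler_wpM2l ?(ltW n0)//.
by rewrite lerXn2r ?nnegrE ?B_ge0 ?(ltW b_gt0).
Qed.

(** Here beta = 1: the row sums are O(log n) and X is sqrt n (log n)^(3/2). Starting at n = 2 keeps
    log n >= log 2 > 0, which absorbs the 1 of the harmonic bound. *)
Lemma kolmogorov_rate_eq : a = 5 / 4 -> exists2 c : R, 0 < c & forall n,
  2 * Num.sqrt (2 * cov_fourth_sum n.+2) / cov_square_sum n.+2 <=
  c * (ln n.+2%:R `^ (3 / 2) / Num.sqrt n.+2%:R).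
Proof.
move=> a54; have b1 : beta = 1 by rewrite /beta a54; field.
have ln2 : 0 < ln (2 : R) by apply: ln_gt0; rewrite ltr1n.
pose b := 2 * ((ln 2)^-1 + 1) : R.
have b_gt0 : 0 < b by rewrite mulr_gt0// addr_gt0// invr_gt0.
pose K := 18 ^+ 4 * b ^+ 3.
have K_gt0 : 0 < K by rewrite mulr_gt0// exprn_gt0.
exists (2 * Num.sqrt (2 * K) / 4^-1).
  by rewrite divr_gt0// mulr_gt0// sqrtr_gt0 mulr_gt0.
move=> n; have n0 : (0 : R) < n.+2%:R by rewrite ltr0n.
set L := ln n.+2%:R.
have L2 : ln 2 <= L by rewrite /L ler_ln ?posrE// ler_nat.
have L0 : 0 < L by exact: lt_le_trans L2.
have Bb : B n.+2 <= b * L.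
  rewrite /B b1 /b -mulrA ler_wpM2l//.
  under eq_bigr do rewrite powR_inv1//.
  rewrite (le_trans (harmonic_le _))// mulrDl mul1r lerD2r.
  by rewrite mulrC ler_pdivlMr// mul1r.
have -> : L `^ (3 / 2) / Num.sqrt n.+2%:R = (Num.sqrt n.+2%:R * L `^ (3 / 2)) / (n.+2%:R * 1).
  rewrite mulr1 -{3}(sqr_sqrtr (ltW n0)); field.
  by rewrite gt_eqF// sqrtr_gt0.
apply: combine_rate; rewrite ?(ltW K_gt0) ?invr_gt0//.
- by rewrite mulr_ge0 ?sqrtr_ge0 ?powR_ge0.
- by rewrite mulr1 mulrC; exact: cov_square_sum_ge.
have L3 : (L `^ (3 / 2)) ^+ 2 = L ^+ 3.
  by rewrite -powR_mulrn ?powR_ge0// -powRrM divfK// powR_mulrn// ltW.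
rewrite exprMn sqr_sqrtr ?(ltW n0)// L3 (le_trans (cov_fourth_sum_le _))//.
rewrite (_ : K * _ = 18 ^+ 4 * (n.+2%:R * (b * L) ^+ 3)); last by rewrite /K; ring.
rewrite ler_wpM2l ?exprn_ge0// ler_wpM2l ?(ltW n0)//.
have bL0 : 0 <= b * L by apply: mulr_ge0; exact: ltW.
by rewrite lerXn2r ?nnegrE ?B_ge0 ?bL0.
Qed.

(** The row sums are O(n^(1 - beta)), and 1 + 3 (1 - beta) = 4 a - 4. Kept apart from the rate
    because the case a = 3/2 combines it with a better bound on D. *)
Lemma cov_fourth_sum_gt : 5 / 4 < a -> exists2 K : R, 0 < K & forall n,
  cov_fourth_sum n.+1 <= K * (n.+1%:R `^ (2 * a - 2)) ^+ 2.
Proof.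
move=> a54; have b1 : beta < 1 by rewrite /beta; lra.
have b10 : 0 < 1 - beta by rewrite subr_gt0.
pose b := 2 / (1 - beta).
have b_gt0 : 0 < b by rewrite divr_gt0.
exists (18 ^+ 4 * b ^+ 3); first by rewrite mulr_gt0// exprn_gt0.
move=> n; have n0 : (0 : R) < n.+1%:R by rewrite ltr0n.
have Bb : B n.+1 <= b * n.+1%:R `^ (1 - beta).
  rewrite /B /b -mulrA ler_wpM2l// (le_trans (sum_powR_le n beta_gt0 _)) ?lt_eqF//.
  have : 1 <= (1 - beta)^-1 by rewrite invf_ge1// gerBl ltW.
  rewrite mulrBl mul1r [_^-1 * _]mulrC; lra.
have -> : (n.+1%:R `^ (2 * a - 2)) ^+ 2 = n.+1%:R * (n.+1%:R `^ (1 - beta)) ^+ 3 :> R.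
  rewrite -!powR_mulrn ?powR_ge0// -!powRrM.
  rewrite -[X in _ = X * _]powRr1 ?(ltW n0)// -powRD; last by rewrite (gt_eqF n0) implybT.
  by congr (_ `^ _); rewrite /beta; field.
rewrite (le_trans (cov_fourth_sum_le _))//.
move: (n.+1%:R) (B n.+1) (B_ge0 n.+1) Bb n0 => N B1 B10 Bb n0.
have c_ge0 : 0 <= 18 ^+ 4 :> R by exact: exprn_ge0.
move: (18 ^+ 4) c_ge0 => c c_ge0; rewrite -mulrA; apply: ler_wpM2l => //.
rewrite [leRHS]mulrCA; apply: ler_wpM2l; first exact: ltW.
have bL0 : 0 <= b * N `^ (1 - beta).
  by apply: mulr_ge0; [exact: ltW|exact: powR_ge0].
by rewrite -exprMn lerXn2r ?nnegrE ?B10 ?bL0.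
Qed.

Lemma kolmogorov_rate_gt : 5 / 4 < a -> exists2 c : R, 0 < c & forall n,
  2 * Num.sqrt (2 * cov_fourth_sum n.+1) / cov_square_sum n.+1 <=
  c * n.+1%:R `^ (2 * a - 3).
Proof.
move=> a54; have [K K0 HK] := cov_fourth_sum_gt a54.
exists (2 * Num.sqrt (2 * K) / 4^-1).
  by rewrite divr_gt0// mulr_gt0// sqrtr_gt0 mulr_gt0.
move=> n; have n0 : (0 : R) < n.+1%:R by rewrite ltr0n.
have -> : n.+1%:R `^ (2 * a - 3) = n.+1%:R `^ (2 * a - 2) / (n.+1%:R * 1) :> R.
  rewrite mulr1 -[X in _ / X]powRr1 ?(ltW n0)// -powRB ?(gt_eqF n0) ?implybT//.
  by congr (_ `^ _); ring.
apply: combine_rate; rewrite ?(ltW K0) ?powR_ge0 ?invr_gt0//.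
by rewrite mulr1 mulrC; exact: cov_square_sum_ge.
Qed.

End covariance_bounds.

(** * The critical case H = 3/4 *)

Section critical_case.
Context {R : realType}.
Local Notation a := (3 / 2 : R).
Local Notation cov := (subfractional_cov a).

Let a_gt0 : 0 < a. Proof. by rewrite divr_gt0. Qed.

(** For j >= 4 q > 4 p the argument of the correction is so much larger than p that the correction
    takes at most half of the main term: 3/8 - 3/16 = 3/16. *)
Lemma critical_cov_ge (q j p : nat) : (4 * q <= j)%N -> (p < q)%N ->
  3 / 16 * p.+1%:R `^ (- 2^-1) <= cov j (j + p).
Proof.
move=> qj pq; rewrite /subfractional_cov.
have -> : (maxn j (j + p) - minn j (j + p))%N = p by lia.
have [m mE] : exists m, (j + (j + p)).+1 = m.+2 by exists (j + (j + p)).-1; lia.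
have h1 := @rho32_ge R p; rewrite mE; have h2 := @rho32_le R m.
have h3 : m.+1%:R `^ (- 2^-1) <= 2^-1 * p.+1%:R `^ (- 2^-1) :> R.
  rewrite !powRN -invfM lef_pV2 ?posrE ?mulr_gt0 ?powR_gt0 ?ltr0n//.
  rewrite !powR12_sqrt//.
  rewrite -ler_sqr ?nnegrE ?mulr_ge0 ?sqrtr_ge0// exprMn !sqr_sqrtr//.
  by rewrite -natrX -natrM ler_nat; lia.
lra.
Qed.

Lemma sum_nat_sub (F : nat -> R) x y n : (forall j, 0 <= F j) ->
  (x <= y)%N -> (y <= n)%N -> \sum_(x <= j < y) F j <= \sum_(0 <= j < n) F j.
Proof.
move=> F0 xy yn; rewrite (@big_cat_nat _ _ _ x 0 n)//=; last exact: leq_trans yn.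
rewrite (@big_cat_nat _ _ _ y x n)//=.
have h1 : 0 <= \sum_(0 <= j < x) F j by apply: sumr_ge0.
have h2 : 0 <= \sum_(y <= j < n) F j by apply: sumr_ge0.
lra.
Qed.

(** Large n needs 32 c0 <= 18/256 and n < 64 needs 64 c0 <= 1/4; 1/512 satisfies both. *)
Let c0 : R := 512^-1.

Let c0_gt0 : 0 < c0.
Proof. by rewrite /c0 invr_gt0 ltr0n. Qed.

(** rho(m)^2 is of order 1 / m, so a row contributes a harmonic sum. With q about n / 8, the rows
    from 4 q to 6 q are far enough down for the correction to be harmless and still have q columns
    from the diagonal on. *)
Lemma critical_square_sum_ge n :
  c0 * (n.+2%:R * ln n.+2%:R) <= cov_square_sum a n.+2.
Proof.
set N := n.+2; have N0 : (0 : R) < N%:R by rewrite ltr0n.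
(* For small n the diagonal bound n / 4 is enough, with log n <= 64. *)
have [N64|N64] := ltnP N 64.
  apply: le_trans (cov_square_sum_ge a_gt0 (lexx _) N).
  have : ln N%:R <= 64 :> R.
    by rewrite (le_trans (ltW (ln_sublinear N0)))// ler_nat ltnW.
  have : 0 <= ln N%:R :> R by rewrite ln_ge0// ler1n.
  move: (ln _) => l l0 l64; have : 0 <= N%:R * (64 - l).
    by apply: mulr_ge0; rewrite ?subr_ge0// ltW.
  by rewrite /c0; nra.
pose q := (N %/ 8)%N.
have q1 : (N < 8 * q.+1)%N by rewrite /q; lia.
have q2 : (8 * q <= N)%N by rewrite /q; lia.
have q8 : (8 <= q)%N by rewrite /q; lia.
(* (q + 1)^2 >= N because N < 8 (q + 1) and q >= 8. *)
have lnq : 2^-1 * ln N%:R <= ln q.+1%:R :> R.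
  rewrite ler_pdivrMl// mulr_natl -lnXn ?ltr0n// -natrX ler_ln ?posrE ?ltr0n//.
  by rewrite ler_nat; nia.
have lnq0 : 0 <= ln q.+1%:R :> R by rewrite ln_ge0// ler1n.
have row j : (4 * q <= j < 6 * q)%N -> 9 / 256 * ln q.+1%:R <= \sum_(0 <= k < N) cov j k ^+ 2.
  move=> /andP[j4 j6].
  apply: (@le_trans _ _ (\sum_(j <= k < j + q) cov j k ^+ 2)); last first.
    apply: sum_nat_sub; [by move=> k; exact: sqr_ge0|lia|lia].
  have -> : \sum_(j <= k < j + q) cov j k ^+ 2 = \sum_(0 <= p < q) cov j (p + j) ^+ 2.
    by rewrite -[X in \sum_(X <= _ < _) _]add0n big_addn addKn.
  apply: (@le_trans _ _ (9 / 256 * \sum_(0 <= p < q) p.+1%:R^-1)).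
    by rewrite ler_wpM2l// harmonic_ge.
  rewrite mulr_sumr !big_mkord; apply: ler_sum => p _; rewrite addnC.
  have h := critical_cov_ge j4 (ltn_ord p).
  have h0 : 0 <= 3 / 16 * p.+1%:R `^ (- 2^-1) :> R by rewrite mulr_ge0// powR_ge0.
  have -> : 9 / 256 / p.+1%:R = (3 / 16 * p.+1%:R `^ (- 2^-1)) ^+ 2 :> R.
    rewrite exprMn -[(_ `^ _) ^+ 2]powR_mulrn ?powR_ge0// -powRrM mulNr mulVf//.
    by rewrite powR_inv1//; move: (p.+1%:R^-1) => r; field.
  by rewrite lerXn2r ?nnegrE// (le_trans h0).
have -> : cov_square_sum a N = \sum_(0 <= j < N) \sum_(0 <= k < N) cov j k ^+ 2.
  by rewrite big_mkord; apply: eq_bigr => j _; rewrite big_mkord.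
apply: (@le_trans _ _ (\sum_(4 * q <= j < 6 * q) \sum_(0 <= k < N) cov j k ^+ 2)); last first.
  apply: sum_nat_sub; [|lia|lia].
  by move=> j; apply: sumr_ge0 => k _; exact: sqr_ge0.
apply: (@le_trans _ _ (\sum_(4 * q <= j < 6 * q) (9 / 256 * ln q.+1%:R))); last first.
  by rewrite big_nat [leRHS]big_nat; apply: ler_sum => j; exact: row.
rewrite sumr_const_nat -mulnBl -[leRHS]mulr_natr natrM.
have Nq : N%:R <= 16 * q%:R :> R by rewrite -natrM ler_nat; lia.
have q0 : 0 <= q%:R :> R by [].
have lnN : 0 <= ln N%:R :> R by rewrite ln_ge0// ler1n.
apply: (@le_trans _ _ (c0 * (16 * q%:R * (2 * ln q.+1%:R)))).
  apply: ler_wpM2l; first exact: ltW.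
  apply: ler_pM => //.
  by rewrite -ler_pdivrMl.
have : 0 <= q%:R * ln q.+1%:R :> R by rewrite mulr_ge0.
rewrite (_ : (6 - 4)%N = 2%N)// /c0; lra.
Qed.

(** Here 2 a - 2 = 1, so X = n, and L = log n makes the rate X / (n L) equal to 1 / log n. *)
Lemma kolmogorov_rate_critical : exists2 c : R, 0 < c & forall n,
  2 * Num.sqrt (2 * cov_fourth_sum a n.+2) / cov_square_sum a n.+2 <=
  c * (1 / ln n.+2%:R).
Proof.
have [K K0 HK] := @cov_fourth_sum_gt R a a_gt0 (lexx _) ltac:(lra).
exists (2 * Num.sqrt (2 * K) / c0).
  by rewrite divr_gt0// mulr_gt0// sqrtr_gt0 mulr_gt0.
move=> n; have n0 : (0 : R) < n.+2%:R by rewrite ltr0n.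
have L0 : 0 < ln n.+2%:R :> R by rewrite ln_gt0// ltr1n.
have -> : 1 / ln n.+2%:R = n.+2%:R / (n.+2%:R * ln n.+2%:R) :> R.
  by field; rewrite !gt_eqF.
apply: combine_rate; rewrite ?(ltW K0) ?(ltW n0)//.
  exact: critical_square_sum_ge.
have := HK n.+1; rewrite (_ : 2 * a - 2 = 1); last by field.
by rewrite powRr1.
Qed.

End critical_case.

(** * Increments of subfractional Brownian motion *)

Section second_order_expectations.
Context {R : realType} {d} {T : measurableType d} (P : probability T R).

Lemma variance_centered (X : T -> R) : all_moments P X -> \int[P]_w X w = 0 ->
  variance P X = (\int[P]_w (X w ^+ 2))%:E.
Proof.
move=> MX X0; have E0 : (\int[P]_w (X w)%:E = 0)%E.
  rewrite -[LHS]fineK; first by rewrite -[fine _]/(\int[P]_w X w) X0.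
  by apply: integrable_fin_num => //; exact: all_moments_integrable.
rewrite /variance covariance.unlock expectation.unlock E0 /=.
rewrite /Rintegral fineK; last first.
  apply: integrable_fin_num => //; apply: all_moments_integrable.
  exact: all_momentsX.
by apply: eq_integral => w _; rewrite -[((X \- cst 0) * _) w]/((X w - 0) * (X w - 0)) subr0 -expr2.
Qed.

End second_order_expectations.

Section subfractional_increments.
Context {R : realType} (H : R) {d} {T : measurableType d} (P : probability T R)
  (S : R -> {RV P >-> R}).
Hypothesis sS : subfractional_brownian_motion H S.

Let S_gauss t : 0 <= t -> gaussian_rv P (S t).
Proof.
move=> t0; have [gS _ _] := sS.
have := @gS 1%N (fun=> t) (fun=> 1) (fun=> t0).
by congr gaussian_rv; apply/funext => w; rewrite big_ord1 mul1r.
Qed.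

Let S_center t : 0 <= t -> (\int[P]_w (S t w)%:E = 0)%E.
Proof. by move=> t0; have [_ cS _] := sS; have := cS t t0; rewrite expectation.unlock. Qed.

Let S_moments t : 0 <= t -> all_moments P (S t).
Proof.
move=> t0; apply: (@gaussian_all_moments _ _ _ P (eq (S t : T -> R))) => //.
- by move=> _ <-; exact: measurable_funPT.
- by move=> _ <-; exact: S_gauss.
- by move=> _ <-; exact: S_center.
Qed.

Let S_mean t : 0 <= t -> \int[P]_w S t w = 0.
Proof. by move=> t0; rewrite /Rintegral S_center. Qed.

Let S_cov s t : 0 <= s -> 0 <= t ->
  \int[P]_w (S s w * S t w) = subfractional_covariance H s t.
Proof.
by move=> s0 t0; have [_ _ cS] := sS; have := cS s t s0 t0; rewrite expectation.unlock /Rintegral => ->.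
Qed.

Variable n : nat.
Hypothesis n_gt0 : (0 < n)%N.

Let nR_gt0 : (0 : R) < n%:R. Proof. by rewrite ltr0n. Qed.

Let time_ge0 k : 0 <= k%:R / n%:R :> R. Proof. by rewrite divr_ge0. Qed.

Lemma increment_all_moments k : all_moments P (increment S n k).
Proof.
rewrite /increment; under eq_fun do rewrite -mulN1r.
by apply: all_momentsD; [|apply: all_momentsZ]; exact: S_moments.
Qed.

Lemma increment_mean k : \int[P]_w increment S n k w = 0.
Proof. by rewrite /increment expectB ?S_mean ?subrr//; exact: S_moments. Qed.

Lemma scaled_subfractional_covariance j k :
  n%:R `^ (2 * H) * subfractional_covariance H (j%:R / n%:R) (k%:R / n%:R) =
  j%:R `^ (2 * H) + k%:R `^ (2 * H) -
  2^-1 * ((j + k)%:R `^ (2 * H) + `|k%:R - j%:R| `^ (2 * H)).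
Proof.
have scale (x : R) : 0 <= x -> n%:R `^ (2 * H) * (x / n%:R) `^ (2 * H) = x `^ (2 * H).
  move=> x0; rewrite -powRM// ?divr_ge0//; congr (_ `^ _).
  by rewrite mulrC divfK// gt_eqF.
rewrite /subfractional_covariance -mulrDl -mulrBl normrM (ger0_norm (_ : 0 <= n%:R^-1))//.
rewrite -natrD -(scale j%:R)// -(scale k%:R)// -(scale (j + k)%:R)// -(scale `|_|)//.
ring.
Qed.

(** Self-similarity removes n. In the mixed second difference of the covariance the terms s^(2H) and
    t^(2H) cancel, |t - s|^(2H) gives rho(|j - k|), and (s + t)^(2H) gives -rho(j + k + 1). *)
Lemma scaled_increment_covariance j k :
  n%:R `^ (2 * H) * \int[P]_w (increment S n j w * increment S n k w) =
  subfractional_cov (2 * H) j k.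
Proof.
have -> : \int[P]_w (increment S n j w * increment S n k w) =
    subfractional_covariance H (j.+1%:R / n%:R) (k.+1%:R / n%:R) -
    subfractional_covariance H (j.+1%:R / n%:R) (k%:R / n%:R) -
    (subfractional_covariance H (j%:R / n%:R) (k.+1%:R / n%:R) -
    subfractional_covariance H (j%:R / n%:R) (k%:R / n%:R)).
  rewrite -!S_cov// -!expectB; first last.
  - by apply: all_momentsM; exact: S_moments.
  - by apply: all_momentsM; exact: S_moments.
  - by apply: all_momentsM; exact: S_moments.
  - by apply: all_momentsM; exact: S_moments.
  - under eq_fun do rewrite -mulrBr.
    apply: all_momentsM; first exact: S_moments.
    exact: increment_all_moments.
  - under eq_fun do rewrite -mulrBr.
    apply: all_momentsM; first exact: S_moments.
    exact: increment_all_moments.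
  by apply: eq_Rintegral => w _; rewrite /increment; ring.
have distr (p x y z t : R) : p * (x - y - (z - t)) = p * x - p * y - (p * z - p * t).
  by ring.
rewrite distr !scaled_subfractional_covariance /subfractional_cov /rho.
set a := 2 * H.
have -> : `|(j + k).+1%:R - 1| = (j + k)%:R :> R.
  by rewrite -natr1 addrK ger0_norm.
rewrite !addSn !addnS.
(* By symmetry k = j + m, which removes [maxn], [minn] and every absolute value except the |m - 1|
   that [rho] contains. *)
wlog jk : j k / (j <= k)%N.
  move=> wl; case/orP: (leq_total j k) => [/wl//|/wl E].
  rewrite maxnC minnC [(j + k)%N]addnC -E.
  by rewrite !(distrC k.+1%:R) !(distrC k%:R); ring.
rewrite (maxn_idPr jk) (minn_idPl jk).
have [m ->] : exists m, k = (j + m)%N by exists (k - j)%N; lia.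
rewrite addKn.
have -> : `|(j + m).+1%:R - j.+1%:R| = m%:R :> R.
  by rewrite -!natr1 natrD (_ : _ - _ = m%:R) ?ger0_norm//; ring.
have -> : `|(j + m)%:R - j%:R| = m%:R :> R.
  by rewrite natrD (_ : _ - _ = m%:R) ?ger0_norm//; ring.
have -> : `|(j + m)%:R - j.+1%:R| = `|m%:R - 1| :> R.
  by rewrite -natr1 natrD; congr `|_|; ring.
have -> : `|(j + m).+1%:R - j%:R| = m.+1%:R :> R.
  by rewrite -!natr1 natrD (_ : _ - _ = m%:R + 1) ?ger0_norm//; ring.
by move: (_ `^ a) => ?; field.
Qed.

Let xi (i : 'I_n) w := n%:R `^ H * increment S n i w.

Let xi_moments i : all_moments P (xi i).
Proof. by apply: all_momentsZ; exact: increment_all_moments. Qed.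

Let xi_center i : (\int[P]_w (xi i w)%:E = 0)%E.
Proof.
rewrite -[LHS]fineK; last first.
  by apply: integrable_fin_num => //; exact: all_moments_integrable.
rewrite -[fine _]/(\int[P]_w xi i w) expectZ; last exact: increment_all_moments.
by rewrite increment_mean mulr0.
Qed.

(** A combination of n increments is a combination of 2 n values of S, at the times (i + 1) / n and
    i / n; [gaussian_process] allows repeated times. *)
Let xi_gauss (a : 'I_n -> R) : gaussian_rv P (fun w => \sum_i a i * xi i w).
Proof.
have [gS _ _] := sS.
pose t (i : 'I_(n + n)%N) : R :=
  match fintype.split i with inl i => i.+1%:R / n%:R | inr i => i%:R / n%:R end.
pose c (i : 'I_(n + n)%N) : R :=
  match fintype.split i with inl i => a i * n%:R `^ H | inr i => - (a i * n%:R `^ H) end.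
have t0 i : 0 <= t i by rewrite /t; case: fintype.split => ?; exact: time_ge0.
have := @gS (n + n)%N t c t0.
congr gaussian_rv; apply/funext => w; rewrite big_split_ord /= -big_split /=.
apply: eq_bigr => i _; rewrite /t /c (unsplitK (inl i)) (unsplitK (inr i)).
by rewrite /xi /increment; ring.
Qed.

Let n2H : n%:R `^ H * n%:R `^ H = n%:R `^ (2 * H) :> R.
Proof. by rewrite -powRD ?(gt_eqF nR_gt0) ?implybT//; congr (_ `^ _); ring. Qed.

Let xi_cov i j : \int[P]_w (xi i w * xi j w) = subfractional_cov (2 * H) i j.
Proof.
rewrite -scaled_increment_covariance -n2H -expectZ; last first.
  by apply: all_momentsM; exact: increment_all_moments.
by apply: eq_Rintegral => w _; rewrite /xi; ring.
Qed.

Let Q w := \sum_i xi i w ^+ 2.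
Let tau := \sum_i \int[P]_w (xi i w * xi i w).

Lemma centered_quadratic_variationE w :
  centered_quadratic_variation H S n w = Q w - tau.
Proof.
rewrite /centered_quadratic_variation big_mkord -sumrB; apply: eq_bigr => i _.
rewrite variance_centered; [|exact: increment_all_moments|exact: increment_mean].
rewrite /= mulrBr -n2H; congr (_ - _); first by rewrite /xi; ring.
rewrite -expectZ; last by apply: all_momentsX; exact: increment_all_moments.
by apply: eq_Rintegral => v _; rewrite /xi; ring.
Qed.

Lemma kolmogorov_distance_quadratic_variation (d' : measure_display)
    (T' : measurableType d') (Pr : probability T' R) (N : {RV Pr >-> R}) :
  0 < 2 * H <= 3 / 2 -> has_law Pr N (normal_prob 0 1) ->
  (kolmogorov_distance P (normalized P (centered_quadratic_variation H S n)) Pr N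
   <= (2 * Num.sqrt (2 * cov_fourth_sum (2 * H) n) / cov_square_sum (2 * H) n)%:E)%E.
Proof.
move=> /andP[a0 a32] law.
have xi_meas i : measurable_fun [set: T] (xi i) by case: (xi_moments i).
have D0 : 0 < cov_square_sum (2 * H) n.
  by apply: lt_le_trans (cov_square_sum_ge a0 a32 n); rewrite divr_gt0.
have DE : \sum_i \sum_j (\int[P]_w (xi i w * xi j w)) ^+ 2 = cov_square_sum (2 * H) n.
  by apply: eq_bigr => i _; apply: eq_bigr => j _; rewrite xi_cov.
have TE : \sum_j \sum_k (\int[P]_w (xi j w * xi k w)) *
    (\sum_i \sum_l (\int[P]_w (xi j w * xi i w)) * (\int[P]_w (xi k w * xi l w)) *
       (\int[P]_w (xi i w * xi l w))) = cov_fourth_sum (2 * H) n.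
  apply: eq_bigr => j _; apply: eq_bigr => k _; rewrite xi_cov; congr (_ * _).
  by apply: eq_bigr => i _; apply: eq_bigr => l _; rewrite !xi_cov.
have MQ := quadratic_all_moments xi_meas xi_gauss xi_center.
have VQ := quadratic_variance xi_meas xi_gauss xi_center.
have ZE : centered_quadratic_variation H S n = (fun w => Q w - tau).
  by apply/funext => w; exact: centered_quadratic_variationE.
have Vn : variance P (centered_quadratic_variation H S n) = (2 * cov_square_sum (2 * H) n)%:E.
  rewrite ZE variance_centered; first by rewrite VQ DE.
    by under eq_fun do rewrite -mulN1r; apply: all_momentsD => //; exact: all_moments_cst.
  rewrite expectB ?expect_cst//; last exact: all_moments_cst.
  by rewrite /Q expect_sum ?subrr// => i; exact: all_momentsX.
rewrite (_ : normalized _ _ = (fun w => (Q w - tau) / Num.sqrt (2 * cov_square_sum (2 * H) n))); last first.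
  by apply/funext => w; rewrite /normalized Vn ZE.
have := kolmogorov_distance_quadratic xi_meas xi_gauss xi_center.
by rewrite DE TE => /(_ _ _ _ _ D0 law).
Qed.

End subfractional_increments.

Theorem mainTheorem1 (R : realType) (H : R) (H_gt0 : 0 < H) (H_le : H <= 3 / 4) :
  exists c : R, 0 < c /\
    forall (d : measure_display) (T : measurableType d) (P : probability T R)
           (S : R -> {RV P >-> R}),
      subfractional_brownian_motion H S ->
    forall (d' : measure_display) (T' : measurableType d')
           (Q : probability T' R) (N : {RV Q >-> R}),
      has_law Q N (normal_prob 0 1) ->
    forall n : nat, (first_index H <= n)%N ->
      (kolmogorov_distance P (normalized P (centered_quadratic_variation H S n)) Q N
         <= (c * rate H n)%:E)%E.
Proof.
have a0 : 0 < 2 * H by rewrite mulr_gt0.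
have a1 : 2 * H <= 3 / 2 by move: H_le; lra.
(* What remains is deterministic: an estimate of tr(C^4) and D in terms of H and n alone, so the
   constant cannot depend on the process or its probability space. *)
suff [c c0 hc] : exists2 c : R, 0 < c & forall n, (first_index H <= n)%N ->
    2 * Num.sqrt (2 * cov_fourth_sum (2 * H) n) / cov_square_sum (2 * H) n <= c * rate H n.
  exists c; split => // d T P S sS d' T' Q N law n hn.
  have n0 : (0 < n)%N by apply: leq_trans hn; rewrite /first_index; case: ifP.
  apply: (le_trans (kolmogorov_distance_quadratic_variation sS n0 _ law)).
    by rewrite a0.
  by rewrite lee_fin; exact: hc.
rewrite /first_index /rate.
have [H58|H58|H58] := ltgtP H (5 / 8).
- have [c c0 hc] := kolmogorov_rate_lt a0 a1 ltac:(move: H58; lra).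
  have -> /= : (H == 3 / 4) = false by apply/eqP; move: H58; lra.
  by exists c => // -[|n]// _; exact: hc.
- have [H34|H34|H34] := ltgtP H (3 / 4).
  + have [c c0 hc] := kolmogorov_rate_gt a0 a1 ltac:(move: H58; lra).
    exists c => // -[|n]// _; apply: (le_trans (hc n)).
    by rewrite (_ : 2 * (2 * H) = 4 * H)//; ring.
  + by exfalso; move: H34 H_le; lra.
  + have [c c0 hc] := @kolmogorov_rate_critical R.
    exists c => // -[|[|n]]// _; rewrite H34 (_ : 2 * (3 / 4) = 3 / 2 :> R); last by field.
    exact: hc.
- have [c c0 hc] := kolmogorov_rate_eq a0 a1 ltac:(move: H58; lra).
  by exists c => // -[|[|n]]// _; exact: hc.
Qed.
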